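(* Let $L$ be an oriented link in $\mathbb{S}^3$. Then the odd Khovanov homology groups of type X and of type Y of $L$ are isomorphic as bigraded abelian groups: $\mathrm{Kh}'_X(L)\cong \mathrm{Kh}'_Y(L)$.
   Context: **Configurations.** An $n$-dimensional (oriented) configuration $\mathcal C$ is a finite set of disjoint circles embedded in the oriented sphere $\mathbb{S}^2$ together with $n$ disjoint embedded (oriented) arcs, numbered $1,\dots,n$, whose boundary points lie on the circles and whose interiors are disjoint from the circles, up to orientation-preserving diffeomorphisms of $\mathbb{S}^2$. $|\mathcal C|$ is the number of circles; $\overline{\mathcal C}$ is the configuration obtained by forgetting the orientations of the arcs. Surgery along an arc $\gamma$: in a small neighbourhood of $\gamma$, the two circle segments at the ends of $\gamma$ are replaced by two segments parallel to $\gamma$, one on each side. The dual configuration $\mathcal C^*$ is obtained by surgery along all arcs, each arc $\gamma$ being replaced by an arc crossing $\gamma$ once and connecting the two new segments, oriented as $\gamma$ rotated by 90 degrees counter-clockwise. A circle is passive if it is disjoint from all arcs, otherwise active; $\mathrm{act}(\mathcal C)$ is $\mathcal C$ without its passive circles; $\mathcal C$ is active if it has no passive circles. The passive circles of $\mathcal C$ and $\mathcal C^*$ are the same. **Hypercube.** $\mathfrak F(n,k)$ is the set of $a\in\{0,1,*\}^n$ with exactly $k$ entries $*$; $a^0,a^1\in\mathfrak F(n,0)$ arise from $a$ by replacing all $*$ by $0$, resp. $1$. For $a\in\mathfrak F(n,0)$, $|a|=\sum_i a_i$. For an $n$-dimensional $\mathcal C$ and $a\in\mathfrak F(n,k)$,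 $\mathrm R(\mathcal C,a)$ is the $k$-dimensional oriented configuration obtained by surgery along the arcs $i$ with $a_i=1$ and then removing all arcs $i$ with $a_i\neq *$. The circles of $\mathrm R(\mathcal C,a)$ are those of $\mathrm R(\mathcal C,a^0)$, and the circles of $\mathrm R(\mathcal C,a)^*$ are those of $\mathrm R(\mathcal C,a^1)$. **Chain groups.** $\mathrm V(\mathcal C)$ is the free abelian group on the circles of $\mathcal C$, and $\mathrm C(\mathcal C)=\bigoplus_{a\in\mathfrak F(n,0)}\Lambda \mathrm V(\mathrm R(\mathcal C,a))$ ($\Lambda$ = exterior algebra). The summand $\Lambda^m\mathrm V(\mathrm R(\mathcal C,a))$ has h-grading $|a|$ and $\delta$-grading $|\mathrm R(\mathcal C,a)|-2m-|a|$. **Edge maps.** Let $\mathcal C$ be a 1-dimensional oriented configuration and $\omega$ a wedge product of passive circles. If $\mathrm{act}(\mathcal C)$ is a join (two circles $x_1,x_2$ connected by the arc; $\mathrm{act}(\mathcal C^* )$ has one circle $y$), then $\partial_{\mathcal C}(\omega)=\omega$, $\partial_{\mathcal C}(x_i\wedge\omega)=y\wedge\omega$, $\partial_{\mathcal C}(x_1\wedge x_2\wedge\omega)=0$. If it is a split (one circle $y$; the arc of $\mathcal C^*$ points from a circle $x_1$ to a circle $x_2$), then $\partial_{\mathcal C}(\omega)=(x_1-x_2)\wedge\omega$, $\partial_{\mathcal C}(y\wedge\omega)=x_1\wedge x_2\wedge\omega$. This defines $\partial_{\mathcal C}:\Lambda\mathrm V(\mathcal C)\to\Lambda\mathrm V(\mathcal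 C^* )$. **Types of squares.** For a 2-dimensional oriented configuration $\mathcal C$ put $P=\partial_{\mathrm R(\mathcal C,(1,* ))}\circ\partial_{\mathrm R(\mathcal C,( *,0))}$ and $Q=\partial_{\mathrm R(\mathcal C,( *,1))}\circ\partial_{\mathrm R(\mathcal C,(0,* ))}$. $\mathcal C$ is of type K if $P=Q\neq0$ and of type A if $P=-Q\ne 0$. In the only remaining cases ($P=Q=0$), $\mathrm{act}(\mathcal C)$ is one circle $x$ with two arcs on different sides of $x$ whose boundary points alternate along $x$. Choose a direction on $x$, called clockwise, and call the side on the right the interior; let $\gamma$ be the arc in the interior and $\delta$ the arc in the exterior, with starting points $\gamma^0,\delta^0$ and end points $\gamma^1,\delta^1$. $\mathcal C$ is of type Y if the clockwise cyclic order is $\gamma^0,\delta^0,\gamma^1,\delta^1$ and of type X if it is $\gamma^0,\delta^1,\gamma^1,\delta^0$ (independent of the choice). **Edge assignments.** An edge assignment is a map $\varepsilon:\mathfrak F(n,1)\to\{-1,1\}$; for $s\in\mathfrak F(n,2)$, $p(s,\varepsilon)$ is the product of the values of $\varepsilon$ on the four edges of $s$. $\varepsilon$ is of type X with respect to $\mathcal C$ if for all $s$: $p(s,\varepsilon)=1$ when $\mathrm R(\mathcal C,s)$ is of type A or X, and $-1$ when it is of type K or Y. $\varepsilon$ is of type Y with respect to $\mathcal C$ if for all $s$: $p(s,\varepsilon)=1$ when $\mathrm R(\mathcal C,s)$ is of type A or Y, and $-1$ when it is of type K or X. Both kinds always exist. **Odd Khovanov complex.** For $\varepsilon$ of type X or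 Y with respect to $\mathcal C$, $\mathrm C(\mathcal C,\varepsilon)$ is $\mathrm C(\mathcal C)$ with differential $\partial(\mathcal C,\varepsilon)=\bigoplus_{b\in\mathfrak F(n,1)}\varepsilon(b)\partial_{\mathrm R(\mathcal C,b)}$, of $(\mathrm h,\delta)$-degree $(1,-2)$. **Links.** Let $\mathcal D$ be a diagram in $\mathbb{S}^2$ (with numbered crossings) of an oriented link, with $\mathrm n_+(\mathcal D)$ positive and $\mathrm n_-(\mathcal D)$ negative crossings. Its 0-resolution is the unoriented configuration obtained by replacing each crossing by its 0-smoothing (the smoothing joining the two regions swept out when the over-strand is rotated counter-clockwise to the under-strand; at a positive crossing this is the oriented smoothing), and adding, for each crossing, the short arc connecting the two resulting segments. If $\overline{\mathcal C}$ is the 0-resolution of $\mathcal D$, then $\mathrm C(\mathcal D,\mathcal C,\varepsilon)$ is $\mathrm C(\mathcal C,\varepsilon)$ with shifted bigrading: $\mathrm C(\mathcal D,\mathcal C)^{\mathrm h}=\mathrm C(\mathcal C)^{\mathrm h+\mathrm n_-(\mathcal D)}$ and $\mathrm C(\mathcal D,\mathcal C)_\delta=\mathrm C(\mathcal C)_{\delta-\mathrm n_+(\mathcal D)}$. By Ozsváth–Rasmussen–Szabó, for each fixed type (X or Y) of $\varepsilon$ with respect to $\mathcal C$, the isomorphism class of the bigraded group $\mathrm H_{\mathrm h,\delta}(\mathrm C(\mathcal D,\mathcal C,\varepsilon))$ depends only on the link $L$ represented by $\mathcal D$; it is denoted $\mathrm{Kh}'_X(L)$ if $\varepsilon$ has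 type X and $\mathrm{Kh}'_Y(L)$ if $\varepsilon$ has type Y. *)

(* Defs.v *)
From HB Require Import structures.
From mathcomp Require Import all_boot all_order all_algebra.
From mathcomp Require Import boolp.

Set Implicit Arguments.
Unset Strict Implicit.
Unset Printing Implicit Defensive.

Import GRing.Theory.

Local Open Scope ring_scope.

(** A configuration is cut at finitely many marked points on its circles, so that
  all arc ends are marked points and every circle carries at least one marked
  point.  A term of [hs] is a half-segment: a marked point together with one of
  the two ways of leaving it along its circle.  [thr] exchanges the two
  half-segments at a point, [seg] the two ends of a segment.
  [tip (i, e, s)] is a half-segment at the starting point ([e = false]) or end
  point ([e = true]) of arc [i].  Looking from that point along the arc, it is
  the one to the left if [s = false] and the one to the right if [s = true].
  Since left and right refer to the orientation of the surface, this records
  the oriented surface spanned by the circles and arcs up to homeomorphism.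
  How the connected components are placed relative to each other in the sphere
  is not recorded; nothing below depends on it.  The surface is not required to
  be planar here: the configurations considered below come from diagrams, for
  which this is a hypothesis (see [spherical]). *)
Record config (n : nat) := Config {
  hs : finType;
  seg : hs -> hs;
  thr : hs -> hs;
  tip : 'I_n * bool * bool -> hs;
  segK : involutive seg;
  seg_neq : forall h, seg h != h;
  thrK : involutive thr;
  thr_neq : forall h, thr h != h;
  tip_inj : injective tip;
  thr_tip : forall i e s, thr (tip (i, e, s)) = tip (i, e, ~~ s)
}.

Section Circles.
Variables (n : nat) (C : config n).

Definition circ_rel : rel (hs C) :=
  fun h h' => (h' == seg h) || (h' == thr h).

Definition circle (h : hs C) : {set hs C} := [set h' | connect circ_rel h h'].

Definition circles : {set {set hs C}} := [set circle h | h : hs C].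

Definition start_circle (i : 'I_n) := circle (tip C (i, false, false)).
Definition end_circle (i : 'I_n) := circle (tip C (i, true, false)).

End Circles.

Section Reorient.
Variables (n : nat) (C : config n) (o : 'I_n -> bool).

Definition flip_end (p : 'I_n * bool * bool) : 'I_n * bool * bool :=
  (p.1.1, p.1.2 (+) o p.1.1, p.2).

Definition reorient_tip p := tip C (flip_end p).

Lemma reorient_tip_inj : injective reorient_tip.
Proof.
move=> [[i e] s] [[j e'] s'] /tip_inj [<- ee <-]; do 2! congr (_, _).
by move: ee; case: e e' (o i) => [] [] [].
Qed.

Lemma reorient_thr_tip i e s :
  thr (reorient_tip (i, e, s)) = reorient_tip (i, e, ~~ s).
Proof. exact: thr_tip. Qed.

Definition reorient : config n :=
  Config (@segK _ C) (@seg_neq _ C) (@thrK _ C) (@thr_neq _ C)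
    reorient_tip_inj reorient_thr_tip.

End Reorient.

(** Surgery along the arcs in [S] reconnects the half-segments at their ends:
  left at one end with right at the other end. *)
Section Surgery.
Variables (n : nat) (C : config n) (S : {set 'I_n}).

Definition surg_thr (h : hs C) : hs C :=
  if [pick p : 'I_n * bool * bool | (p.1.1 \in S) && (tip C p == h)]
    is Some p then tip C (p.1.1, ~~ p.1.2, ~~ p.2) else thr h.

Lemma surg_thr_tip i e s :
  surg_thr (tip C (i, e, s)) =
  if i \in S then tip C (i, ~~ e, ~~ s) else tip C (i, e, ~~ s).
Proof.
rewrite /surg_thr; case: pickP => [[[j e'] s'] /= /andP[jS /eqP/tip_inj[<- <- <-]]|].
  by rewrite jS.
move/(_ (i, e, s)); rewrite /= eqxx andbT => ->; exact: thr_tip.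
Qed.

Lemma surg_thr_out h :
  (forall p, p.1.1 \in S -> tip C p != h) -> surg_thr h = thr h.
Proof.
by rewrite /surg_thr => hP; case: pickP => // p /andP[pS]; rewrite (negPf (hP _ pS)).
Qed.

Lemma surg_case h :
  (exists i e s, i \in S /\ h = tip C (i, e, s)) \/
  (forall p, p.1.1 \in S -> tip C p != h).
Proof.
case: (pickP [pred p : 'I_n * bool * bool | (p.1.1 \in S) && (tip C p == h)]).
  by case=> [[i e] s] /= /andP[iS /eqP<-]; left; exists i, e, s.
by move=> hP; right=> p pS; move: (hP p); rewrite /= pS /= => ->.
Qed.

Lemma surg_thrK : involutive surg_thr.
Proof.
move=> h; have [[i [e [s [iS ->]]]]|hP] := surg_case h.
  by rewrite !surg_thr_tip iS surg_thr_tip iS !negbK.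
rewrite (surg_thr_out hP) surg_thr_out ?thrK // => -[[i e] s] /= iS.
apply: contraNneq (hP (i, e, ~~ s) iS) => ht.
by rewrite -thr_tip ht thrK.
Qed.

Lemma surg_thr_neq h : surg_thr h != h.
Proof.
have [[i [e [s [iS ->]]]]|hP] := surg_case h.
  by rewrite surg_thr_tip iS; apply/eqP => /tip_inj []; case: e.
by rewrite surg_thr_out // thr_neq.
Qed.

End Surgery.

(** The dual arc of an arc [i] pointing north crosses it from east to west: its
  starting point lies between [tip C (i, false, true)], now to the left, and
  [tip C (i, true, false)], now to the right. *)
Section Dual.
Variables (n : nat) (C : config n).

Definition dual_tip (p : 'I_n * bool * bool) : hs C :=
  let: (i, e, s) := p in
  if s then tip C (i, ~~ e, false) else tip C (i, e, true).

Lemma dual_tip_inj : injective dual_tip.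
Proof.
by move=> [[i []] []] [[j []] []] /= /tip_inj [] // ->.
Qed.

Lemma dual_thr_tip i e s :
  surg_thr [set: 'I_n] (dual_tip (i, e, s)) = dual_tip (i, e, ~~ s).
Proof. by case: s; rewrite /= surg_thr_tip in_setT ?negbK. Qed.

Definition dual : config n :=
  Config (@segK _ C) (@seg_neq _ C) (@surg_thrK _ C [set: 'I_n])
    (@surg_thr_neq _ C [set: 'I_n]) dual_tip_inj dual_thr_tip.

End Dual.

(** A vector in [{0, 1, *}^n] is a function to [option bool], with [None] for the
  entry [*]. *)
Definition stars n (a : {ffun 'I_n -> option bool}) : {set 'I_n} :=
  [set i | a i == None].

Definition face (n k : nat) :=
  {a : {ffun 'I_n -> option bool} | #|stars a| == k}.

Section Faces.
Variables (n k : nat).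

Definition ones (a : face n k) : {set 'I_n} := [set i | val a i == Some true].

Definition star (a : face n k) (j : 'I_k) : 'I_n :=
  enum_val (cast_ord (esym (eqP (valP a))) j).

Lemma star_inj a : injective (star a).
Proof. by move=> j j' /enum_val_inj/cast_ord_inj. Qed.

Lemma starP (a : face n k) j : val a (star a j) = None.
Proof. by have := enum_valP (cast_ord (esym (eqP (valP a))) j); rewrite inE => /eqP. Qed.

Lemma star_ones a j : star a j \notin ones a.
Proof. by rewrite inE starP. Qed.

Definition fill_fun (v : bool) (a : face n k) : {ffun 'I_n -> option bool} :=
  [ffun i => Some (odflt v (val a i))].

Lemma fill_subproof v a : #|stars (fill_fun v a)| == 0%N.
Proof. by rewrite cards_eq0; apply/eqP/setP => i; rewrite !inE ffunE. Qed.

(** [fill false a] and [fill true a] are a^0 and a^1. *)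
Definition fill (v : bool) (a : face n k) : face n 0 :=
  exist _ (fill_fun v a) (fill_subproof v a).

Definition subface l (b : face n l) (a : face n k) : bool :=
  [forall i, (val a i != None) ==> (val b i == val a i)].

End Faces.

Definition weight n (a : face n 0) : nat := #|ones a|.

(** The edge of the cube [{0, 1}^n] in direction [i] whose other coordinates are
  given by [v]. *)
Section Edge.
Variables (n : nat) (i : 'I_n) (v : 'I_n -> bool).

Definition edge_fun : {ffun 'I_n -> option bool} :=
  [ffun j => if j == i then None else Some (v j)].

Lemma edge_subproof : #|stars edge_fun| == 1%N.
Proof.
rewrite -(cards1 i); apply/eqP; congr #|pred_of_set _|; apply/setP => j.
by rewrite !inE ffunE; case: (j == i).
Qed.

Definition cube_edge : face n 1 := exist _ edge_fun edge_subproof.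

End Edge.

(** R(C,a): the remaining arcs are renumbered in increasing order. *)
Section Restriction.
Variables (n k : nat) (C : config n) (a : face n k).

Definition res_tip (p : 'I_k * bool * bool) : hs C :=
  tip C (star a p.1.1, p.1.2, p.2).

Lemma res_tip_inj : injective res_tip.
Proof. by move=> [[i e] s] [[j e'] s'] /tip_inj [/star_inj -> -> ->]. Qed.

Lemma res_thr_tip i e s :
  surg_thr (ones a) (res_tip (i, e, s)) = res_tip (i, e, ~~ s).
Proof. by rewrite surg_thr_tip /= (negPf (star_ones a i)). Qed.

Definition restr : config k :=
  Config (@segK _ C) (@seg_neq _ C) (@surg_thrK _ C (ones a))
    (@surg_thr_neq _ C (ones a)) res_tip_inj res_thr_tip.

End Restriction.

(** The exterior algebra over the integers of the free abelian group on a finite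
  set [S].  The coefficient at [A] is the one of the wedge product of the
  elements of [A], taken in the order of [enum S]. *)
Definition ext (S : finType) := {ffun {set S} -> int}.

Section Exterior.
Variable S : finType.

Definition mono (A : {set S}) : ext S := [ffun B => (B == A)%:Z].

Definition gen (x : S) : ext S := mono [set x].

(** The wedge product of the ordered monomials of two disjoint sets [A] and [B]
  is [wsign A B] times the ordered monomial of their union. *)
Definition wsign (A B : {set S}) : int :=
  (-1) ^+ #|[set p in setX A B | (enum_rank p.2 < enum_rank p.1)%N]|.

Definition wedge (f g : ext S) : ext S :=
  [ffun E : {set S} => \sum_(A : {set S} | A \subset E)
     wsign A (E :\: A) * f A * g (E :\: A)].

End Exterior.

(** The circles of [C] and of the configurations obtained from it by surgery are
  subsets of [hs C], and a passive circle is the same subset before and after.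
  So the groups [ext] below are all generated by the subsets of [hs C], and
  Lambda V(C) is the subgroup spanned by the [mono A] with [A \subset circles C];
  [edge_map] is zero on all other [mono A]. *)
Section EdgeMap.
Variable C : config 1.

Let x1 : {set hs C} := start_circle C ord0.
Let x2 : {set hs C} := end_circle C ord0.
Let z1 : {set hs C} := start_circle (dual C) ord0.
Let z2 : {set hs C} := end_circle (dual C) ord0.

(** For [x] in [A], [mono A] is [wsign [set x] (A :\ x)] times the wedge product
  of [gen x] and [mono (A :\ x)].  For a join, [z1 = z2]; for a split,
  [x1 = x2]. *)
Definition edge_mono (A : {set {set hs C}}) : ext {set hs C} :=
  if x1 != x2 then
    match x1 \in A, x2 \in A with
    | false, false => mono A
    | true, false => wedge (gen z1) (mono (A :\ x1)) *~ wsign [set x1] (A :\ x1)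
    | false, true => wedge (gen z1) (mono (A :\ x2)) *~ wsign [set x2] (A :\ x2)
    | true, true => 0
    end
  else if x1 \in A then
    wedge (gen z1) (wedge (gen z2) (mono (A :\ x1))) *~ wsign [set x1] (A :\ x1)
  else wedge (gen z1 - gen z2) (mono A).

Definition edge_map (f : ext {set hs C}) : ext {set hs C} :=
  \sum_(A : {set {set hs C}} | A \subset circles C) edge_mono A *~ f A.

Lemma edge_map_is_zmod_morphism : zmod_morphism edge_map.
Proof.
move=> f g; rewrite /edge_map -sumrB; apply: eq_bigr => A _.
by rewrite !ffunE mulrzBr.
Qed.

HB.instance Definition _ :=
  GRing.isZmodMorphism.Build _ _ edge_map edge_map_is_zmod_morphism.

End EdgeMap.

Section SquareTypes.
Variable C : config 2.

Let i0 : 'I_2 := ord0.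
Let i1 : 'I_2 := ord_max.
Let E (i : 'I_2) (v : bool) (f : ext {set hs C}) : ext {set hs C} :=
  edge_map (C := restr C (cube_edge i (fun=> v))) f.

Definition path_P (f : ext {set hs C}) := E i1 true (E i0 false f).
Definition path_Q (f : ext {set hs C}) := E i0 true (E i1 false f).

Definition type_K : Prop :=
  (forall f, path_P f = path_Q f) /\ (exists f, path_P f <> 0).

Definition type_A : Prop :=
  (forall f, path_P f = - path_Q f) /\ (exists f, path_P f <> 0).

(** A half-segment gives a direction of travel on its circle, and [travel] moves
  on to the next marked point.  Leaving an arc end by its left half-segment, one
  has the arc on the right; leaving by the right half-segment, on the left.  In
  the lists below [g] is therefore the interior arc and [d] the exterior one. *)
Definition travel (h : hs C) : hs C := thr (seg h).

Definition clockwise_from_start (g d : 'I_2) (v : bool) : bool :=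
  subseq [:: tip C (g, false, false); tip C (d, v, true);
             tip C (g, true, false); tip C (d, ~~ v, true)]
         (orbit travel (tip C (g, false, false))).

Definition square_Y : Prop :=
  exists g d : 'I_2, g != d /\ clockwise_from_start g d false.

Definition square_X : Prop :=
  exists g d : 'I_2, g != d /\ clockwise_from_start g d true.

End SquareTypes.

Section EdgeAssignments.
Variables (n : nat) (C : config n) (eps : face n 1 -> int).

Definition edge_assignment : Prop := forall b, eps b = 1 \/ eps b = -1.

Definition square_sign (s : face n 2) : int :=
  \prod_(b : face n 1 | subface b s) eps b.

Definition assignment_X : Prop :=
  edge_assignment /\
  forall s : face n 2,
    (type_A (restr C s) \/ square_X (restr C s) -> square_sign s = 1) /\
    (type_K (restr C s) \/ square_Y (restr C s) -> square_sign s = -1).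

Definition assignment_Y : Prop :=
  edge_assignment /\
  forall s : face n 2,
    (type_A (restr C s) \/ square_Y (restr C s) -> square_sign s = 1) /\
    (type_K (restr C s) \/ square_X (restr C s) -> square_sign s = -1).

End EdgeAssignments.

Section Subquotient.
Variables (V : zmodType) (Z B : zmodClosed V).

Definition subgrp := {x : V | x \in Z}.
HB.instance Definition _ := SubChoice.on subgrp.
HB.instance Definition _ := [SubChoice_isSubZmodule of subgrp by <:].

Definition pull_back : {pred subgrp} := [pred x | val x \in B].

Lemma pull_back_zmod_closed : zmod_closed pull_back.
Proof.
split=> [|x y]; rewrite !inE ?raddf0 ?rpred0 // => xB yB.
by rewrite raddfB rpredB.
Qed.

HB.instance Definition _ := GRing.isZmodClosed.Build _ pull_back pull_back_zmod_closed.

Definition subquotient : zmodType := @Quotient.quot subgrp pull_back.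

End Subquotient.

Definition chain n (C : config n) := {ffun face n 0 -> ext {set hs C}}.
HB.instance Definition _ n (C : config n) := GRing.Zmodule.on (chain C).

Section Complex.
Variables (n : nat) (C : config n) (eps : face n 1 -> int).

Definition diff (f : chain C) : chain C :=
  [ffun a => \sum_(b : face n 1 | fill true b == a)
     (edge_map (C := restr C b) (f (fill false b)) : ext {set hs C}) *~ eps b].

Lemma diff_is_zmod_morphism : zmod_morphism diff.
Proof.
move=> f g; apply/ffunP => a; rewrite !ffunE -sumrB; apply: eq_bigr => b _.
by rewrite !ffunE raddfB mulrzBl.
Qed.

HB.instance Definition _ :=
  GRing.isZmodMorphism.Build _ _ diff diff_is_zmod_morphism.

(** The gradings of [mono A] in the summand at [a]. *)
Definition h_deg (a : face n 0) : int := (weight a)%:Z.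

Definition delta_deg (a : face n 0) (A : {set {set hs C}}) : int :=
  #|circles (restr C a)|%:Z - 2 * #|A|%:Z - (weight a)%:Z.

Definition homog (h d : int) (f : chain C) : bool :=
  [forall a : face n 0, forall A : {set {set hs C}},
    (f a A != 0) ==>
    [&& A \subset circles (restr C a), h_deg a == h & delta_deg a A == d]].

Variables h d : int.

Definition cycles : {pred chain C} := [pred f | homog h d f && (diff f == 0)].

Definition boundaries : {pred chain C} :=
  [pred f | `[< exists2 g, homog (h - 1) (d + 2) g & diff g = f >]].

Lemma homog0 h' d' : homog h' d' 0.
Proof. by apply/forallP => a; apply/forallP => A; rewrite !ffunE eqxx. Qed.

Lemma homogB h' d' f g : homog h' d' f -> homog h' d' g -> homog h' d' (f - g).
Proof.
move=> /forallP hf /forallP hg; apply/forallP => a; apply/forallP => A.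
have /forallP/(_ A)/implyP haf := hf a; have /forallP/(_ A)/implyP hag := hg a.
apply/implyP; rewrite !ffunE.
by have [->|/hag //] := eqVneq (g a A) 0; rewrite subr0.
Qed.

Lemma cycles_zmod_closed : zmod_closed cycles.
Proof.
split=> [|f g]; rewrite !inE ?homog0 ?raddf0 ?eqxx //.
move=> /andP[hf /eqP df] /andP[hg /eqP dg]; rewrite homogB //=.
by rewrite diff_is_zmod_morphism df dg subr0.
Qed.

Lemma boundaries_zmod_closed : zmod_closed boundaries.
Proof.
split=> [|f g]; rewrite !inE; first by apply/asboolP; exists 0; rewrite ?homog0 ?raddf0.
move=> /asboolP[f' hf <-] /asboolP[g' hg <-]; apply/asboolP; exists (f' - g').
  exact: homogB.
exact: diff_is_zmod_morphism.
Qed.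

HB.instance Definition _ := GRing.isZmodClosed.Build _ cycles cycles_zmod_closed.
HB.instance Definition _ :=
  GRing.isZmodClosed.Build _ boundaries boundaries_zmod_closed.

Definition homology : zmodType := subquotient cycles boundaries.

End Complex.

(** Each crossing [i] has four ends.  In counter-clockwise order, starting with the
  one where the lower strand enters, these are [(i, false, false)],
  [(i, false, true)], [(i, true, false)], [(i, true, true)].  So the lower strand
  leaves at [(i, true, false)], and the upper strand leaves at [(i, false, true)]
  if the crossing is positive and at [(i, true, true)] if it is negative. *)
Definition ends (n : nat) : finType := ('I_n * bool * bool)%type.

Definition ccw n (x : ends n) : ends n :=
  let: (i, e, s) := x in if s then (i, ~~ e, false) else (i, e, true).

Definition leaves n (pos : 'I_n -> bool) (x : ends n) : bool :=
  let: (i, e, s) := x in if s then e (+) pos i else e.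

(** Euler's formula for the sphere, summed over the connected components: the
  orbits of [ccw] are the crossings, those of [edge] the edges and those of
  [ccw \o edge] the boundaries of the regions of each component; the number of
  edges is half the number of ends. *)
Definition spherical n (edge : ends n -> ends n) : Prop :=
  (fcard (@ccw n) predT + fcard edge predT + fcard (@ccw n \o edge) predT)%N =
  (#|ends n| + (n_comp (fun x y => (y == edge x) || (x == edge y) ||
                                   (y == ccw x) || (x == ccw y)) predT).*2)%N.

(** [edge] exchanges the two ends of each edge of the diagram, and [loops] is the
  number of components without crossings.  As for configurations, the relative
  position of the connected components is not recorded. *)
Record diagram (n : nat) := Diagram {
  edge : ends n -> ends n;
  pos : 'I_n -> bool;
  loops : nat;
  edgeK : involutive edge;
  edge_leaves : forall x, leaves pos (edge x) = ~~ leaves pos x;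
  edge_spherical : spherical edge
}.

Definition n_pos n (D : diagram n) : nat := #|[set i | pos D i]|.
Definition n_neg n (D : diagram n) : nat := #|[set i | ~~ pos D i]|.

(** The 0-smoothing joins the ends 0 and 1 and the ends 2 and 3 of each crossing,
  in the above order.  A component without crossings gets one marked point.  The
  arcs are given an arbitrary orientation here, from the segment containing the
  ends 0 and 1 to the other one. *)
Section Resolution.
Variables (n : nat) (D : diagram n).

Definition res_hs : finType := (ends n + 'I_(loops D) * bool)%type.

Definition res_seg (h : res_hs) : res_hs :=
  match h with inl x => inl (edge D x) | inr (l, b) => inr (l, ~~ b) end.

Definition res_thr (h : res_hs) : res_hs :=
  match h with
  | inl (i, e, s) => inl (i, e, ~~ s)
  | inr (l, b) => inr (l, ~~ b)
  end.

Definition zero_tip (p : 'I_n * bool * bool) : res_hs := inl p.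

Lemma res_segK : involutive res_seg.
Proof. by case=> [x|[l b]] /=; rewrite ?edgeK ?negbK. Qed.

Lemma res_seg_neq h : res_seg h != h.
Proof.
case: h => [x|[l b]] /=; apply/eqP => -[]; last by case: b.
by move=> ex; have := edge_leaves D x; rewrite ex; case: (leaves _ _).
Qed.

Lemma res_thrK : involutive res_thr.
Proof. by case=> [[[i e] s]|[l b]] /=; rewrite negbK. Qed.

Lemma res_thr_neq h : res_thr h != h.
Proof. by case: h => [[[i e] s]|[l b]] /=; apply/eqP => -[]; [case: s|case: b]. Qed.

Lemma zero_tip_inj : injective zero_tip.
Proof. by move=> p q []. Qed.

Lemma res_thr_zero_tip i e s : res_thr (zero_tip (i, e, s)) = zero_tip (i, e, ~~ s).
Proof. by []. Qed.

Definition zero_resolution : config n :=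
  Config res_segK res_seg_neq res_thrK res_thr_neq zero_tip_inj res_thr_zero_tip.

(** Forgetting the orientations of the arcs of [C] gives the 0-resolution. *)
Definition resolves (C : config n) : Prop :=
  exists o : 'I_n -> bool, C = reorient zero_resolution o.

End Resolution.

Definition bigraded_iso (G G' : int -> int -> zmodType) : Prop :=
  forall h d : int, exists f : {additive G h d -> G' h d}, bijective f.

(** The homology of C(D,C,eps), which represents Kh' of the link of [D]. *)
Definition odd_Kh n (D : diagram n) (C : config n) (eps : face n 1 -> int)
    (h d : int) : zmodType :=
  homology C eps (h + (n_neg D)%:Z) (d - (n_pos D)%:Z).

(* Main.v *)
(** Colour the regions of the diagram like a checkerboard.  The circles of a
  resolution then bound black and white regions, and each arc lies in a region of
  one of the two colours.  The circles and the regions of a connected component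
  form a tree, so there is a unique involution of the free abelian group on the
  circles that fixes a base circle in each component, negates the difference of
  two circles joined by a black arc and fixes that of two circles joined by a
  white arc.  The induced involutions of the exterior algebras commute with the
  join maps, and with the split maps up to a sign that depends on the colour of
  the arc and on its orientations in the two configurations.  Hence they exchange
  the types K and A of a square according to the product of these signs.  In the
  squares of type X or Y the two arcs have different colours, so that the product
  is -1 unless the orientations change the type.  So the products of the signs on
  the squares turn an assignment of type X into one of type Y, and since the cube
  has no first cohomology, the involutions become a chain isomorphism after a
  change of sign at each vertex. *)
From HB Require Import structures.
Require Import Defs.
From mathcomp Require Import all_boot all_order all_algebra.
From mathcomp Require Import perm boolp zify ring.

Set Implicit Arguments.
Unset Strict Implicit.
Unset Printing Implicit Defensive.

Import Order.TTheory GRing.Theory Num.Theory.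

Local Open Scope ring_scope.

(** * Components of finite graphs *)

(** Regions are not part of the data: a diagram is an involution on ends satisfying Euler's formula.
    So the tree of circles and regions is never built, and planarity enters as the equality case of
    a counting bound. The integer [pot] rises by at most one each time a black arc turns white;
    Euler's formula makes the total rise maximal, hence every step sharp ([glueBW]), and this
    replaces the tree. The colouring is not given either; the same bound, applied to a double cover
    that is coloured by construction, produces it.

    The involution is constructed on the dual side, as an operation on integer functions that are
    constant along circles, prescribed by their jumps across arcs. One function can be constant on
    the circles of two adjacent states, and on such functions the two involutions coincide. This
    fact gives the commutation with joins and with splits together, once edge maps are described by
    the common rules [is_edge]. The involution ignores the orientations of the arcs, so the two
    complexes may be built from unrelated orientations; these enter through the sign [eta]. *)

Section Components.
Variable T : finType.
Implicit Types e : rel T.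

Lemma connect_symP e : (forall x y, e x y -> connect e y x) -> connect_sym e.
Proof.
move=> es; have sub : subrel (connect e) (fun x y => connect e y x).
  move=> x y /connectP [p]; elim: p x => [|z p IH] x /=; first by move=> _ ->.
  by move=> /andP[/es zx pzp] ly; apply: connect_trans (IH _ pzp ly) zx.
by move=> x y; apply/idP/idP; apply: sub.
Qed.

Lemma leq_n_comp (T' : finType) e (e' : rel T') (h : T -> T') (a : {pred T}) :
  connect_sym e -> connect_sym e' ->
  (forall x y, x \in a -> y \in a -> connect e' (h x) (h y) -> connect e x y) ->
  (n_comp e a <= n_comp e' predT)%N.
Proof.
move=> es es' ee'; rewrite /n_comp_mem.
rewrite -[X in (X <= _)%N](@card_in_imset _ _ (fingraph.root e' \o h)) => [|x y].
  apply/subset_leq_card/subsetP => _ /imsetP[x _ ->].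
  by rewrite !inE /= (roots_root es').
rewrite !inE => /andP[/eqP rx ax] /andP[/eqP ry ay] /eqP /=.
by rewrite (root_connect es') => /(ee' _ _ ax ay); rewrite -(root_connect es) rx ry => /eqP.
Qed.

(** One added edge between [a] and [b] merges two components unless they already coincide. The
    relations are compared only up to [connect], because in the application the links at a crossing
    are replaced by different ones. *)
Lemma n_comp_add_edge e e' a b : connect_sym e -> connect_sym e' ->
  subrel e (connect e') -> connect e' a b ->
  (forall x y, e' x y -> [|| connect e x y,
     connect e x a && connect e b y | connect e x b && connect e a y]) ->
  n_comp e predT = (n_comp e' predT + ~~ connect e a b)%N.
Proof.
move=> es es' /connect_sub sub ab' sup.
have sup' x y : connect e' x y -> [|| connect e x y,
    connect e x a && connect e b y | connect e x b && connect e a y].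
  move=> /connectP[p]; elim: p x => [|z p IH] x /=; first by move=> _ ->; rewrite connect0.
  move=> /andP[/sup xz pp] /(IH _ pp) zy.
  case/or3P: xz => [xz|/andP[xa bz]|/andP[xb az]];
    case/or3P: zy => [zy|/andP[za by_]|/andP[zb ay]].
  - by rewrite (connect_trans xz zy).
  - by rewrite (connect_trans xz za) by_ orbT.
  - by rewrite (connect_trans xz zb) ay !orbT.
  - by rewrite xa (connect_trans bz zy) orbT.
  - rewrite xa; have ba := connect_trans bz za.
    by rewrite (connect_trans (connect_trans ba _) by_) ?orbT // es.
  - by rewrite (connect_trans xa ay).
  - by rewrite xb (connect_trans az zy) !orbT.
  - by rewrite (connect_trans xb by_).
  - rewrite xb; have ab := connect_trans az zb.
    by rewrite (connect_trans (connect_trans ab _) ay) ?orbT // es.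
case: (boolP (connect e a b)) => [ab|nab].
  rewrite addn0; apply: eq_n_comp => x y; apply/idP/idP; first exact: sub.
  move=> /sup' /or3P[//|/andP[xa by_]|/andP[xb ay]].
    exact: connect_trans xa (connect_trans ab by_).
  by rewrite es in ab; apply: connect_trans xb (connect_trans ab ay).
rewrite /n_comp_mem (cardD1 (fingraph.root e b)) !inE (roots_root es) /= addnC; congr addn.
set S := [predD1 _ & _].
have inj : {in S &, injective (fingraph.root e')}.
  move=> x y; rewrite !inE => /and3P[nx /eqP rx _] /and3P[ny /eqP ry _] /eqP.
  rewrite (root_connect es') => /sup' /or3P[|/andP[_ by_]|/andP[xb _]].
  - by rewrite -(root_connect es) rx ry => /eqP.
  - by move: by_ ny; rewrite -(root_connect es) ry eq_sym => ->.
  - by move: xb nx; rewrite -(root_connect es) rx => ->.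
rewrite -(card_in_imset inj); apply: eq_card => y; rewrite !inE andbT.
apply/imsetP/idP => [[x _ ->]|/eqP ry]; first exact: roots_root.
case: (eqVneq (fingraph.root e y) (fingraph.root e b)) => [yb|nyb]; last first.
  exists (fingraph.root e y); first by rewrite !inE nyb /= andbT; exact: roots_root.
  by rewrite -{1}ry; apply/eqP; rewrite (root_connect es'); apply: sub; apply: connect_root.
(* Components are counted by their roots with that of [b] left out, so the merged component must be
   represented by the root of [a]. *)
exists (fingraph.root e a).
  rewrite !inE andbT (root_connect es) nab /=; exact: roots_root.
rewrite -{1}ry; apply/eqP; rewrite (root_connect es') es'.
apply: connect_trans (_ : connect e' (fingraph.root e a) a) _.
  by apply: sub; rewrite es connect_root.
apply: connect_trans ab' _; apply: sub.
by rewrite -(root_connect es) yb.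
Qed.

End Components.

(** * States of a coloured diagram *)

Section Link.
Variable I : finType.
Notation dart := (I * bool * bool)%type.
Implicit Types (x y : dart) (A : {set I}) (i : I).

(* A dart is an end of a crossing.  [link A x] is the dart joined to [x] at its
  crossing when exactly the crossings in [A] have the 1-smoothing, and [opp x] the
  other dart of the strand through [x]. *)
Definition opp x : dart := (x.1.1, ~~ x.1.2, x.2).

Definition link A x : dart := (x.1.1, x.1.2 (+) (x.1.1 \in A), ~~ x.2).

Definition tog i A : {set I} := [set j | (j \in A) (+) (j == i)].

Lemma in_tog i A j : (j \in tog i A) = (j \in A) (+) (j == i).
Proof. by rewrite inE. Qed.

Lemma togK i : involutive (tog i).
Proof. by move=> A; apply/setP => j; rewrite !in_tog addbK. Qed.

Lemma togC i j A : tog i (tog j A) = tog j (tog i A).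
Proof. by apply/setP => k; rewrite !in_tog addbAC. Qed.

Lemma oppK : involutive opp.
Proof. by move=> [[i e] s]; rewrite /opp /= negbK. Qed.

Lemma linkK A : involutive (link A).
Proof. by move=> [[i e] s]; rewrite /link /= addbK negbK. Qed.

Lemma link_opp A x : link A (opp x) = opp (link A x).
Proof. by case: x => [[i e] s]; rewrite /link /opp /= addNb. Qed.

Lemma link_tog_out i A x : x.1.1 != i -> link (tog i A) x = link A x.
Proof. by move=> xi; rewrite /link in_tog (negPf xi) addbF. Qed.

Lemma link_tog_in i A x : x.1.1 = i -> link (tog i A) x = opp (link A x).
Proof. by move=> xi; rewrite /link /opp in_tog /= xi eqxx addbT addbN. Qed.

Lemma link_other i A x y : x.1.1 = i -> y.1.1 = i -> y.2 = ~~ x.2 ->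
  y = link A x \/ y = link (tog i A) x.
Proof.
case: x y => [[j e] s] [[k e'] s'] /= -> -> ->; rewrite /link /= in_tog eqxx.
by case: e e' (i \in A) => [] [] []; [right|left|left|right|left|right|right|left].
Qed.

Lemma dart_cases i A x y : x.1.1 = i -> y.1.1 = i ->
  [\/ y = x, y = link A x, y = opp x | y = opp (link A x)].
Proof.
case: x y => [[j e] s] [[k e'] s'] /= -> ->; rewrite /link /opp /=.
by case: e s e' s' (i \in A) => [] [] [] [] [];
  [constructor 1|constructor 1|constructor 4|constructor 2|constructor 3|constructor 3
  |constructor 2|constructor 4|constructor 4|constructor 2|constructor 1|constructor 1
  |constructor 2|constructor 4|constructor 3|constructor 3|constructor 3|constructor 3
  |constructor 2|constructor 4|constructor 1|constructor 1|constructor 4|constructor 2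
  |constructor 2|constructor 4|constructor 3|constructor 3|constructor 4|constructor 2
  |constructor 1|constructor 1].
Qed.

End Link.

Section Coloured.
Variables (I : finType) (E : I * bool * bool -> I * bool * bool) (col : I -> bool).
Notation dart := (I * bool * bool)%type.
Implicit Types (x y : dart) (A : {set I}) (i : I).

(** Looking out of the crossing along [x], the black region lies on the counter-clockwise side
    exactly when the colour is [true]. Hence the colours alternate around a crossing, and the two
    ends of an edge have opposite colours. *)
Definition colour x := x.2 (+) col x.1.1.

Hypothesis EK : involutive E.
Hypothesis colour_E : forall x, colour (E x) = ~~ colour x.

(* In the state [A], the arc at [i] lies in a black region. *)
Definition black A i := (i \in A) == col i.

Definition circ_r A : rel dart := fun x y => (y == E x) || (y == link A x).

(* The boundaries of the regions of the state [A], with the crossings in [B]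
  collapsed to points. *)
Definition glue (B : pred I) A : rel dart :=
  fun x y => circ_r A x y || B x.1.1 && (y == opp x).

Definition outer i A : rel dart :=
  fun x y => (y == E x) || (x.1.1 != i) && (y == link A x).

Lemma colour_link A x : colour (link A x) = ~~ colour x.
Proof. by rewrite /colour /= addNb. Qed.

Lemma glue_sym B A : connect_sym (glue B A).
Proof.
apply: connect_symP => x y /orP[/orP[]|/andP[bx]] /eqP->; apply: connect1;
by rewrite /glue /circ_r ?EK ?linkK ?oppK ?eqxx ?orbT //= bx orbT.
Qed.

Lemma circ_sym A : connect_sym (circ_r A).
Proof.
apply: connect_symP => x y /orP[] /eqP->; apply: connect1;
by rewrite /circ_r ?EK ?linkK ?eqxx ?orbT.
Qed.

Lemma outer_tog i A : outer i (tog i A) =2 outer i A.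
Proof.
by move=> x y; rewrite /outer; case: (eqVneq x.1.1 i) => //= xi; rewrite link_tog_out.
Qed.

(* Follow the circle from [x] until it is back at the crossing: edges and links
  alternate and both change the colour. *)
Lemma outer_other i A x : x.1.1 = i ->
  exists2 y, y.1.1 = i & y.2 = ~~ x.2 /\ connect (outer i A) x y.
Proof.
move=> xi; pose f x := link A (E x).
have f_inj : injective f by apply: inj_comp; [apply: inv_inj (@linkK _ A)|apply: inv_inj].
have ex : exists k, (iter k.+1 f x).1.1 == i.
  exists (order f x).-1; rewrite prednK ?order_gt0 //.
  by rewrite (iter_order f_inj) xi.
pose k := ex_minn ex.
have [hk mk] : (iter k.+1 f x).1.1 = i /\ forall j, (j < k)%N -> (iter j.+1 f x).1.1 != i.
  rewrite /k; case: ex_minnP => m /eqP-> mm; split=> // j jm.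
  by apply: contraL jm => /mm; rewrite -leqNgt.
have cf y : colour (f y) = colour y by rewrite colour_link colour_E negbK.
have cit j : colour (iter j f x) = colour x by elim: j => //= j IH; rewrite cf.
have con j : (j <= k)%N -> connect (outer i A) x (iter j f x).
  elim: j => [|j IH] jk; first exact: connect0.
  apply: connect_trans (IH (ltnW jk)) _; apply: (@connect_trans _ _ (E (iter j f x))); apply: connect1.
    by rewrite /outer eqxx.
  by have := mk _ jk; rewrite /outer /= => ->; rewrite eqxx orbT.
exists (E (iter k f x)); first exact: hk.
have Ei : (E (iter k f x)).1.1 = i by exact: hk.
split.
  have := colour_E (iter k f x); rewrite cit /colour Ei xi -addNb.
  by move/(can_inj (addbK _)).
by apply: connect_trans (con k (leqnn k)) (connect1 _); rewrite /outer eqxx.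
Qed.

(** The strand returns at a dart of the other parity, so never at [opp x]. This excludes surgeries
    that turn one circle into one circle. *)
Lemma outer_link i A x : x.1.1 = i ->
  connect (outer i A) x (link A x) \/ connect (outer i A) x (link (tog i A) x).
Proof.
move=> xi; have [y yi [ys xy]] := outer_other A xi.
by case: (link_other A xi yi ys) => <-; [left|right].
Qed.

Lemma outer_glue i A B : subrel (connect (outer i A)) (connect (glue B A)).
Proof.
apply: connect_sub => x y /orP[|/andP[_]] /eqP->; apply: connect1;
by rewrite /glue /circ_r eqxx ?orbT.
Qed.

Lemma outer_circ i A : subrel (connect (outer i A)) (connect (circ_r A)).
Proof.
apply: connect_sub => x y /orP[|/andP[_]] /eqP->; apply: connect1;
by rewrite /circ_r eqxx ?orbT.
Qed.

Lemma circ_glue B A : subrel (connect (circ_r A)) (connect (glue B A)).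
Proof. by apply: connect_sub => x y xy; apply: connect1; rewrite /glue xy. Qed.

Lemma connect_link A x : connect (circ_r A) x (link A x).
Proof. by apply: connect1; rewrite /circ_r eqxx orbT. Qed.

Lemma glue_opp (B : pred I) A x : B x.1.1 -> connect (glue B A) x (opp x).
Proof. by move=> Bx; apply: connect1; rewrite /glue Bx eqxx orbT. Qed.

(** The dart at which the strand from [x] returns is linked to [opp x] by the smoothing that does
    not link it to [x]. *)
Lemma glue_or (B B' : pred I) i A (x : dart) : x.1.1 = i ->
  connect (glue B A) x (opp x) || connect (glue B' (tog i A)) x (opp x).
Proof.
move=> xi.
have key B0 A' : connect (outer i A') x (link (tog i A') x) ->
    connect (glue B0 A') x (opp x).
  move=> ox; apply: connect_trans (outer_glue _ ox) _.
  rewrite link_tog_in // -link_opp glue_sym; apply: circ_glue; exact: connect_link.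
have [ox|ox] := outer_link A xi; last by rewrite key.
rewrite orbC key // togK; by rewrite (eq_connect (outer_tog _ _)).
Qed.

Definition glueB A := glue (black A) A.
Definition glueW A := glue (predC (black A)) A.

Lemma black_tog i A j : black (tog i A) j = black A j (+) (j == i).
Proof. by rewrite /black in_tog; case: (j \in A) (j == i) (col j) => [] [] []. Qed.

(** Once [i] is collapsed its smoothing no longer matters, so [glue B' A] amounts to
    [glue B (tog i A)] with the two linked pairs at [i] joined. *)
Lemma n_comp_tog (B B' : pred I) i A : 
  (forall j, B' j = B j || (j == i)) -> ~~ B i ->
  n_comp (glue B (tog i A)) predT =
  (n_comp (glue B' A) predT + ~~ connect (glue B (tog i A)) (i, false, false) (i, true, false))%N.
Proof.
move=> BB' nBi; apply: n_comp_add_edge; [exact: glue_sym|exact: glue_sym|..].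
- have gi x : x.1.1 = i -> connect (glue B' A) x (link (tog i A) x).
    move=> xi; rewrite link_tog_in //.
    apply: connect_trans (circ_glue B' (connect_link A x)) _.
    by apply: glue_opp; rewrite BB' /= xi eqxx orbT.
  move=> x y /orP[/orP[]|/andP[bx]] /eqP->; first by apply: connect1; rewrite /glue /circ_r eqxx.
    case: (eqVneq x.1.1 i) => xi; first exact: gi.
    by rewrite link_tog_out //; apply: circ_glue; apply: connect_link.
  by apply: glue_opp; rewrite BB' bx.
- by apply: (@glue_opp _ _ (i, false, false)); rewrite BB' eqxx orbT.
have ab x : x.1.1 = i -> connect (glue B (tog i A)) x (i, false, false) ||
    connect (glue B (tog i A)) x (i, true, false).
  move=> xi; pose a := (i, false, false).
  case: (@dart_cases _ i (tog i A) a x) => // ->.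
  - by rewrite connect0.
  - by rewrite glue_sym (circ_glue _ (connect_link _ _)).
  - by rewrite /opp connect0 orbT.
  - by rewrite orbC -link_opp glue_sym (circ_glue _ (connect_link _ _)).
move=> x y; rewrite {1}/glue BB' => xy.
case: (eqVneq x.1.1 i) => xi; last first.
  apply/orP; left; apply: connect1; rewrite /glue /circ_r link_tog_out //.
  by move: xy; rewrite (negPf xi) orbF.
case/orP: xy => [/orP[] /eqP->|/andP[_ /eqP->]].
- by apply/orP; left; apply: connect1; rewrite /glue /circ_r eqxx.
- have := ab _ xi; have := ab (link A x) xi; rewrite ![connect _ (link A x) _]glue_sym.
  case/orP=> la; case/orP=> xa; rewrite ?xa ?la ?orbT //.
    by rewrite (connect_trans xa la).
  by rewrite (connect_trans xa la).
have := ab _ xi; have := ab (opp x) xi; rewrite ![connect _ (opp x) _]glue_sym.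
case/orP=> la; case/orP=> xa; rewrite ?xa ?la ?orbT //.
  by rewrite (connect_trans xa la).
by rewrite (connect_trans xa la).
Qed.

Section Step.
Variables (i : I) (A : {set I}).
Hypothesis bi : black A i.
Let a : dart := (i, false, false).
Let b : dart := (i, true, false).

Lemma n_compB_tog : n_comp (glueB (tog i A)) predT =
  (n_comp (glueB A) predT + ~~ connect (glueB (tog i A)) a b)%N.
Proof.
apply: n_comp_tog => [j|]; rewrite black_tog ?eqxx ?bi //.
by case: eqP => [->|]; rewrite ?bi ?addbF ?orbF ?orbT.
Qed.

Lemma n_compW_tog : n_comp (glueW A) predT =
  (n_comp (glueW (tog i A)) predT + ~~ connect (glueW A) a b)%N.
Proof.
have := @n_comp_tog (predC (black A)) (predC (black (tog i A))) i (tog i A).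
rewrite togK; apply=> [j|] /=; rewrite ?bi // black_tog.
by case: eqP => [->|]; rewrite ?bi ?addbF ?orbF ?orbT.
Qed.

Lemma glueBW_or x : x.1.1 = i ->
  connect (glueB (tog i A)) x (opp x) || connect (glueW A) x (opp x).
Proof. move=> xi; rewrite orbC; exact: glue_or. Qed.

End Step.

(* Making a black arc white raises [pot] by at most one.  In genus 0 the total
  rise from [all_black] to [all_white] is the number of crossings, so that every
  step raises it by exactly one. *)
Definition pot A : int :=
  (n_comp (glueB A) predT)%:Z - (n_comp (glueW A) predT)%:Z.

Definition whites A := #|[set i | ~~ black A i]|.

Lemma whites_tog i A : black A i -> whites (tog i A) = (whites A).+1.
Proof.
move=> bi; rewrite /whites (cardsD1 i) !inE black_tog bi eqxx /= add1n.
congr _.+1; apply: eq_card => j; rewrite !inE black_tog.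
by case: eqP => [->|] /=; rewrite ?bi ?addbF.
Qed.

Lemma pot_tog i A : black A i -> pot (tog i A) <= pot A + 1.
Proof.
move=> bi; rewrite /pot (n_compB_tog bi) (n_compW_tog bi).
have := @glueBW_or i A (i, false, false) (erefl _); rewrite /opp /=.
case: (connect _ _ _) => /=; last by move=> ->; lia.
by case: (connect _ _ _) => /= _; lia.
Qed.

Definition all_black : {set I} := [set i | col i].
Definition all_white : {set I} := [set i | ~~ col i].

Lemma black_all_black i : black all_black i.
Proof. by rewrite /black inE eqxx. Qed.

Lemma black_all_white i : ~~ black all_white i.
Proof. by rewrite /black inE; case: (col i). Qed.

Lemma black_ext A A' : black A =1 black A' -> A = A'.
Proof.
move=> bb; apply/setP => i; have := bb i; rewrite /black.
by case: (i \in A) (i \in A') (col i) => [] [] [].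
Qed.

Lemma whites_ind (P : {set I} -> Prop) :
  P all_black -> (forall i A, black A i -> P A -> P (tog i A)) -> forall A, P A.
Proof.
move=> P0 PS A; have [m] := ubnP (whites A); elim: m A => // m IH A.
case: (pickP (fun i => ~~ black A i)) => [i wi|bA _].
  rewrite -(togK i A); set A' := tog i A => le.
  have bi : black A' i by rewrite black_tog eqxx (negPf wi).
  by apply: PS => //; apply: IH; move: le; rewrite whites_tog.
have -> : A = all_black by apply: black_ext => i; rewrite black_all_black; apply/negbFE/bA.
exact: P0.
Qed.

Lemma blacks_ind (P : {set I} -> Prop) :
  P all_white -> (forall i A, black A i -> P (tog i A) -> P A) -> forall A, P A.
Proof.
move=> P0 PS A; have [m] := ubnP (#|I| - whites A)%N; elim: m A => // m IH A.
case: (pickP (fun i => black A i)) => [i bi|wA _].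
  move=> le; apply: (PS i) => //; apply: IH; rewrite whites_tog //.
  have : (whites (tog i A) <= #|I|)%N by apply: max_card.
  by rewrite whites_tog //; lia.
have -> : A = all_white.
  by apply: black_ext => i; rewrite wA; apply/esym/negbTE/black_all_white.
exact: P0.
Qed.

Lemma pot_le A : pot A <= pot all_black + (whites A)%:Z.
Proof.
elim/whites_ind: A => [|i A bi le]; first by rewrite lerDl.
by rewrite whites_tog //; have := pot_tog bi; lia.
Qed.

Lemma pot_ge A : pot all_white <= pot A + #|I|%:Z - (whites A)%:Z.
Proof.
elim/blacks_ind: A => [|i A bi le].
  have : (whites all_white <= #|I|)%N by apply: max_card.
  lia.
by move: le; rewrite whites_tog //; have := pot_tog bi; lia.
Qed.

Definition total : rel dart := fun x y => [|| y == E x, y == link set0 x | y == opp x].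

Lemma total_sym : connect_sym total.
Proof.
apply: connect_symP => x y /or3P[] /eqP->; apply: connect1;
by rewrite /total ?EK ?linkK ?oppK ?eqxx ?orbT.
Qed.

Lemma glue_total (B : pred I) A : (forall i, B i) ->
  connect (glue B A) =2 connect total.
Proof.
move=> Bt; have st := total_sym.
have lt x : (link A x = link set0 x) \/ (link A x = opp (link set0 x)).
  by rewrite /link /opp /= inE; case: (_ \in A); [right|left]; rewrite ?addbT ?addbF.
have l1 x : connect (glue B A) x (opp x) by apply: glue_opp.
have l2 x : connect total x (opp x) by apply: connect1; rewrite /total eqxx !orbT.
have l3 x : connect (glue B A) x (link A x) by apply/circ_glue/connect_link.
have l4 x : connect total x (link set0 x) by apply: connect1; rewrite /total eqxx !orbT.
move=> x y; apply/idP/idP; apply: connect_sub => {}x {}y.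
  move=> /orP[/orP[]|/andP[_]] /eqP-> //; first by apply: connect1; rewrite /total eqxx.
  by case: (lt x) => -> //; apply: connect_trans (l4 x) _.
move=> /or3P[] /eqP-> //; first by apply: connect1; rewrite /glue /circ_r eqxx.
case: (lt x) => [<-//|] /(congr1 (@opp I)); rewrite oppK => <-.
exact: connect_trans (l3 x) _.
Qed.

Lemma glue_none (B : pred I) A : (forall i, ~~ B i) -> glue B A =2 circ_r A.
Proof. by move=> Bf x y; rewrite /glue (negPf (Bf _)) orbF. Qed.

(** At an extreme state one of the two glued relations is connectedness in the diagram; the other
    leaves the circles, which there bound the regions of one colour. *)
Lemma pot_ends :
  pot all_white - pot all_black =
  (n_comp (circ_r all_white) predT)%:Z + (n_comp (circ_r all_black) predT)%:Z
  - (n_comp total predT).*2%:Z.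
Proof.
rewrite /pot /glueB /glueW.
rewrite (eq_n_comp (glue_total all_black black_all_black)).
rewrite (eq_n_comp (@glue_total (predC (black all_white)) all_white black_all_white)).
rewrite (eq_n_comp (eq_connect (glue_none all_white black_all_white))).
rewrite (eq_n_comp (eq_connect (@glue_none (predC (black all_black)) all_black _))).
  lia.
by move=> i; rewrite /= black_all_black.
Qed.

(** The genus is nonnegative: the left side counts the regions, and as there are two edges per
    crossing, regions minus crossings is the Euler characteristic. *)
Lemma genus_ge0 :
  (n_comp (circ_r all_white) predT + n_comp (circ_r all_black) predT <=
  #|I| + (n_comp total predT).*2)%N.
Proof.
have := pot_ends; have := pot_le all_white; have := pot_ge all_black.
have : (whites all_black <= #|I|)%N by apply: max_card.
have : (whites all_white <= #|I|)%N by apply: max_card.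
lia.
Qed.

Section Planar.
Hypothesis planar :
  (n_comp (circ_r all_white) predT + n_comp (circ_r all_black) predT =
  #|I| + (n_comp total predT).*2)%N.

Lemma pot_planar A : pot A = pot all_black + (whites A)%:Z.
Proof.
have := pot_ends; have := pot_ge A; have := pot_le A; lia.
Qed.

(** If both connections were present, turning [i] white would leave [pot] unchanged, against
    [pot_planar]. *)
Lemma glueBW i A x : black A i -> x.1.1 = i ->
  connect (glueB (tog i A)) x (opp x) -> ~~ connect (glueW A) x (opp x).
Proof.
move=> bi xi xB; apply/negP => xW.
have opp_all B A' y : y.1.1 = i -> connect (glue B A') x (opp x) ->
    connect (glue B A') y (opp y).
  move=> yi xo; have xl : connect (glue B A') x (link A' x) by apply/circ_glue/connect_link.
  have yl : connect (glue B A') (opp x) (link A' (opp x)) by apply/circ_glue/connect_link.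
  case: (dart_cases A' xi yi) => -> //.
  - rewrite -link_opp -(same_connect (@glue_sym _ _) xl) .
    exact: connect_trans xo yl.
  - by rewrite oppK glue_sym.
  rewrite oppK -link_opp glue_sym -(same_connect (@glue_sym _ _) xl).
  exact: connect_trans xo yl.
have := pot_planar (tog i A); rewrite (whites_tog bi) /pot.
have := pot_planar A; rewrite /pot (n_compB_tog bi) (n_compW_tog bi).
have -> := opp_all _ _ (i, false, false) (erefl _) xB.
have -> := opp_all _ _ (i, false, false) (erefl _) xW.
by rewrite /=; lia.
Qed.

End Planar.
End Coloured.

(** * The involution on functions that are constant along circles *)

Section Flips.
Variables (I : finType) (E : I * bool * bool -> I * bool * bool) (col : I -> bool).
Notation dart := (I * bool * bool)%type.
Implicit Types (x y : dart) (A : {set I}) (i : I) (u v w : dart -> int).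

Hypothesis EK : involutive E.
Hypothesis colour_E : forall x, colour col (E x) = ~~ colour col x.
Hypothesis planar :
  (n_comp (circ_r E (all_white col)) predT + n_comp (circ_r E (all_black col)) predT =
  #|I| + (n_comp (total E) predT).*2)%N.

Local Notation black := (black col).

Definition inv A u := forall x, u (E x) = u x /\ u (link A x) = u x.

Definition jump u x := u (opp x) - u x.

(* [v] has the jumps of [u] across white arcs and their negatives across black arcs. *)
Definition flips A u v := inv A v /\
  forall x, jump v x = if black A x.1.1 then - jump u x else jump u x.

Lemma connect_const (T : finType) (S : Type) (e : rel T) (u : T -> S) :
  (forall a b, e a b -> u b = u a) -> forall a b, connect e a b -> u b = u a.
Proof.
move=> ue a b /connectP[p]; elim: p a => [|z p IH] a /=; first by move=> _ ->.
by move=> /andP[/ue <- pp] /(IH _ pp).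
Qed.

Lemma invP A u : inv A u -> forall x y, connect (circ_r E A) x y -> u y = u x.
Proof. by move=> iu; apply: connect_const => x y /orP[] /eqP->; case: (iu x). Qed.

Lemma jump_link A u x : inv A u -> jump u (link A x) = jump u x.
Proof. by move=> iu; rewrite /jump -link_opp; case: (iu x) => _ ->; case: (iu (opp x)) => _ ->. Qed.

Lemma jump_opp u x : jump u (opp x) = - jump u x.
Proof. by rewrite /jump oppK opprB. Qed.

Lemma jump0_in A u i x y : inv A u -> x.1.1 = i -> jump u x = 0 ->
  y.1.1 = i -> jump u y = 0.
Proof.
move=> iu xi u0 yi.
by case: (dart_cases A xi yi) => ->; rewrite ?jump_opp ?jump_link // u0 oppr0.
Qed.

Lemma inv_tog i A u : inv A u -> (forall x, x.1.1 = i -> jump u x = 0) ->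
  inv (tog i A) u.
Proof.
move=> iu u0 x; have [uE ul] := iu x; split=> //.
case: (eqVneq x.1.1 i) => xi; last by rewrite link_tog_out.
rewrite link_tog_in // -[LHS](subrK (u (link A x))) -/(jump _ _) u0 //.
by rewrite add0r.
Qed.

Lemma flips_lift i A u v : black A i -> inv (tog i A) u ->
  (forall x, x.1.1 = i -> jump u x = 0) -> flips A u v -> flips (tog i A) u v.
Proof.
move=> bi iu u0 [iv jv].
have v0 x : x.1.1 = i -> jump v x = 0.
  by move=> xi; rewrite jv xi bi u0 // oppr0.
split; first exact: inv_tog.
move=> x; rewrite black_tog; case: (eqVneq x.1.1 i) => xi; last by rewrite addbF jv.
by rewrite u0 // v0 // oppr0; case: ifP.
Qed.

(** Induction from the all-black state, where negation works, turning one arc white at a time. To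
    apply the induction hypothesis, the function must be constant on the circles of the previous
    state, that is, have no jump at the new white arc. *)
Lemma flips_exists A u : inv A u -> exists v, flips A u v.
Proof.
elim/(@whites_ind _ col): A u => [|i A bi IH] u iu.
  exists (fun x => - u x); split=> x; last by rewrite black_all_black /jump; ring.
  by case: (iu x) => -> ->.
pose x : dart := (i, false, false).
have xi : x.1.1 = i by [].
(* If black arcs connect the two ends of the new white arc, planarity puts these ends on one circle,
   and [u] has no jump there. *)
case: (boolP (connect (glueB E col (tog i A)) x (opp x))) => [xB|nB].
  have u0 : jump u x = 0.
    have nW := glueBW EK colour_E planar bi xi xB.
    case: (outer_link EK colour_E A xi) => ox; last first.
      case/negP: nW; apply: connect_trans (outer_glue _ ox) _.
      rewrite link_tog_in // -link_opp glue_sym //; exact/circ_glue/connect_link.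
    apply/eqP; rewrite subr_eq0; apply/eqP/(invP iu).
    apply: connect_trans (_ : connect _ x (link A x)) _.
      by apply: (@outer_circ _ _ i); rewrite (eq_connect (outer_tog _ _ _)).
    have -> : link A x = link (tog i A) (opp x) by rewrite link_opp link_tog_in // oppK.
    rewrite circ_sym //; exact: connect_link.
  have u0' y : y.1.1 = i -> jump u y = 0 by exact: (jump0_in iu xi u0).
  have iu' : inv A u by rewrite -(togK i A); apply: inv_tog.
  by have [v fv] := IH _ iu'; exists v; apply: flips_lift fv.
(* Otherwise the indicator of what [x] reaches through black arcs jumps only across white arcs,
   where jumps are kept. So a multiple of it can be taken off [u] and added back to the result. *)
pose U y : int := (connect (glueB E col (tog i A)) x y)%:Z.
have cU y z : connect (glueB E col (tog i A)) y z -> U z = U y.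
  by move=> yz; rewrite /U (same_connect_r _ yz) //; apply: glue_sym.
have iU : inv (tog i A) U.
  move=> y; split; apply/cU/circ_glue; last exact: connect_link.
  by apply: connect1; rewrite /circ_r eqxx.
have Ux : U x = 1 by rewrite /U connect0.
have Uo : U (opp x) = 0 by rewrite /U (negPf nB).
(* The jump of [U] at [x] is [-1], so subtracting [e] times [U] cancels the jump of [u]. *)
pose e := - jump u x.
pose w y := u y - e * U y.
have iw : inv (tog i A) w.
  by move=> y; rewrite /w; case: (iu y) => -> ->; case: (iU y) => -> ->.
have w0 : jump w x = 0 by rewrite /jump /w Ux Uo /e /jump; ring.
have w0' y : y.1.1 = i -> jump w y = 0 by exact: (jump0_in iw xi w0).
have iw' : inv A w by rewrite -(togK i A); apply: inv_tog.
have [v /(flips_lift bi iw w0') [iv jv]] := IH _ iw'.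
exists (fun y => v y + e * U y); split=> y.
  by case: (iv y) => -> ->; case: (iU y) => -> ->.
have jD a b : jump (fun y => a y + e * b y) y = jump a y + e * jump b y.
  by rewrite /jump; ring.
rewrite jD jv; have -> : jump w y = jump u y - e * jump U y by rewrite /jump /w; ring.
case: ifP => by_; last by ring.
suff -> : jump U y = 0 by ring.
by apply/eqP; rewrite subr_eq0; apply/eqP/cU/glue_opp.
Qed.

(** The jumps leave a constant free on each component of the diagram. The base dart depends on the
    diagram alone, so one normalisation serves all states. *)
Definition base x := fingraph.root (total E) x.

Definition nflips A u v := flips A u v /\ forall x, v (base x) = u (base x).

Lemma inv_total A u : inv A u -> (forall x, jump u x = 0) ->
  forall x y, connect (total E) x y -> u y = u x.
Proof.
move=> iu u0 x y.
have oo z : u (opp z) = u z by apply/eqP; rewrite -subr_eq0; apply/eqP/u0.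
rewrite -(@glue_total _ E EK predT A) //; apply: connect_const => {}x {}y.
by move=> /orP[/orP[]|/andP[_]] /eqP->; rewrite ?oo //; case: (iu x).
Qed.

Lemma nflips_exists A u : inv A u -> exists v, nflips A u v.
Proof.
move=> iu; have [v [iv jv]] := flips_exists iu.
pose c x := u (base x) - v (base x).
have cP x y : connect (total E) x y -> c y = c x.
  by rewrite -(root_connect (total_sym EK)) /c /base => /eqP->.
have c1 x : c (E x) = c x by apply/cP/connect1; rewrite /total eqxx.
have c2 x : c (opp x) = c x by apply/cP/connect1; rewrite /total eqxx !orbT.
have c3 x : c (link A x) = c x.
  by apply: cP; rewrite -(@glue_total _ E EK predT A) //; apply/circ_glue/connect_link.
exists (fun x => v x + c x); split; last first.
  by move=> x; rewrite /c /base (root_root (total_sym EK)); ring.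
split=> x; first by case: (iv x) => -> ->; rewrite c1 c3.
by rewrite -jv /jump c2; ring.
Qed.

Lemma nflips_uniq A u v v' : nflips A u v -> nflips A u v' -> v =1 v'.
Proof.
move=> [[iv jv] bv] [[iv' jv'] bv'] x; pose w y := v y - v' y.
have iw : inv A w by move=> y; rewrite /w; case: (iv y) => -> ->; case: (iv' y) => -> ->.
have w0 y : jump w y = 0.
  have -> : jump w y = jump v y - jump v' y by rewrite /w /jump; ring.
  by rewrite jv jv' subrr.
have := inv_total iw w0 (connect_root _ x).
by rewrite /w -/(base x) bv bv' subrr => /esym/eqP; rewrite subr_eq0 => /eqP.
Qed.

Lemma nflips_sym A u v : inv A u -> nflips A u v -> nflips A v u.
Proof.
move=> iu [[iv jv] bv]; split; last by move=> x; rewrite bv.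
split=> [//|x]; rewrite jv; by case: (black A x.1.1); rewrite ?opprK.
Qed.

Lemma nflips_tog i A u v : inv (tog i A) u -> inv A u ->
  (forall x, x.1.1 = i -> jump u x = 0) -> nflips A u v -> nflips (tog i A) u v.
Proof.
move=> iu iu' u0 [[iv jv] bv]; split=> //.
have v0 x : x.1.1 = i -> jump v x = 0.
  by move=> xi; rewrite jv u0 // oppr0 if_same.
split; first exact: inv_tog.
move=> x; rewrite black_tog; case: (eqVneq x.1.1 i) => xi; last by rewrite addbF jv.
by rewrite u0 // v0 // oppr0 if_same.
Qed.

Lemma nflipsD A u v u' v' (c : int) : nflips A u v -> nflips A u' v' ->
  nflips A (fun x => u x + c * u' x) (fun x => v x + c * v' x).
Proof.
move=> [[iv jv] bv] [[iv' jv'] bv']; split; last by move=> x; rewrite bv bv'.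
split=> x; first by case: (iv x) => -> ->; case: (iv' x) => -> ->.
have jD a b : jump (fun y => a y + c * b y) x = jump a x + c * jump b x.
  by rewrite /jump; ring.
by rewrite !jD jv jv'; case: ifP => _; ring.
Qed.

End Flips.

(** * The exterior algebra *)

Section ExtOps.
Variable S : finType.
Implicit Types (x y : S) (A B X : {set S}) (f g : ext S) (v w : S -> int).

Definition one : ext S := mono set0.

Definition lw x f : ext S := wedge (gen x) f.

Definition sg x B : int := (-1) ^+ #|[set y in B | (enum_rank y < enum_rank x)%N]|.

Lemma wsign1 x B : wsign [set x] B = sg x B.
Proof.
rewrite /wsign /sg; congr (_ ^+ _).
rewrite -[RHS](card_imset _ (can_inj (fun y => erefl : (x, y).2 = y))).
apply: eq_card => -[x' y]; rewrite !inE /=; apply/andP/imsetP => /= [[/andP[/eqP-> yB] lt]|].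
  by exists y => //; rewrite inE yB.
by case=> z; rewrite inE => /andP[zB lt] [-> ->]; rewrite eqxx zB.
Qed.

Lemma sg_neq0 x B : sg x B != 0.
Proof. by rewrite /sg signr_eq0. Qed.

Lemma sg_sq x B : sg x B * sg x B = 1.
Proof. by rewrite /sg -expr2 sqrr_sign. Qed.

Lemma lwE x f E : lw x f E = if x \in E then sg x (E :\ x) * f (E :\ x) else 0.
Proof.
rewrite /lw /wedge ffunE; case: ifP => xE; last first.
  apply: big1 => A AE; rewrite ffunE; case: eqP => [A1|_]; last by rewrite mulr0 mul0r.
  by move: AE; rewrite A1 sub1set xE.
rewrite (bigD1 [set x]) ?sub1set //= big1 => [|A /andP[_ nA]].
  by rewrite ffunE eqxx mulr1 addr0 wsign1.
by rewrite ffunE (negPf nA) mulr0 mul0r.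
Qed.

Lemma ext_subE f g E : (f - g) E = f E - g E.
Proof. by rewrite !ffunE. Qed.

Lemma ext_oppE f E : (- f) E = - f E.
Proof. by rewrite !ffunE. Qed.

Lemma ext_mulzE f (c : int) E : (f *~ c) E = f E * c.
Proof.
have pos n : (f *~ n%:Z) E = f E * n%:Z by rewrite -pmulrn ffunMnE -mulr_natr natz.
by case: c => n; rewrite ?NegzE ?mulrNz ?ext_oppE pos // mulrN.
Qed.

Lemma ext_sumE J (r : seq J) (P : pred J) (F : J -> ext S) E :
  (\sum_(j <- r | P j) F j) E = \sum_(j <- r | P j) F j E.
Proof. by elim/big_rec2: _ => [|j a b _ <-]; rewrite ffunE. Qed.

Lemma lw_is_zmod_morphism x : zmod_morphism (lw x).
Proof.
move=> f g; apply/ffunP => E; rewrite ext_subE !lwE ext_subE.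
by case: ifP => _; rewrite ?subr0 // mulrBr.
Qed.

HB.instance Definition _ x :=
  GRing.isZmodMorphism.Build _ _ (lw x) (lw_is_zmod_morphism x).

Lemma sg_setD1 x y B : y \in B ->
  sg x B = sg x (B :\ y) * (-1) ^+ (enum_rank y < enum_rank x)%N.
Proof.
move=> yB; rewrite /sg -exprD; congr (_ ^+ _).
rewrite (cardsD1 y) inE yB addnC; congr (_ + _)%N.
by apply: eq_card => z; rewrite !inE andbA.
Qed.

Lemma lwC x y f : x != y -> lw x (lw y f) = - lw y (lw x f).
Proof.
move=> xy; apply/ffunP => E; rewrite ext_oppE !lwE !inE xy eq_sym xy /=.
case: (boolP (x \in E)) => xE; case: (boolP (y \in E)) => yE; rewrite ?mulr0 ?oppr0 //.
rewrite (@sg_setD1 x y (E :\ x)) ?inE 1?eq_sym ?xy // (@sg_setD1 y x (E :\ y)) ?inE ?xy //.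
have -> : E :\ y :\ x = E :\ x :\ y by rewrite setDDl setUC -setDDl.
have : enum_rank x != enum_rank y by rewrite (inj_eq enum_rank_inj).
by rewrite neq_ltn; case: ltngtP => //= _ _; rewrite !(expr0, expr1); ring.
Qed.

Lemma lwxx x f : lw x (lw x f) = 0.
Proof. by apply/ffunP => E; rewrite !lwE !inE eqxx mulr0 if_same !ffunE. Qed.

Lemma lw_mono x B : x \notin B -> lw x (mono B) = mono (x |: B) *~ sg x B.
Proof.
move=> xB; apply/ffunP => E; rewrite ext_mulzE lwE !ffunE.
case: (boolP (x \in E)) => xE; last first.
  by case: eqP => [EB|_]; [rewrite EB setU11 in xE|rewrite mul0r].
have -> : (E == x |: B) = (E :\ x == B).
  apply/eqP/eqP => [->|<-]; last by rewrite setD1K.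
  by rewrite setU1K.
by case: eqP => [->|_]; rewrite ?mulr1 ?mul1r // mulr0 mul0r.
Qed.

Lemma lw_mono_in x B : x \in B -> lw x (mono B) = 0.
Proof.
move=> xB; apply/ffunP => E; rewrite lwE !ffunE.
by case: eqP => [EB|_]; rewrite ?mulr0 ?if_same //; rewrite -EB !inE eqxx in xB.
Qed.

Lemma ext_mono f : f = \sum_A mono A *~ f A.
Proof.
apply/ffunP => E; rewrite ext_sumE (bigD1 E) //= big1 => [|A nA].
  by rewrite addr0 ext_mulzE ffunE eqxx mul1r.
by rewrite ext_mulzE ffunE eq_sym (negPf nA) mul0r.
Qed.

Definition supp X f := forall A, f A != 0 -> A \subset X.

(** Wedging with generators produces everything from [one], so additive maps can be compared without
    the signs of ordered monomials. *)
Lemma ext_ind X (P : ext S -> Prop) : P 0 -> P one ->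
  (forall f g, P f -> P g -> P (f - g)) ->
  (forall x f, x \in X -> supp X f -> P f -> P (lw x f)) ->
  forall f, supp X f -> P f.
Proof.
move=> P0 P1 PB Plw.
have PN f : P f -> P (- f) by move=> Pf; rewrite -sub0r; apply: PB.
have PD f g : P f -> P g -> P (f + g) by move=> Pf Pg; rewrite -[g]opprK; apply/PB/PN.
have PM f (c : int) : P f -> P (f *~ c).
  have Pn k g : P g -> P (g *+ k).
    by move=> Pg; elim: k => [|k IH]; rewrite ?mulr0n // mulrS; apply: PD.
  by move=> Pf; case: c => k; [apply: Pn|apply/PN/Pn].
have Pm A : A \subset X -> P (mono A).
  have [m] := ubnP #|A|; elim: m A => // m IH A le AX.
  have [->|[x xA]] := set_0Vmem A; first exact: P1.
  have sX : A :\ x \subset X by apply: subset_trans (subD1set _ _) AX.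
  have -> : mono A = lw x (mono (A :\ x)) *~ sg x (A :\ x).
    by rewrite lw_mono ?setD11 // setD1K // -mulrzA sg_sq.
  apply/PM/Plw; [exact: (subsetP AX)| |apply: IH => //].
    by move=> B; rewrite ffunE; case: (B =P _) => [->|_] //; rewrite eqxx.
  by move: le; rewrite (cardsD1 x) xA.
move=> f fX; rewrite (ext_mono f); elim/big_rec: _ => // A g _ Pg; apply: PD => //.
by have [->|/fX/Pm/PM//] := eqVneq (f A) 0; rewrite mulr0z.
Qed.

Lemma ext_ind_all (P : ext S -> Prop) : P 0 -> P one ->
  (forall f g, P f -> P g -> P (f - g)) -> (forall x f, P f -> P (lw x f)) ->
  forall f, P f.
Proof.
move=> P0 P1 PB Plw f; apply: (@ext_ind setT) => [||||A _]; [by []..| | by apply: subsetT].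
by move=> x g _ _; apply: Plw.
Qed.

(** Left multiplication by the vector with coordinates [v]. *)
Definition L v f : ext S := \sum_x lw x f *~ v x.

Lemma L_is_zmod_morphism v : zmod_morphism (L v).
Proof.
move=> f g; rewrite /L -sumrB; apply: eq_bigr => x _.
by rewrite raddfB mulrzBl.
Qed.

HB.instance Definition _ v :=
  GRing.isZmodMorphism.Build _ _ (L v) (L_is_zmod_morphism v).

Lemma lw_L x v f : lw x (L v f) = - L v (lw x f).
Proof.
rewrite /L raddf_sum /= -sumrN; apply: eq_bigr => y _; rewrite raddfMz /= -mulNrz.
have [->|xy] := eqVneq x y; last by rewrite (lwC _ xy).
by rewrite lwxx oppr0.
Qed.

Lemma L_anti v w f : L v (L w f) = - L w (L v f).
Proof.
have -> : L w (L v f) = \sum_x L w (lw x f) *~ v x.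
  by rewrite {2}/L raddf_sum /=; apply: eq_bigr => x _; rewrite raddfMz.
by rewrite {1}/L -sumrN; apply: eq_bigr => x _; rewrite lw_L mulNrz.
Qed.

(** Anticommutativity makes twice the value vanish, and the integers have no 2-torsion. *)
Lemma L_sq v f : L v (L v f) = 0.
Proof.
apply/ffunP => E; have := congr1 (fun h : ext S => h E) (L_anti v v f).
by rewrite /= ext_oppE ffunE => /eqP; rewrite -addr_eq0 -mulr2n mulrn_eq0 => /eqP.
Qed.

Lemma eq_L v w f : v =1 w -> L v f = L w f.
Proof. by move=> vw; apply: eq_bigr => x _; rewrite vw. Qed.

Lemma L_delta x f : L (fun y => (y == x)%:Z) f = lw x f.
Proof.
rewrite /L (bigD1 x) //= eqxx big1 ?addr0 // => y nyx.
by rewrite (negPf nyx) mulr0z.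
Qed.

End ExtOps.

(** * Maps of exterior algebras induced by matrices *)

Section ExtMaps.
Implicit Types S T U : finType.

Definition mwedge S T (phi : S -> T -> int) (s : seq S) : ext T :=
  foldr (fun x g => L (phi x) g) (one T) s.

(** The ring homomorphism of exterior algebras extending the linear map with matrix [phi]; [Phi_lw]
    expresses its multiplicativity. *)
Definition Phi S T (phi : S -> T -> int) (f : ext S) : ext T :=
  \sum_(A : {set S}) mwedge phi (enum A) *~ f A.

Lemma Phi_is_zmod_morphism S T (phi : S -> T -> int) : zmod_morphism (Phi phi).
Proof.
move=> f g; rewrite /Phi -sumrB; apply: eq_bigr => A _.
by rewrite ext_subE mulrzBr.
Qed.

HB.instance Definition _ S T (phi : S -> T -> int) :=
  GRing.isZmodMorphism.Build _ _ (Phi phi) (Phi_is_zmod_morphism phi).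

Lemma Phi_mono S T (phi : S -> T -> int) (A : {set S}) : Phi phi (mono A) = mwedge phi (enum A).
Proof.
rewrite /Phi (bigD1 A) //= ffunE eqxx big1 ?addr0 // => B nBA.
by rewrite ffunE (negPf nBA) mulr0z.
Qed.

Lemma Phi1 S T (phi : S -> T -> int) : Phi phi (one S) = one T.
Proof. by rewrite Phi_mono enum_set0. Qed.

Lemma mwedge_cat S T (phi : S -> T -> int) x s1 s2 :
  L (phi x) (mwedge phi (s1 ++ s2)) = mwedge phi (s1 ++ x :: s2) *~ (-1) ^+ size s1.
Proof.
elim: s1 => [|y s IH] /=; first by [].
by rewrite L_anti IH raddfMz /= exprS mulN1r mulrNz.
Qed.

Lemma mwedge_in S T (phi : S -> T -> int) x s : x \in s -> L (phi x) (mwedge phi s) = 0.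
Proof.
elim: s => //= y s IH; rewrite inE => /orP[/eqP->|/IH xs]; first exact: L_sq.
by rewrite L_anti xs raddf0 oppr0.
Qed.

(** Cutting the enumeration of [S] at [x] shows the number of factors that [x] has to pass, which is
    the exponent in [sg]. *)
Lemma enum_split S x (B : {set S}) :
  let s1 := [seq y <- take (enum_rank x) (enum S) | y \in B] in
  let s2 := [seq y <- drop (enum_rank x).+1 (enum S) | y \in B] in
  x \notin B ->
  [/\ enum B = s1 ++ s2, enum (x |: B) = s1 ++ x :: s2 &
      size s1 = #|[set y in B | (enum_rank y < enum_rank x)%N]|].
Proof.
move=> s1 s2 xB.
have eS : enum S = take (enum_rank x) (enum S) ++ x :: drop (enum_rank x).+1 (enum S).
  rewrite -{1}(cat_take_drop (enum_rank x) (enum S)); congr cat.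
  rewrite (drop_nth x) -?cardE ?ltn_ord //; congr cons.
  by rewrite -(enum_val_nth x) enum_rankK.
have eB (A : {set S}) : enum A = [seq y <- enum S | y \in A].
  by rewrite enumT; apply: eq_filter => y; rewrite inE.
have us : uniq (enum S) by exact: enum_uniq.
move: (us); rewrite {1}eS cat_uniq /= => /and3P[_ /norP[xt _] /andP[xd _]].
have nfil (s : seq S) : x \notin s -> [seq y <- s | y \in x |: B] = [seq y <- s | y \in B].
  move=> xs; apply: eq_in_filter => y ys; rewrite !inE.
  by case: eqP => // yx; rewrite -yx ys in xs.
split.
- by rewrite eB {1}eS filter_cat /= (negPf xB).
- by rewrite eB {1}eS filter_cat /= setU11 !nfil.
rewrite -(card_uniqP _) ?filter_uniq ?take_uniq //; apply: eq_card => y.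
rewrite mem_filter !inE; congr andb.
have iy : index y (enum S) = enum_rank y.
  by rewrite -{1}(enum_rankK y) (enum_val_nth y) index_uniq // -cardE ltn_ord.
by rewrite in_take ?mem_enum // iy.
Qed.

Lemma Phi_lw S T (phi : S -> T -> int) x f : Phi phi (lw x f) = L (phi x) (Phi phi f).
Proof.
have -> : lw x f = \sum_A lw x (mono A) *~ f A.
  by rewrite {1}(ext_mono f) raddf_sum /=; apply: eq_bigr => A _; rewrite raddfMz.
rewrite (raddf_sum (Phi phi)) (raddf_sum (L (phi x))) /=; apply: eq_bigr => A _.
rewrite !raddfMz /=; congr (_ *~ _).
have [xA|xA] := boolP (x \in A).
  by rewrite lw_mono_in // raddf0 mwedge_in // mem_enum.
rewrite lw_mono // raddfMz /= Phi_mono.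
have [-> -> sz] := enum_split xA.
by rewrite mwedge_cat sz.
Qed.

Lemma Phi_L S T (phi : S -> T -> int) v f :
  Phi phi (L v f) = L (fun z => \sum_x v x * phi x z) (Phi phi f).
Proof.
rewrite /L raddf_sum /=.
under eq_bigr do rewrite raddfMz /= Phi_lw /L mulrz_suml.
rewrite exchange_big /=; apply: eq_bigr => z _.
by rewrite mulrz_sumr; apply: eq_bigr => x _; rewrite mulrC mulrzA.
Qed.

Lemma eq_mwedge S T (phi psi : S -> T -> int) s :
  (forall x, x \in s -> phi x =1 psi x) -> mwedge phi s = mwedge psi s.
Proof.
elim: s => //= x s IH h; rewrite IH => [|y ys]; last by apply: h; rewrite inE ys orbT.
by apply: eq_L; apply: h; rewrite inE eqxx.
Qed.

Lemma Phi_comp S T U (phi : S -> T -> int) (psi : T -> U -> int) f :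
  Phi psi (Phi phi f) = Phi (fun x z => \sum_y phi x y * psi y z) f.
Proof.
elim/ext_ind_all: f => [||f g Hf Hg|x f Hf].
- by rewrite !raddf0.
- by rewrite !Phi1.
- by rewrite !raddfB /= Hf Hg.
by rewrite !Phi_lw Phi_L Hf.
Qed.

Lemma eq_Phi_supp S T (X : {set S}) (phi psi : S -> T -> int) f :
  (forall x, x \in X -> phi x =1 psi x) -> supp X f -> Phi phi f = Phi psi f.
Proof.
move=> pp fX; apply: eq_bigr => A _.
have [->|/fX/subsetP AX] := eqVneq (f A) 0; first by rewrite !mulr0z.
by rewrite (@eq_mwedge _ _ phi psi) // => x; rewrite mem_enum => /AX/pp.
Qed.

Lemma Phi_id S (f : ext S) : Phi (fun x y => (y == x)%:Z) f = f.
Proof.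
elim/ext_ind_all: f => [||f g Hf Hg|x f Hf].
- by rewrite raddf0.
- by rewrite Phi1.
- by rewrite raddfB /= Hf Hg.
by rewrite Phi_lw Hf L_delta.
Qed.

Lemma L_neq0 S (v : S -> int) f E : L v f E != 0 ->
  exists x, [/\ v x != 0, x \in E & f (E :\ x) != 0].
Proof.
rewrite /L ext_sumE => nz; case: (pickP (fun x => (lw x f *~ v x) E != 0)) => [x|z].
  rewrite ext_mulzE lwE; case: ifP => xE; last by rewrite mul0r eqxx.
  by rewrite !mulf_eq0 !negb_or => /andP[/andP[_ fx] vx]; exists x.
by rewrite big1 ?eqxx // in nz => x _; apply/eqP; rewrite -[_ == _]negbK z.
Qed.

Lemma mwedge_neq0 S T (phi : S -> T -> int) (Y : {set T}) s E :
  (forall x y, x \in s -> phi x y != 0 -> y \in Y) -> mwedge phi s E != 0 ->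
  #|E| = size s /\ E \subset Y.
Proof.
elim: s E => [|x s IH] E /= h.
  by rewrite ffunE; case: (E =P _) => [->|_]; rewrite ?eqxx // cards0 sub0set.
move=> /L_neq0 [y [vy yE /IH[]]]; first by move=> x' y' x's; apply: h; rewrite inE x's orbT.
move=> sz sY; rewrite (cardsD1 y) yE sz; split=> //.
by rewrite -(setD1K yE) subUset sY sub1set (h x) // inE eqxx.
Qed.

(** The equality of sizes says that induced maps preserve the exterior degree, and with it the
    delta-grading. *)
Lemma Phi_neq0 S T (phi : S -> T -> int) (X : {set S}) (Y : {set T}) f E :
  (forall x y, x \in X -> phi x y != 0 -> y \in Y) -> supp X f -> Phi phi f E != 0 ->
  E \subset Y /\ exists2 A, f A != 0 & #|A| = #|E|.
Proof.
move=> h fX; rewrite /Phi ext_sumE => nz.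
case: (pickP (fun A : {set S} => (mwedge phi (enum A) *~ f A) E != 0)) => [A|z].
  rewrite ext_mulzE mulf_eq0 negb_or => /andP[mA fA].
  have hA x y : x \in enum A -> phi x y != 0 -> y \in Y.
    by rewrite mem_enum => /(subsetP (fX _ fA))/h; apply.
  have [sz sY] := mwedge_neq0 hA mA; split=> //; exists A => //.
  by rewrite cardE sz.
by rewrite big1 ?eqxx // in nz => x _; apply/eqP; rewrite -[_ == _]negbK z.
Qed.

End ExtMaps.

(** * The checkerboard colouring *)

Section Faces.
Variables (I : finType) (E : I * bool * bool -> I * bool * bool) (col : I -> bool).
Notation dart := (I * bool * bool)%type.
Implicit Types x y : dart.
Hypothesis EK : involutive E.
Hypothesis colour_E : forall x, colour col (E x) = ~~ colour col x.

(** The next end counter-clockwise, as [ccw], but for an arbitrary set of crossings; [turn'] is the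
    next one clockwise. *)
Definition turn x : dart := (x.1.1, x.1.2 (+) x.2, ~~ x.2).
Definition turn' x : dart := (x.1.1, x.1.2 (+) ~~ x.2, ~~ x.2).

Lemma turnK : cancel turn turn'.
Proof. by case=> [[i e] s]; rewrite /turn /turn' /= !negbK addbK. Qed.

Lemma turn'K : cancel turn' turn.
Proof. by case=> [[i e] s]; rewrite /turn /turn' /= !negbK addbK. Qed.

Lemma face_inj : injective (turn \o E).
Proof. exact: inj_comp (can_inj turnK) (inv_inj EK). Qed.

(** In an extreme state the links turn clockwise at all darts of one colour and counter-clockwise at
    the others, so the circles run along the boundaries of regions. *)
Lemma face_connect (A : {set I}) (b : bool) :
  (forall i, (i \in A) = (col i (+) ~~ b)) ->
  forall x y, colour col x = b -> colour col y = b ->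
  connect (circ_r E A) x y -> fconnect (turn \o E) x y.
Proof.
move=> Ab x y cx cy xy.
(* A circle contains darts of both colours; those of the wrong colour are moved by one turn onto the
   orbit of the region. *)
pose g z := if colour col z == b then z else turn z.
have fs := fconnect_sym face_inj.
have step u v : circ_r E A u v ->
    fingraph.root (frel (turn \o E)) (g v) = fingraph.root (frel (turn \o E)) (g u).
  move=> uv; apply/eqP; rewrite (root_connect fs); move: uv.
  have lk z : link A z = if colour col z == b then turn' z else turn z.
    rewrite /link /turn /turn' Ab /colour; case: z => [[i e] s] /=.
    by case: (b) (e) (s) (col i) => [] [] [] [].
  have N c : (~~ c == b) = ~~ (c == b) by case: c (b) => [] [].
  case/orP=> /eqP->; rewrite /g; last first.
    by rewrite colour_link lk N; case: (colour col u == b); rewrite /= ?turn'K; apply: connect0.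
  rewrite colour_E N; case: (colour col u == b) => /=; first by rewrite fs; apply: (fconnect1 (turn \o E)).
  by rewrite -{2}(EK u); apply: (fconnect1 (turn \o E)).
have := connect_const step xy; rewrite /g cx cy eqxx => /eqP.
by rewrite (root_connect fs) fs.
Qed.

(** With [genus_ge0] for the opposite direction, this turns Euler's formula into the equality
    assumed as [planar]. *)
Lemma fcard_face_le :
  (fcard (turn \o E) predT <= n_comp (circ_r E (all_white col)) predT +
     n_comp (circ_r E (all_black col)) predT)%N.
Proof.
rewrite (n_compC [pred x | colour col x]) addnC; apply: leq_add.
  apply: (@leq_n_comp _ _ _ _ id); [exact: fconnect_sym face_inj|exact: circ_sym|].
  move=> x y; rewrite !inE => /negbTE cx /negbTE cy.
  by apply: (@face_connect _ false) => // i; rewrite !inE /= addbT.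
apply: (@leq_n_comp _ _ _ _ id); [exact: fconnect_sym face_inj|exact: circ_sym|].
move=> x y; rewrite !inE => cx cy.
by apply: (@face_connect _ true) => // i; rewrite !inE /= addbF.
Qed.

End Faces.

Section DoubleCover.
Variables (I : finType) (E : I * bool * bool -> I * bool * bool).
Notation dart := (I * bool * bool)%type.
Notation dart2 := (I * bool * bool * bool)%type.
Implicit Types x y : dart.
Hypothesis EK : involutive E.

(* A double cover of the diagram that is coloured by its sheets.  By [genus_ge0]
  for the cover of a planar diagram, it has two components over each component of
  the diagram, and a choice of one of them is a colouring. *)
Definition lift2 b x : dart2 := ((x.1.1, x.2 (+) b), x.1.2, x.2).
Definition down (z : dart2) : dart := (z.1.1.1, z.1.2, z.2).
Definition col2 (j : I * bool) : bool := j.2.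
Definition E2 (z : dart2) : dart2 := lift2 (~~ colour col2 z) (E (down z)).

Lemma down_lift b : cancel (lift2 b) down.
Proof. by case=> [[i e] s]. Qed.

Lemma lift_down z : lift2 (colour col2 z) (down z) = z.
Proof. by case: z => [[[i t] e] s]; rewrite /lift2 /colour /= addKb. Qed.

Lemma colour_lift b x : colour col2 (lift2 b x) = b.
Proof. by rewrite /colour /= addKb. Qed.

Lemma E2_lift b x : E2 (lift2 b x) = lift2 (~~ b) (E x).
Proof. by rewrite /E2 colour_lift down_lift. Qed.

Lemma E2K : involutive E2.
Proof. by move=> z; rewrite -(lift_down z) !E2_lift EK negbK. Qed.

Lemma colour_E2 z : colour col2 (E2 z) = ~~ colour col2 z.
Proof. by rewrite colour_lift. Qed.

Lemma face_down b x y : fconnect (@turn _ \o E2) (lift2 b x) (lift2 b y) ->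
  fconnect (@turn _ \o E) x y.
Proof.
have fs := fconnect_sym (face_inj EK).
have step (u v : dart2) : frel (@turn _ \o E2) u v ->
    fingraph.root (frel (@turn _ \o E)) (down v) = fingraph.root (frel (@turn _ \o E)) (down u).
  move=> /eqP<-; apply/eqP; rewrite (root_connect fs) fs.
  exact: (fconnect1 (@turn _ \o E) (down u)).
by move/(connect_const step); rewrite !down_lift => /eqP; rewrite (root_connect fs) fs.
Qed.

(** The boundary of a region alternates edges and turns, which both change the colour, so it closes
    up in the cover and has two lifts. *)
Lemma double_faces :
  ((fcard (@turn _ \o E) predT).*2 <= n_comp (circ_r E2 (all_white col2)) predT +
     n_comp (circ_r E2 (all_black col2)) predT)%N.
Proof.
rewrite -addnn; have fs := fconnect_sym (face_inj EK).
apply: leq_add.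
  apply: (@leq_n_comp _ _ _ _ (lift2 false)); [exact: fs|exact: circ_sym E2K _|].
  move=> x y _ _ /(@face_connect _ _ col2 E2K colour_E2 _ false).
  rewrite !colour_lift => h; apply: (@face_down false); apply: h => // i.
  by rewrite inE addbT.
apply: (@leq_n_comp _ _ _ _ (lift2 true)); [exact: fs|exact: circ_sym E2K _|].
move=> x y _ _ /(@face_connect _ _ col2 E2K colour_E2 _ true).
rewrite !colour_lift => h; apply: (@face_down true); apply: h => // i.
by rewrite inE addbF.
Qed.

Hypothesis sphere :
  fcard (@turn _ \o E) predT = (#|I| + (n_comp (total E) predT).*2)%N.

(** The cover has twice the crossings and at least twice the regions, so the genus bound forces at
    least twice the components. *)
Lemma double_total : ((n_comp (total E) predT).*2 <= n_comp (total E2) predT)%N.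
Proof.
have := leq_trans double_faces (genus_ge0 E2K colour_E2).
by rewrite sphere card_prod card_bool muln2 doubleD leq_add2l leq_double.
Qed.

Lemma total_E2 b x : connect (total E2) (lift2 b x) (lift2 (~~ b) (E x)).
Proof. by apply: connect1; rewrite /total E2_lift eqxx. Qed.

Lemma total_link2 b x : connect (total E2) (lift2 b x) (lift2 (~~ b) (link set0 x)).
Proof.
apply: connect1; rewrite /total /link /lift2 /= !inE addNb addbN negbK.
by rewrite eqxx orbT.
Qed.

Lemma total_opp2 b x : connect (total E2) (lift2 b x) (lift2 b (opp x)).
Proof. by apply: connect1; rewrite /total /opp /lift2 /= eqxx !orbT. Qed.

Lemma lift_path x y : connect (total E) x y ->
  exists c, forall b, connect (total E2) (lift2 b x) (lift2 (b (+) c) y).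
Proof.
move=> /connectP[p]; elim: p x => [|z p IH] x /=.
  by move=> _ ->; exists false => b; rewrite addbF connect0.
move=> /andP[xz /IH zy] /zy [c zc].
case/or3P: xz zc => /eqP-> zc; [exists (~~ c)|exists (~~ c)|exists c] => b.
- by rewrite addbN -addNb; apply: connect_trans (total_E2 b x) (zc _).
- by rewrite addbN -addNb; apply: connect_trans (total_link2 b x) (zc _).
exact: connect_trans (total_opp2 b x) (zc _).
Qed.

(** If the two lifts of one dart were connected, the component below would have a single lift, and
    the cover fewer than twice as many components. *)
Lemma sheets x : ~~ connect (total E2) (lift2 false x) (lift2 true x).
Proof.
apply/negP => xx.
have ts := total_sym EK; have ts2 := total_sym E2K.
pose r0 := fingraph.root (total E) x.
have rr : connect (total E2) (lift2 false r0) (lift2 true r0).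
  have /lift_path [c xc] : connect (total E) x r0 by exact: connect_root.
  have c0 := xc false; have c1 := xc true.
  have := connect_trans (connect_trans (_ : connect _ (lift2 c r0) (lift2 false x)) xx) c1.
  rewrite ts2 => /(_ c0) /=; case: (c) => //=; by rewrite ts2.
have : (n_comp (total E2) predT <= #|[predD1 [predX (roots (total E)) & predT] & (r0, true)]|)%N.
  rewrite /n_comp_mem.
  apply: leq_trans (leq_imset_card (fun p => fingraph.root (total E2) (lift2 p.2 p.1)) _).
  apply/subset_leq_card/subsetP => z; rewrite !inE andbT => /eqP rz.
  have /lift_path [c zc] : connect (total E) (down z) (fingraph.root (total E) (down z)).
    exact: connect_root.
  have := zc (colour col2 z); rewrite lift_down; set d := _ (+) c => zd.
  have rd : z = fingraph.root (total E2) (lift2 d (fingraph.root (total E) (down z))).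
    by rewrite -{1}rz; apply/eqP; rewrite (root_connect ts2).
  case: (eqVneq (fingraph.root (total E) (down z), d) (r0, true)) => [[er ed]|ne].
    apply/imsetP; exists (r0, false); first by rewrite !inE xpair_eqE /= andbF (roots_root ts).
    rewrite rd er ed /=; apply/eqP; rewrite (root_connect ts2) ts2; exact: rr.
  apply/imsetP; exists (fingraph.root (total E) (down z), d) => //.
  by rewrite !inE ne /= (roots_root ts).
have : (#|[predX (roots (total E)) & (predT : pred bool)]| = (n_comp (total E) predT).*2)%N.
  rewrite cardX cardT -cardE card_bool muln2; congr double.
  by apply: eq_card => z; rewrite !inE andbT.
rewrite (cardD1 (r0, true)) !inE /= (roots_root ts) /= => card le.
by have := leq_trans double_total le; rewrite -card add1n ltnn.
Qed.

Lemma colouring_exists : exists col, forall x, colour col (E x) = ~~ colour col x.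
Proof.
have ts := total_sym EK; have ts2 := total_sym E2K.
(* Over each component the chosen lift is the one containing the lift of the root with colour
   [false]; [c x] is the colour of [x] in it. *)
pose c x := connect (total E2) (lift2 false (fingraph.root (total E) x)) (lift2 true x).
have cN x : c x = ~~ connect (total E2) (lift2 false (fingraph.root (total E) x)) (lift2 false x).
  have := sheets x; rewrite /c; have : connect (total E) (fingraph.root (total E) x) x.
    by rewrite ts connect_root.
  case/lift_path=> d /(_ false); rewrite addFb.
  case: (boolP (connect _ _ (lift2 false x))) => [c0 _|c0].
    rewrite ts2 in c0; by move/negP=> nx; apply/negP => c1; apply/nx/(connect_trans c0 c1).
  by case: d => // cf; rewrite cf in c0.
have step d x y : connect (total E) x y ->
    (forall b, connect (total E2) (lift2 b x) (lift2 (b (+) d) y)) -> c y = c x (+) d.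
  rewrite -(root_connect ts) => /eqP xy l; rewrite {1}/c -xy; case: d l => l.
    by rewrite addbT cN negbK; apply/esym/(same_connect_r ts2 (l false)).
  by rewrite addbF /c; apply/esym/(same_connect_r ts2 (l true)).
have cE x : c (E x) = ~~ c x.
  rewrite -addbT; apply: step => [|b]; last by rewrite addbT; apply: total_E2.
  by apply: connect1; rewrite /total eqxx.
have cl x : c (link set0 x) = ~~ c x.
  rewrite -addbT; apply: step => [|b]; last by rewrite addbT; apply: total_link2.
  by apply: connect1; rewrite /total eqxx orbT.
have co x : c (opp x) = c x.
  rewrite -[RHS]addbF; apply: step => [|b]; last by rewrite addbF; apply: total_opp2.
  by apply: connect1; rewrite /total eqxx !orbT.
exists (fun i => c (i, false, false)).
suff key x : colour (fun i => c (i, false, false)) x = c x by move=> x; rewrite !key cE.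
have ce i e s : c (i, e, s) = c (i, false, s).
  by case: e => //; rewrite -(co (i, true, s)).
case: x => [[i e] s]; rewrite /colour /= ce; case: s => //.
by rewrite addTb -(cl (i, false, false)) /link /= inE.
Qed.

End DoubleCover.

(** * Euler's formula for a diagram *)

Section DiagramEuler.
Variables (n : nat) (D : diagram n).

Lemma ccwE (x : ends n) : ccw x = turn x.
Proof. by case: x => [[i e] []]; rewrite /turn /= ?addbT ?addbF. Qed.

Lemma edge_neq x : edge D x != x.
Proof. by apply/eqP => ex; have := edge_leaves D x; rewrite ex; case: leaves. Qed.

Lemma fcard_edge : (fcard (edge D) predT * 2 = #|ends n|)%N.
Proof.
apply: fcard_order_set => //; first by apply: inv_inj (edgeK D).
apply/subsetP => x _; rewrite inE; apply/eqP.
apply: (@order_cycle _ _ [:: x; edge D x]); rewrite /= ?edgeK ?eqxx ?inE ?eqxx //.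
by rewrite eq_sym edge_neq.
Qed.

Lemma fcard_ccw : (fcard (@ccw n) predT * 4 = #|ends n|)%N.
Proof.
apply: fcard_order_set => //; first exact: eq_inj (can_inj (@turnK _)) (fun x => esym (ccwE x)).
apply/subsetP => x _; rewrite inE; apply/eqP.
apply: (@order_cycle _ _ [:: x; ccw x; ccw (ccw x); ccw (ccw (ccw x))]).
- by case: x => [[i []] []]; rewrite /= ?eqxx.
- by case: x => [[i []] []]; rewrite /= !inE !xpair_eqE /= !andbF.
by rewrite inE eqxx.
Qed.

Lemma turn_link (x : ends n) : turn x = link set0 x \/ turn x = opp (link set0 x).
Proof.
case: x => [[i e] []]; rewrite /turn /link /opp /= inE ?addbT ?addbF; by [right|left].
Qed.

(** A crossing has four ends and accounts for two edges, which eliminates the edges from Euler's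
    formula. *)
Lemma edge_sphere :
  fcard (@turn _ \o edge D) predT = (#|'I_n| + (n_comp (total (edge D)) predT).*2)%N.
Proof.
have := edge_spherical D; rewrite /spherical.
rewrite (@eq_fcard _ (@ccw n \o edge D) (@turn _ \o edge D)); last by move=> x; exact: ccwE.
set R := (fun x y => _ || (x == ccw y)).
have -> : n_comp R predT = n_comp (total (edge D)) predT.
  have ts := total_sym (edgeK D).
  have tt x : connect (total (edge D)) x (turn x).
    have l1 y : connect (total (edge D)) y (link set0 y) by apply: connect1; rewrite /total eqxx orbT.
    have l2 y : connect (total (edge D)) y (opp y) by apply: connect1; rewrite /total eqxx !orbT.
    by case: (turn_link x) => -> //; apply: connect_trans (l1 x) (l2 _).
  have rc x : connect R x (turn x) by apply: connect1; rewrite /R ccwE eqxx orbT.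
  have re x : connect R x (edge D x) by apply: connect1; rewrite /R eqxx.
  apply: eq_n_comp => x y; apply/idP/idP; apply: connect_sub => {}x {}y.
    rewrite /R !ccwE; case/orP => [/orP[/orP[]|]|] /eqP->; rewrite ?tt ?[connect _ _ y]ts ?tt //.
      by apply: connect1; rewrite /total eqxx.
    by apply: connect1; rewrite /total eqxx.
  have rs : connect_sym R.
    by apply: connect_symP => u v h; apply: connect1; move: h; rewrite /R;
      case/orP => [/orP[/orP[]|]|] ->; rewrite ?orbT.
  have ro u : connect R u (opp u).
    have -> : opp u = turn (turn u).
      by case: u => [[i e] s]; rewrite /turn /opp /= -addbA addbN addbb addbT negbK.
    exact: connect_trans (rc u) (rc _).
  case/or3P => /eqP->; [exact: re| |exact: ro].
  case: (turn_link x) => h; first by rewrite -h.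
  by rewrite -[link _ _]oppK -h; apply: connect_trans (rc x) (ro _).
have := fcard_edge; have := fcard_ccw; rewrite /ends !card_prod card_bool card_ord /=; lia.
Qed.

Lemma diagram_colouring : exists2 col : 'I_n -> bool,
  (forall x, colour col (edge D x) = ~~ colour col x) &
  (n_comp (circ_r (edge D) (all_white col)) predT +
   n_comp (circ_r (edge D) (all_black col)) predT =
   #|'I_n| + (n_comp (total (edge D)) predT).*2)%N.
Proof.
have [col ce] := colouring_exists (edgeK D) edge_sphere; exists col => //.
apply/eqP; rewrite eqn_leq (genus_ge0 (edgeK D) ce) -edge_sphere.
exact: fcard_face_le (edgeK D) ce.
Qed.

End DiagramEuler.

(** * Counting circles: joins and splits *)

Section Self.
Variables (I : finType) (E : I * bool * bool -> I * bool * bool) (col : I -> bool).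
Notation dart := (I * bool * bool)%type.
Implicit Types (x y : dart) (A : {set I}) (i j : I).
Hypothesis EK : involutive E.
Hypothesis colour_E : forall x, colour col (E x) = ~~ colour col x.

Local Notation conn A := (connect (circ_r E A)).

Definition self A i := conn A (i, false, false) (i, true, false).

Lemma conn_opp i A x y : x.1.1 = i -> y.1.1 = i ->
  conn A x (opp x) = conn A y (opp y).
Proof.
move=> xi yi; have cs := circ_sym EK A.
have l z : conn A (link A z) (opp (link A z)) = conn A z (opp z).
  rewrite -(same_connect cs (connect_link E A z)) -link_opp.
  by rewrite -(same_connect_r cs (connect_link E A (opp z))).
case: (dart_cases A xi yi) => -> //; rewrite ?oppK ?l //; rewrite [RHS]cs ?l //.
Qed.

Lemma selfE A i x : x.1.1 = i -> self A i = conn A x (opp x).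
Proof. by move=> xi; rewrite /self -(@conn_opp i A (i, false, false) x). Qed.

(** The first-return map to the darts of colour [true], under which each circle with crossings is
    one cycle. The other darts are fixed points, which makes it a permutation. *)
Definition step A x := if colour col x then E (link A x) else x.

Lemma colour_step A x : colour col (step A x) = colour col x.
Proof. by rewrite /step; case: ifP => // cx; rewrite colour_E colour_link cx. Qed.

Lemma step_inj A : injective (step A).
Proof.
move=> x y sxy; have : colour col x = colour col y.
  by rewrite -(colour_step A x) sxy colour_step.
move: sxy; rewrite /step => sxy cxy; move: sxy; rewrite cxy.
by case: ifP => // _ /(inv_inj EK)/(inv_inj (@linkK _ A)).
Qed.

Definition stepp A : {perm dart} := perm (@step_inj A).

Lemma porbit_conn A x y : colour col x -> colour col y ->
  (x \in porbit (stepp A) y) = conn A x y.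
Proof.
move=> cx cy; have cs := circ_sym EK A; apply/idP/idP.
  move=> /porbitP[m]; elim: m y cy => [|m IH] y cy.
    by rewrite expg0 perm1 => ->; apply: connect0.
  rewrite expgS permM permE => e; have := IH (step A y) _ e.
  rewrite colour_step => /(_ cy) h; apply: connect_trans h _; rewrite /step cy cs.
  apply: connect_trans (connect_link E A y) _; apply: connect1.
  by rewrite /circ_r eqxx.
pose g z := porbit (stepp A) (if colour col z then z else E z).
have gE u v : circ_r E A u v -> g v = g u.
  have gE1 u' : g (E u') = g u'.
    by rewrite /g colour_E; case: (colour col u'); rewrite //= EK.
  have gl u' : colour col u' -> g (link A u') = g u'.
    move=> cu; rewrite /g colour_link cu /=; apply/esym/eqP.
    rewrite eq_porbit_mem porbit_sym; apply/porbitP; exists 1%N.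
    by rewrite expg1 permE /step cu.
  case/orP=> /eqP->; first exact: gE1.
  case: (boolP (colour col u)) => cu; first exact: gl.
  by rewrite -[in RHS](linkK A u) [RHS]gl // colour_link.
move/(connect_const gE); rewrite /g cx cy => /eqP.
by rewrite eq_porbit_mem porbit_sym.
Qed.

(* The number of circles, up to a constant that does not depend on [A]. *)
Definition ncirc A := #|porbits (stepp A)|.

(** Toggling [i] multiplies the permutation by the transposition of the two darts of colour [true]
    at [i], which splits a cycle or merges two. *)
Lemma ncirc_tog A i :
  (ncirc (tog i A) + (~~ self A i).*2 = ncirc A + 1)%N.
Proof.
pose x : dart := (i, false, ~~ col i).
have cx : colour col x by rewrite /colour /= addNb addbb.
have cox : colour col (opp x) by [].
have xo : x != opp x by rewrite /opp /= !xpair_eqE /= andbF.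
have := porbits_mul_tperm (stepp A) x (opp x).
rewrite /= xo porbit_conn // -(@selfE A i x) //; rewrite -/(ncirc A) => <-.
rewrite /ncirc; congr (#|porbits _| + _)%N; apply/permP => y; rewrite permM ![stepp _ _]permE /step.
case: (tpermP x (opp x) y) => [->|->|nx no].
- by rewrite cx cox link_opp link_tog_in.
- by rewrite cx cox !link_opp link_tog_in // oppK.
case: (boolP (colour col y)) => // cy; rewrite link_tog_out //; apply/eqP => yi.
have y2 : y.2 = x.2 by move: cy; rewrite /colour yi /=; case: (col i) y.2 => [] [].
case: y yi y2 nx no {cy} => [[k e] s] /= -> ->; rewrite /x /opp /=.
by case: e => nx no; [apply: no|apply: nx].
Qed.

Lemma self_tog A i : self (tog i A) i = ~~ self A i.
Proof.
have := ncirc_tog A i; have := ncirc_tog (tog i A) i; rewrite togK.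
by case: (self A i) (self (tog i A) i) => [] [] /=; lia.
Qed.

(** Both paths around the square change the number of circles by the same total. *)
Lemma self_square A i j :
  (self A i + self (tog i A) j = self A j + self (tog j A) i)%N.
Proof.
have := ncirc_tog A i; have := ncirc_tog (tog i A) j.
have := ncirc_tog A j; have := ncirc_tog (tog j A) i; rewrite togC.
case: (self A i) (self A j) (self (tog i A) j) (self (tog j A) i) => [] [] [] [] /=; lia.
Qed.

End Self.

(** * The involution on the circles of a state *)

Section StateCircles.
Variables (n : nat) (D : diagram n).
Local Notation H := (res_hs D).
Local Notation E := (edge D).
Implicit Types (A : {set 'I_n}) (h k : H) (c : {set H}) (i : 'I_n) (u v : H -> int).

Definition state_thr A h : H :=
  match h with inl x => inl (link A x) | inr (l, b) => inr (l, ~~ b) end.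

Definition state_rel A : rel H := fun h k => (k == res_seg h) || (k == state_thr A h).

Definition circ A h : {set H} := [set k | connect (state_rel A) h k].

Definition circs A : {set {set H}} := [set circ A h | h : H].

Lemma state_thrK A : involutive (state_thr A).
Proof. by case=> [x|[l b]] /=; rewrite ?linkK ?negbK. Qed.

Lemma state_sym A : connect_sym (state_rel A).
Proof.
apply: connect_symP => h k /orP[] /eqP->; apply: connect1;
by rewrite /state_rel ?res_segK ?state_thrK eqxx ?orbT.
Qed.

Lemma state_inl A x y :
  connect (state_rel A) (inl x) (inl y) = connect (circ_r E A) x y.
Proof.
apply/idP/idP; last first.
  move=> /connectP[p]; elim: p x => [|z p IH] x /=; first by move=> _ ->; apply: connect0.
  move=> /andP[xz pp] /(IH _ pp); apply: connect_trans; apply: connect1.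
  by case/orP: xz => /eqP->; rewrite /state_rel /= eqxx ?orbT.
move=> /connectP[p pp lp].
suff [z [->]] : exists2 z, inl y = inl z :> H & connect (circ_r E A) x z by [].
elim: p x pp lp => [|k p IH] x /=; first by move=> _ ->; exists x; rewrite ?connect0.
move=> /andP[/orP[] /eqP-> pp] /(IH _ pp) [z yz xz]; exists z => //;
  apply: connect_trans xz; apply: connect1; by rewrite /circ_r eqxx ?orbT.
Qed.

Lemma in_circ A h k : (k \in circ A h) = connect (state_rel A) h k.
Proof. by rewrite inE. Qed.

Lemma circ_eq A h k : (circ A h == circ A k) = connect (state_rel A) h k.
Proof.
apply/eqP/idP => [e|hk]; first by rewrite -in_circ e in_circ connect0.
by apply/setP => z; rewrite !in_circ (same_connect (@state_sym A) hk).
Qed.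

Lemma circ_in A h : circ A h \in circs A.
Proof. exact: imset_f. Qed.

Definition rep c : option H := [pick h in c].

Lemma rep_circ A h : exists2 k, rep (circ A h) = Some k & circ A k = circ A h.
Proof.
rewrite /rep; case: pickP => [k|/(_ h)]; last by rewrite in_circ connect0.
by rewrite in_circ -circ_eq eq_sym => /eqP; exists k.
Qed.

Definition ind c h : int := (h \in c)%:Z.

Definition invH A u := forall h k, state_rel A h k -> u k = u h.

Lemma invH_conn A u : invH A u -> forall h k, circ A h = circ A k -> u h = u k.
Proof. by move=> iu h k /eqP; rewrite circ_eq => /(connect_const iu). Qed.

Lemma invH_ind A c : c \in circs A -> invH A (ind c).
Proof.
case/imsetP=> z _ -> h k hk; rewrite /ind !in_circ; congr (Posz (nat_of_bool _)).
by apply/esym/(same_connect_r (@state_sym A))/connect1.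
Qed.

Lemma ind_circ A c h : c \in circs A -> ind c h = (c == circ A h)%:Z.
Proof.
case/imsetP=> z _ ->; congr (Posz (nat_of_bool _)).
by rewrite in_circ circ_eq.
Qed.

Variable col : 'I_n -> bool.
Hypothesis colour_E : forall x, colour col (E x) = ~~ colour col x.
Hypothesis planar :
  (n_comp (circ_r E (all_white col)) predT + n_comp (circ_r E (all_black col)) predT =
  #|'I_n| + (n_comp (total E) predT).*2)%N.

Let EK : involutive E := edgeK D.

(** On invariant functions the choice is forced by [nflips_uniq]; this is why it is linear and
    involutive there. *)
Definition nflip A (u : ends n -> int) : ends n -> int :=
  if pselect (exists w, nflips E col A u w) is left p then projT1 (cid p) else u.

Lemma nflipP A (u : ends n -> int) : inv E A u -> nflips E col A u (nflip A u).
Proof.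
move=> iu; rewrite /nflip; case: pselect => [p|[]]; first exact: projT2 (cid p).
exact: nflips_exists.
Qed.

Lemma nflip_eq A (u v : ends n -> int) : nflips E col A u v -> nflip A u =1 v.
Proof.
move=> uv x; rewrite /nflip; case: pselect => [p|[]]; last by exists v.
exact: (nflips_uniq EK (projT2 (cid p)) uv).
Qed.

(** A circle without crossings is a component of its own, hence a base circle, so the value on it is
    kept. *)
Definition flipH A u h : int :=
  match h with inl x => nflip A (u \o inl) x | inr _ => u h end.

Lemma invH_inl A u : invH A u -> inv E A (u \o inl).
Proof. by move=> iu x; split; apply: iu; rewrite /state_rel /= eqxx ?orbT. Qed.

Lemma flipH_inv A u : invH A u -> invH A (flipH A u).
Proof.
move=> iu h k hk; have [[iv _] _] := nflipP (invH_inl iu).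
case: h hk => [x|[l b]] /orP[] /eqP-> /=; try by case: (iv x).
all: by apply: iu; rewrite /state_rel /= eqxx ?orbT.
Qed.

Lemma flipH_jump A u x : invH A u ->
  flipH A u (inl (opp x)) - flipH A u (inl x) =
  (u (inl (opp x)) - u (inl x)) * (-1) ^+ black col A x.1.1.
Proof.
move=> iu; have [[_ jv] _] := nflipP (invH_inl iu); move: (jv x).
by rewrite /jump /= => ->; case: black; rewrite ?mulr1 ?mulrN1.
Qed.

Lemma flipHD A u v (c : int) : invH A u -> invH A v ->
  flipH A (fun h => u h + c * v h) =1 fun h => flipH A u h + c * flipH A v h.
Proof.
move=> iu iv [x|p] //=.
exact: (nflip_eq (nflipsD c (nflipP (invH_inl iu)) (nflipP (invH_inl iv)))).
Qed.

Lemma flipHK A u : invH A u -> flipH A (flipH A u) =1 u.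
Proof.
move=> iu [x|p] //=.
exact: (nflip_eq (nflips_sym (invH_inl iu) (nflipP (invH_inl iu)))).
Qed.

(** The compatibility of adjacent states on which the commutation with the edge maps rests. *)
Lemma flipH_tog A i u : invH A u -> invH (tog i A) u -> flipH (tog i A) u =1 flipH A u.
Proof.
move=> iu iu' [x|p] //=; apply: nflip_eq.
have iu1 := invH_inl iu; have iu2 := invH_inl iu'.
apply: nflips_tog (nflipP iu1) => // y yi; rewrite /jump.
have [_ e1] := iu1 (link A y); have [_ e2] := iu2 (link A y).
move: e1 e2; rewrite (link_tog_in _ (_ : (link A y).1.1 = i)) // linkK => e1 ->.
by rewrite -e1 subrr.
Qed.

Lemma eq_flipH A u v : u =1 v -> flipH A u =1 flipH A v.
Proof. by move/funext->. Qed.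

Lemma invH_sum A (s : seq {set H}) (a : {set H} -> int) : all [in circs A] s ->
  invH A (fun h => \sum_(c <- s) a c * ind c h).
Proof.
move=> /allP sA h k hk; apply: eq_big_seq => c /sA cA.
by rewrite (invH_ind cA hk).
Qed.

Lemma flipH_sum A (s : seq {set H}) (a : {set H} -> int) h : all [in circs A] s ->
  flipH A (fun h => \sum_(c <- s) a c * ind c h) h = \sum_(c <- s) a c * flipH A (ind c) h.
Proof.
elim: s h => [|c s IH] h /=.
  move=> _; rewrite big_nil; have i0 : invH A (fun=> 0) by [].
  under [X in flipH A X]funext do rewrite big_nil.
  have := @flipHD A _ _ 1 i0 i0 h; set f := flipH _ _ => e.
  have : f h = f h + 1 * f h by rewrite -{1}e; apply: eq_flipH => z; rewrite mul1r addr0.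
  by rewrite mul1r => /eqP; rewrite -subr_eq0 opprD addrA subrr sub0r oppr_eq0 => /eqP.
move=> /andP[cA sA]; rewrite big_cons -IH // addrC.
rewrite -(flipHD _ (invH_sum _ sA) (invH_ind cA)); apply: eq_flipH => z.
by rewrite big_cons addrC.
Qed.

Definition repv u c : int := if rep c is Some h then u h else 0.

Lemma repv_circ A u h : invH A u -> repv u (circ A h) = u h.
Proof. by move=> iu; rewrite /repv; have [k -> e] := rep_circ A h; apply: (invH_conn iu). Qed.

Lemma inv_expand A u h : invH A u -> u h = \sum_(c <- enum (circs A)) repv u c * ind c h.
Proof.
move=> iu; rewrite (bigD1_seq (circ A h)) ?mem_enum ?circ_in ?enum_uniq //=.
rewrite (ind_circ _ (circ_in A h)) eqxx mulr1 repv_circ // big_seq_cond big1 ?addr0 // => c.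
by rewrite mem_enum => /andP[cA /negPf nc]; rewrite (ind_circ _ cA) nc mulr0.
Qed.

(* The coefficient of [c'] in the image of [c] under an involution of the free
  abelian group on the circles that negates the difference of the circles at a
  black arc and fixes the one at a white arc. *)
Definition phi A c c' : int :=
  if c' \in circs A then repv (flipH A (ind c')) c else 0.

Lemma phi_circ A h c : c \in circs A -> phi A (circ A h) c = flipH A (ind c) h.
Proof.
by move=> cA; rewrite /phi cA repv_circ //; apply/flipH_inv/invH_ind.
Qed.

Lemma phi_out A c c' : c' \notin circs A -> phi A c c' = 0.
Proof. by rewrite /phi => /negPf->. Qed.

(** The involution on functions is the transpose of the one on circles, so properties of jumps
    become properties of [phi]. *)
Lemma flipH_phi A u h : invH A u ->
  flipH A u h = \sum_c phi A (circ A h) c * repv u c.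
Proof.
move=> iu; rewrite (eq_flipH A (fun k => inv_expand k iu)) flipH_sum; last first.
  by apply/allP => c; rewrite mem_enum.
rewrite big_enum /= big_mkcond /=; apply: eq_bigr => c _.
by case: ifP => cA; [rewrite phi_circ // mulrC|rewrite phi_out ?cA ?mul0r].
Qed.

Lemma phiK A c c' : c \in circs A -> \sum_k phi A c k * phi A k c' = (c' == c)%:Z.
Proof.
case/imsetP=> h _ ->; have [cA|cA] := boolP (c' \in circs A); last first.
  rewrite big1 => [|k _]; last by rewrite (phi_out _ cA) mulr0.
  by case: eqP => // e; rewrite e circ_in in cA.
transitivity (flipH A (flipH A (ind c')) h).
  rewrite flipH_phi; last exact/flipH_inv/invH_ind.
  by apply: eq_bigr => k _; congr (_ * _); rewrite /phi cA.
by rewrite flipHK ?(ind_circ _ cA) //; apply: invH_ind.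
Qed.

End StateCircles.

(** * Edge maps *)

Lemma mulz_signK (V : zmodType) (b : bool) : involutive (fun x : V => x *~ (-1) ^+ b).
Proof. by case: b => x; rewrite ?expr1 ?expr0 ?mulr1z // !mulrN1z opprK. Qed.

Lemma mulz_signI (V : zmodType) (b : bool) : injective (fun x : V => x *~ (-1) ^+ b).
Proof. exact: inv_inj (@mulz_signK V b). Qed.

Section Supports.
Variable S : finType.
Implicit Types (x : S) (X : {set S}) (f g : ext S) (v : S -> int).

Definition trunc X f : ext S := [ffun B : {set S} => if B \subset X then f B else 0].

Lemma supp_trunc X f : supp X (trunc X f).
Proof. by move=> B; rewrite ffunE; case: ifP => //; rewrite eqxx. Qed.

Lemma supp0 X : supp X (0 : ext S).
Proof. by move=> B; rewrite ffunE eqxx. Qed.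

Lemma supp_one X : supp X (one S).
Proof.
by move=> B; rewrite ffunE; case: (B =P set0) => [->|_]; rewrite ?sub0set ?eqxx.
Qed.

Lemma suppB X f g : supp X f -> supp X g -> supp X (f - g).
Proof.
move=> fX gX B; rewrite ext_subE.
by have [->|/fX] := eqVneq (f B) 0; rewrite // sub0r oppr_eq0 => /gX.
Qed.

Lemma supp_mulz X f (c : int) : supp X f -> supp X (f *~ c).
Proof. by move=> fX B; rewrite ext_mulzE mulf_eq0 negb_or => /andP[/fX]. Qed.

Lemma supp_lw X x f : x \in X -> supp X f -> supp X (lw x f).
Proof.
move=> xX fX B; rewrite lwE; case: ifP => xB; rewrite ?eqxx // mulf_eq0 negb_or.
by move=> /andP[_ /fX sX]; rewrite -(setD1K xB) subUset sX sub1set xX.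
Qed.

Lemma supp_L X v f : (forall x, v x != 0 -> x \in X) -> supp X f -> supp X (L v f).
Proof.
move=> vX fX B /L_neq0 [x [/vX xX xB /fX sX]].
by rewrite -(setD1K xB) subUset sX sub1set xX.
Qed.

End Supports.

Section EdgeMaps.
Variables (n : nat) (D : diagram n).
Local Notation H := (res_hs D).
Local Notation E := (edge D).
Implicit Types (A : {set 'I_n}) (h k : H) (c J : {set H}) (i j : 'I_n).
Implicit Types (f g G : ext {set H}) (b : bool).

(** In the state after a surgery at [i], this is the start circle minus the end circle of the dual
    arc, the vector that a split multiplies by. *)
Definition ev b A i c : int :=
  (c == circ A (inl (i, b, true)))%:Z - (c == circ A (inl (i, ~~ b, true)))%:Z.

(* [F] is the edge map from the state [A] to [tog i A], where the arc [i] starts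
  at the end with index [b]. *)
Record is_edge b A i (F : ext {set H} -> ext {set H}) : Prop := IsEdge {
  edge_additive : zmod_morphism F;
  edge_one : F (one _) = if self E A i then L (ev b (tog i A) i) (one _) else one _;
  edge_lw : forall h f, supp (circs D A) f ->
    F (lw (circ A h) f) = lw (circ (tog i A) h) (F f) *~ (-1) ^+ self E A i;
  edge_trunc : forall f, F f = F (trunc (circs D A) f) }.

Lemma ev_circs b A i c : ev b A i c != 0 -> c \in circs D A.
Proof.
rewrite /ev; have [->|_] := eqVneq c (circ A (inl (i, b, true))); first by rewrite circ_in.
by have [->|_] := eqVneq c (circ A (inl (i, ~~ b, true))); rewrite ?circ_in.
Qed.

Section OneEdge.
Variables (b : bool) (A : {set 'I_n}) (i : 'I_n) (F : ext {set H} -> ext {set H}).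
Hypothesis Fe : is_edge b A i F.

HB.instance Definition _ :=
  GRing.isZmodMorphism.Build _ _ F (edge_additive Fe).

Lemma edge0 : F 0 = 0.
Proof. exact: raddf0. Qed.

Lemma edgeMz f (c : int) : F (f *~ c) = F f *~ c.
Proof. exact: raddfMz. Qed.

Lemma edge_L v f : F (L v f) = \sum_c F (lw c f) *~ v c.
Proof. by rewrite /L raddf_sum; apply: eq_bigr => c _; rewrite raddfMz. Qed.

Lemma edge_supp f : supp (circs D A) f -> supp (circs D (tog i A)) (F f).
Proof.
elim/ext_ind => [||f1 f2 s1 s2|c f1 /imsetP[h _ ->] fA sf].
- by rewrite edge0; apply: supp0.
- rewrite (edge_one Fe); case: ifP => _; last exact: supp_one.
  by apply: supp_L (supp_one _); apply: ev_circs.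
- by rewrite (edge_additive Fe); apply: suppB.
by rewrite (edge_lw Fe) //; apply/supp_mulz/supp_lw => //; apply: circ_in.
Qed.

(** The classes are the circles of the coarser state: the one after a join, the one before a
    split. *)
Definition relU : rel H := fun h k => state_rel A h k || state_rel (tog i A) h k.

Lemma relU_sym : connect_sym relU.
Proof.
apply: connect_symP => h k /orP[] hk; have := connect1 hk; rewrite state_sym => kh;
  by apply: connect_sub kh => x y xy; apply: connect1; rewrite /relU xy ?orbT.
Qed.

(** [edge_lw] may be applied with any half-segment of a circle of [A]. After a split these lie on
    two circles, whose products with [F g] must therefore agree. *)
Lemma edge_glue g h k : supp (circs D A) g -> connect relU h k ->
  lw (circ (tog i A) h) (F g) = lw (circ (tog i A) k) (F g).
Proof.
move=> gA; move: h k.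
suff st h k : relU h k -> lw (circ (tog i A) k) (F g) = lw (circ (tog i A) h) (F g).
  by move=> h k hk; apply/esym/(connect_const st hk).
case/orP => hk; last first.
  by congr (lw _ _); apply/eqP; rewrite circ_eq state_sym connect1.
have : circ A k = circ A h by apply/eqP; rewrite circ_eq state_sym connect1.
move=> /(congr1 (fun c => F (lw c g))).
by rewrite !(edge_lw Fe) // => /mulz_signI.
Qed.

End OneEdge.

Variable col : 'I_n -> bool.
Hypothesis colour_E : forall x, colour col (E x) = ~~ colour col x.
Hypothesis planar :
  (n_comp (circ_r E (all_white col)) predT + n_comp (circ_r E (all_black col)) predT =
  #|'I_n| + (n_comp (total E) predT).*2)%N.
Local Notation phi := (phi col).

Lemma Phi_supp A f : supp (circs D A) f -> supp (circs D A) (Phi (phi A) f).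
Proof.
move=> fA B /(@Phi_neq0 _ _ _ (circs D A) (circs D A)) [] // c c' _.
by apply: contraNT => /phi_out ->.
Qed.

Lemma Phi_stK A f : supp (circs D A) f -> Phi (phi A) (Phi (phi A) f) = f.
Proof.
move=> fA; rewrite Phi_comp -[RHS]Phi_id; apply: eq_Phi_supp fA => c cA c'.
exact: (phiK colour_E planar).
Qed.

(** Circles of either state and classes of [relU] are all sets of half-segments, so one definition
    evaluates [M] on each of them. *)
Definition valJ (M : H -> ext {set H}) c : ext {set H} := if rep c is Some k then M k else 0.

Lemma valJ_circ M A h : (forall x y, connect (state_rel A) x y -> M x = M y) ->
  valJ M (circ A h) = M h.
Proof.
move=> MA; rewrite /valJ; have [k -> /eqP e] := rep_circ A h.
by apply: MA; rewrite -circ_eq.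
Qed.

Definition classJ A i h : {set H} := [set k | connect (relU A i) h k].
Definition classesJ A i := [set classJ A i h | h : H].

Lemma classJ_eq A i h k : (classJ A i h == classJ A i k) = connect (relU A i) h k.
Proof.
apply/eqP/idP => [e|hk]; last first.
  by apply/setP => z; rewrite !inE (same_connect (@relU_sym A i) hk).
have : k \in classJ A i k by rewrite inE connect0.
by rewrite -e inE.
Qed.

(* A sum over the circles of [B], grouped by the circles of the coarser one of
  the states [A] and [tog i A]. *)
Lemma sum_classes A i B M h :
  (forall x y, connect (relU A i) x y -> M x = M y) ->
  subrel (state_rel B) (relU A i) ->
  \sum_c valJ M c *~ phi B (circ B h) c =
  \sum_(J in classesJ A i) valJ M J *~ flipH col B (ind J) h.
Proof.
move=> MJ BU; have sub x y : connect (state_rel B) x y -> connect (relU A i) x y.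
  by apply: connect_sub => {}x {}y /BU; apply: connect1.
have iJ J : J \in classesJ A i -> invH B (ind J).
  case/imsetP=> z _ -> x y xy; rewrite /ind !inE; congr (Posz (nat_of_bool _)).
  by apply/esym/(same_connect_r (@relU_sym A i))/connect1/BU.
under [RHS]eq_bigr => J JA do rewrite (flipH_phi colour_E planar _ (iJ J JA)) mulrz_sumr.
rewrite exchange_big /=; apply: eq_bigr => c _.
have [/imsetP[k _ ->]|cB] := boolP (c \in circs D B); last first.
  by rewrite phi_out // mulr0z big1 // => J _; rewrite mul0r mulr0z.
have kA : classJ A i k \in classesJ A i by exact: imset_f.
rewrite (bigD1 _ kA) big1 /= => [|J /andP[JA nJ]].
  rewrite addr0 repv_circ; last exact: iJ.
  rewrite /ind inE connect0 mulr1; congr (_ *~ _).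
  rewrite valJ_circ; last by move=> x y /sub/MJ.
  rewrite /valJ /rep; case: pickP => [k'|/(_ k)]; last by rewrite inE connect0.
  by rewrite inE => /MJ.
rewrite repv_circ; last exact: iJ.
case/imsetP: JA nJ => z _ ->; rewrite classJ_eq /ind inE => /negPf->.
by rewrite mulr0 mulr0z.
Qed.

(** The difference of the circles at an arc is an eigenvector whose eigenvalue is given by the
    colour; reversing the arc contributes the remaining sign. *)
Lemma phi_ev b b' A i c :
  \sum_k ev b A i k * phi A k c = ev b' A i c * (-1) ^+ (b (+) b' (+) black col A i).
Proof.
have -> : \sum_k ev b A i k * phi A k c =
    phi A (circ A (inl (i, b, true))) c - phi A (circ A (inl (i, ~~ b, true))) c.
  rewrite /ev; under eq_bigr do rewrite mulrBl; rewrite sumrB.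
  have d c0 : \sum_k (k == c0)%:Z * phi A k c = phi A c0 c.
    by rewrite (bigD1 c0) //= eqxx mul1r big1 ?addr0 // => k /negPf->; rewrite mul0r.
  by rewrite !d.
have evN : ev b A i c = ev b' A i c * (-1) ^+ (b (+) b').
  by rewrite /ev; case: b b' => [] [] /=; ring.
have [cA|cA] := boolP (c \in circs D A); last first.
  rewrite !phi_out // subrr; have [->|/ev_circs cA'] := eqVneq (ev b' A i c) 0; first by rewrite mul0r.
  by rewrite cA' in cA.
rewrite signr_addb mulrA -evN !(phi_circ colour_E planar) //.
have := flipH_jump colour_E planar (i, ~~ b, true) (invH_ind cA).
rewrite /opp /= negbK => ->; rewrite !(ind_circ _ cA); reflexivity.
Qed.

(** At [one] the sign is that of [phi_ev] for the dual arc. When a circle is wedged on, both sides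
    become sums over the classes of [relU], whose indicators are invariant in both states, and
    [flipH_tog] identifies the coefficients. *)
Lemma edge_intertwine b b' A i F F' f : is_edge b A i F -> is_edge b' A i F' ->
  supp (circs D A) f ->
  Phi (phi (tog i A)) (F f) =
  F' (Phi (phi A) f) *~ (-1) ^+ (self E A i && (b (+) b' (+) black col (tog i A) i)).
Proof.
move=> Fe Fe'; elim/ext_ind => [||f1 f2 s1 s2|c f1 /imsetP[h _ ->] fA IH].
- by rewrite (edge0 Fe) !raddf0 (edge0 Fe') mul0rz.
- rewrite (edge_one Fe) Phi1 (edge_one Fe'); case: (self E A i) => /=; last by rewrite Phi1.
  rewrite Phi_L Phi1 (eq_L _ (fun c => phi_ev b b' (tog i A) i c)).
  rewrite /L mulrz_suml; apply: eq_bigr => c _; by rewrite mulrzA.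
- by rewrite (edge_additive Fe) !raddfB /= s1 s2 (edge_additive Fe') mulrzBl.
rewrite (edge_lw Fe) // raddfMz /= !Phi_lw IH raddfMz /=.
rewrite [in RHS](edge_L Fe').
set g := Phi (phi A) f1; set G := F' g; set s := (X in _ *~ X).
have gA : supp (circs D A) g by exact: Phi_supp.
pose M k := lw (circ (tog i A) k) G.
have MU x y : connect (relU A i) x y -> M x = M y by exact: (edge_glue Fe' gA).
have subA : subrel (state_rel A) (relU A i) by move=> x y xy; rewrite /relU xy.
have subA' : subrel (state_rel (tog i A)) (relU A i) by move=> x y xy; rewrite /relU xy orbT.
have MA x y : connect (state_rel A) x y -> M x = M y.
  by move=> xy; apply: MU; apply: connect_sub xy => {}x {}y /subA; apply: connect1.
have MA' x y : connect (state_rel (tog i A)) x y -> M x = M y.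
  by move=> xy; apply: MU; apply: connect_sub xy => {}x {}y /subA'; apply: connect1.
have -> : L (phi (tog i A) (circ (tog i A) h)) G =
    \sum_c valJ M c *~ phi (tog i A) (circ (tog i A) h) c.
  apply: eq_bigr => d _; have [/imsetP[k _ ->]|dA] := boolP (d \in circs D (tog i A)).
    by rewrite valJ_circ.
  by rewrite phi_out.
have -> : \sum_c F' (lw c g) *~ phi A (circ A h) c =
    (\sum_c valJ M c *~ phi A (circ A h) c) *~ (-1) ^+ self E A i.
  rewrite mulrz_suml; apply: eq_bigr => d _.
  have [/imsetP[k _ ->]|dA] := boolP (d \in circs D A); last by rewrite phi_out // mul0rz.
  by rewrite (edge_lw Fe') // valJ_circ // -!mulrzA mulrC.
rewrite !(@sum_classes A i) // -!mulrzA mulrC; congr (_ *~ _).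
apply: eq_bigr => J /imsetP[z _ ->]; congr (_ *~ _).
have iJ B : subrel (state_rel B) (relU A i) -> invH B (ind (classJ A i z)).
  move=> BU x y xy; rewrite /ind !inE; congr (Posz (nat_of_bool _)).
  by apply/esym/(same_connect_r (@relU_sym A i))/connect1/BU.
by apply: (flipH_tog colour_E planar); apply: iJ.
Qed.

End EdgeMaps.

(** * Edge maps as substitutions of circles *)

Section EdgeMapFormula.
Variable S : finType.
Implicit Types (x y : S) (f g : ext S) (B : {set S}).

Lemma lw_anti x y f : lw x (lw y f) = - lw y (lw x f).
Proof.
by have [->|/lwC//] := eqVneq x y; rewrite lwxx oppr0.
Qed.

Lemma wedgeBl f g k : wedge (f - g) k = wedge f k - wedge g k.
Proof.
apply/ffunP => B; rewrite ext_subE !ffunE -sumrB; apply: eq_bigr => A _.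
by rewrite ext_subE mulrBr mulrBl.
Qed.

Lemma mono_rem x B : x \in B -> mono B = lw x (mono (B :\ x)) *~ sg x (B :\ x).
Proof. by move=> xB; rewrite lw_mono ?setD11 // setD1K // -mulrzA sg_sq. Qed.

Definition subst (m : S -> S) : S -> S -> int := fun x y => (y == m x)%:Z.

Lemma Phi_subst_lw m x f : Phi (subst m) (lw x f) = lw (m x) (Phi (subst m) f).
Proof. by rewrite Phi_lw; apply: L_delta. Qed.

Lemma Phi_subst_fix m B : {in B, m =1 id} -> Phi (subst m) (mono B) = mono B.
Proof.
move=> mB; rewrite -[RHS]Phi_id; apply: (@eq_Phi_supp _ _ B) => [x xB y|A].
  by rewrite /subst mB.
by rewrite ffunE; case: (A =P B) => [->|_]; rewrite ?eqxx.
Qed.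

Lemma L_diff z1 z2 f : L (fun y => (y == z1)%:Z - (y == z2)%:Z) f = lw z1 f - lw z2 f.
Proof.
rewrite -!(L_delta _ f) /L -sumrB; apply: eq_bigr => y _.
by rewrite mulrzBr.
Qed.

Lemma lw_L_diff z1 z2 f : let e y := (y == z1)%:Z - (y == z2)%:Z in
  lw z1 (L e f) = lw z2 (L e f).
Proof. by move=> e; rewrite !L_diff !raddfB /= !lwxx sub0r subr0 -lw_anti. Qed.

End EdgeMapFormula.

Section EdgeMapPhi.
Variable C : config 1.
Local Notation T := {set hs C}.
Let x1 : T := start_circle C ord0.
Let x2 : T := end_circle C ord0.
Let z1 : T := start_circle (dual C) ord0.
Let z2 : T := end_circle (dual C) ord0.

(** For a split, sending the circle to [z1] rather than [z2] is harmless, since the result is then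
    multiplied by their difference. *)
Definition merge_circle (c : T) : T := if (c == x1) || (c == x2) then z1 else c.

Lemma edge_map_additive (F : ext T -> ext T) f :
  zmod_morphism F -> supp (circles C) f ->
  (forall B, edge_mono B = F (mono B)) -> edge_map (C := C) f = F f.
Proof.
move=> Fadd fC FB.
pose F' : {additive _ -> _} := HB.pack F (GRing.isZmodMorphism.Build _ _ F Fadd).
have FM u (c : int) : F (u *~ c) = F u *~ c by exact: (raddfMz F').
rewrite /edge_map -[RHS]/(F' f) [in RHS](ext_mono f) raddf_sum /= [RHS](bigID (fun B : {set T} => B \subset circles C)) /=.
rewrite [X in _ = _ + X]big1 ?addr0 => [|B nB].
  by apply: eq_bigr => B _; rewrite FM FB.
suff -> : f B = 0 by rewrite FM mulr0z.
by apply/eqP; apply: contraNT nB => /fC.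
Qed.

Lemma edge_map_join f : x1 != x2 -> supp (circles C) f ->
  edge_map (C := C) f = Phi (subst merge_circle) f.
Proof.
move=> x12 fC; apply: edge_map_additive => // [|B]; first exact: Phi_is_zmod_morphism.
rewrite /edge_mono -/x1 -/x2 -/z1 -/z2 x12.
have fixB (A : {set T}) : x1 \notin A -> x2 \notin A ->
    Phi (subst merge_circle) (mono A) = mono A.
  move=> n1 n2; apply: Phi_subst_fix => c cA; rewrite /merge_circle.
  by case: eqP => [e|_]; [rewrite -e cA in n1|case: eqP => [e|_//]; rewrite -e cA in n2].
have m1 : merge_circle x1 = z1 by rewrite /merge_circle eqxx.
have m2 : merge_circle x2 = z1 by rewrite /merge_circle eqxx orbT.
case: (boolP (x1 \in B)) => b1; case: (boolP (x2 \in B)) => b2.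
- have b2' : x2 \in B :\ x1 by rewrite !inE eq_sym x12.
  rewrite (mono_rem b1) (mono_rem b2') raddfMz /= Phi_subst_lw m1.
  by rewrite raddfMz /= Phi_subst_lw m2 raddfMz /= lwxx !mul0rz.
- rewrite [in RHS](mono_rem b1) raddfMz /= Phi_subst_lw m1 fixB ?wsign1 //.
    by rewrite setD11.
  by rewrite !inE negb_and b2 orbT.
- rewrite [in RHS](mono_rem b2) raddfMz /= Phi_subst_lw m2 fixB ?wsign1 //.
    by rewrite !inE negb_and b1 orbT.
  by rewrite setD11.
by rewrite fixB.
Qed.

Lemma edge_map_split f : x1 = x2 -> supp (circles C) f ->
  edge_map (C := C) f = L (fun c => (c == z1)%:Z - (c == z2)%:Z) (Phi (subst merge_circle) f).
Proof.
move=> x12 fC; set e := (fun c => _).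
apply: (@edge_map_additive (fun f => L e (Phi (subst merge_circle) f))) => // [u v|B].
  by rewrite !raddfB.
rewrite /edge_mono -/x1 -/x2 -/z1 -/z2 x12 eqxx /= -x12 L_diff.
have fixB (A : {set T}) : x1 \notin A -> Phi (subst merge_circle) (mono A) = mono A.
  move=> n1; apply: Phi_subst_fix => c cA; rewrite /merge_circle -x12 orbb.
  by case: eqP => [ec|_//]; rewrite -ec cA in n1.
have m1 : merge_circle x1 = z1 by rewrite /merge_circle eqxx.
case: (boolP (x1 \in B)) => b1; last by rewrite fixB // wedgeBl.
rewrite [in RHS](mono_rem b1) raddfMz /= Phi_subst_lw m1 fixB ?setD11 // wsign1.
by rewrite !raddfMz /= lwxx mul0rz add0r -lw_anti.
Qed.

End EdgeMapPhi.

(** * Circles before and after one surgery *)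

Section Toggle.
Variables (n : nat) (D : diagram n).
Local Notation H := (res_hs D).
Local Notation E := (edge D).
Implicit Types (A : {set 'I_n}) (h k : H) (i : 'I_n).

Definition at_cross i h : bool := if h is inl x then x.1.1 == i else false.

Lemma state_thr_tog A i h : ~~ at_cross i h -> state_thr (tog i A) h = state_thr A h.
Proof. by case: h => [x|//] /= xi; rewrite link_tog_out. Qed.

Lemma circ_away A i h : (forall k, k \in circ A h -> ~~ at_cross i k) ->
  circ (tog i A) h = circ A h.
Proof.
move=> away; have key B B' : (forall k, k \in circ A h -> state_rel B k =1 state_rel B' k) ->
    (forall k k', k \in circ A h -> state_rel B k k' -> k' \in circ A h) ->
    circ B h \subset circ B' h.
  move=> BB' cl; apply/subsetP => z; rewrite !in_circ.
  suff gen p u : u \in circ A h -> path (state_rel B) u p ->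
      connect (state_rel B') u (last u p).
    by move=> /connectP[p pp ->]; apply: gen => //; rewrite in_circ connect0.
  elim: p u => [|y p IH] u uA /=; first by move=> _; apply: connect0.
  move=> /andP[uy pp]; have yA := cl _ _ uA uy.
  by apply: connect_trans (connect1 _) (IH _ yA pp); rewrite -BB'.
have e k : k \in circ A h -> state_rel (tog i A) k =1 state_rel A k.
  by move=> /away nk k'; rewrite /state_rel state_thr_tog.
have cl k k' : k \in circ A h -> state_rel A k k' -> k' \in circ A h.
  by rewrite !in_circ => hk kk'; apply: connect_trans hk (connect1 kk').
apply/eqP; rewrite eqEsubset !key //.
- by move=> k kA k'; rewrite e.
- by move=> k k' kA; rewrite e //; apply: cl.
Qed.

Lemma circ_cross B i b s (x : ends n) : x.1.1 = i ->
  circ B (inl x) = circ B (inl (i, b, s) : H) \/ circ B (inl x) = circ B (inl (i, ~~ b, s) : H).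
Proof.
move=> xi.
have main y : y.1.1 = i -> y.2 = s ->
  circ B (inl y) = circ B (inl (i, b, s) : H) \/ circ B (inl y) = circ B (inl (i, ~~ b, s) : H).
  by case: y => [[j e] s'] /= -> ->; case: e b => [] []; auto.
have [xs|xs] := eqVneq x.2 s; first exact: main.
have -> : circ B (inl x) = circ B (inl (link B x) : H).
  by apply/eqP; rewrite circ_eq state_inl connect_link.
by apply: main => //=; case: x.2 s xs => [] [].
Qed.

Lemma circ_selfE A i b s :
  (circ A (inl (i, b, s)) == circ A (inl (i, ~~ b, s) : H)) = self E A i.
Proof. by rewrite circ_eq state_inl (selfE (edgeK D) A (x := (i, b, s))). Qed.

Lemma circ_tog_away A i b h :
  circ A h != circ A (inl (i, b, false) : H) -> circ A h != circ A (inl (i, ~~ b, false) : H) ->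
  circ (tog i A) h = circ A h.
Proof.
move=> n1 n2; apply: circ_away => -[x|//]; rewrite in_circ -circ_eq /= => /eqP e.
apply/negP => /eqP xi; rewrite e in n1 n2.
by case: (circ_cross A b false xi) => e'; rewrite e' eqxx in n1 n2.
Qed.

(** If the new circle avoided [i], it would already be a circle of [A], but the circle of [h] in [A]
    meets [i]. *)
Lemma circ_tog_cross A i b h :
  circ A h = circ A (inl (i, b, false) : H) \/ circ A h = circ A (inl (i, ~~ b, false) : H) ->
  circ (tog i A) h = circ (tog i A) (inl (i, b, true) : H) \/
  circ (tog i A) h = circ (tog i A) (inl (i, ~~ b, true) : H).
Proof.
move=> hx; case: (pickP [pred k in circ (tog i A) h | at_cross i k]) => [k|no].
  rewrite /= in_circ -circ_eq => /andP[/eqP->]; case: k => // x /= /eqP xi.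
  exact: circ_cross.
have e : circ A h = circ (tog i A) h.
  rewrite -{1}(togK i A); apply: circ_away => k kc; apply/negP => ki.
  by have := no k; rewrite /= kc ki.
have [x xi xh] : exists2 x : ends n, x.1.1 = i & (inl x : H) \in circ A h.
  by case: hx => ->; [exists (i, b, false)|exists (i, ~~ b, false)]; rewrite ?in_circ ?connect0.
by have := no (inl x); rewrite /= -e xh xi eqxx.
Qed.

Section EdgeConfig.
Variables (thr : H -> H) (tip : 'I_1 * bool * bool -> H).
Variables (segK : involutive (@res_seg n D)) (seg_neq : forall h, @res_seg n D h != h).
Variables (thrK : involutive thr) (thr_neq : forall h, thr h != h).
Variables (tip_inj : injective tip).
Variable (thr_tip : forall o e s, thr (tip (o, e, s)) = tip (o, e, ~~ s)).
Let C : config 1 := Config segK seg_neq thrK thr_neq tip_inj thr_tip.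
Variables (A : {set 'I_n}) (i : 'I_n) (b : bool).
Hypothesis thrE : thr =1 state_thr A.
Hypothesis tipE : forall e s, tip (ord0, e, s) = inl (i, e (+) b, s).
Hypothesis iA : i \notin A.
Variable col : 'I_n -> bool.
Hypothesis colour_E : forall x, colour col (E x) = ~~ colour col x.

Lemma config_circle h : circle (C := C) h = circ A h.
Proof.
apply/setP => k; rewrite inE in_circ; apply: eq_connect => u v.
by rewrite /circ_rel /state_rel /= thrE.
Qed.

Lemma config_circles : circles C = circs D A.
Proof. by apply: eq_imset => h; apply: config_circle. Qed.

Lemma config_dual_circle h : circle (C := dual C) h = circ (tog i A) h.
Proof.
apply/setP => k; rewrite inE in_circ; apply: eq_connect => u v.
rewrite /circ_rel /state_rel /=; congr (_ || (_ == _)).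
have [[j [e [s [_ ->]]]]|hP] := @surg_case _ C setT u.
  rewrite surg_thr_tip in_setT (ord1 j) /= !tipE /= /link /= in_tog eqxx (negPf iA) /=.
  by rewrite addbT addNb.
rewrite surg_thr_out // (@state_thr_tog A i u) -?thrE //.
case: u hP => [x|//] hP /=; apply/negP => /eqP xi.
have := hP (ord0, x.1.2 (+) b, x.2); rewrite in_setT => /(_ isT) /=.
by rewrite tipE addbK; case: x xi {hP} => [[j e] s] /= ->; rewrite eqxx.
Qed.

(** [thr] and [tip] are left general because the edges of the cube and the edges of a single square,
    which are restricted twice, both have this form. *)
Lemma edge_map_is_edge : is_edge b A i (edge_map (C := C)).
Proof.
have x1E : start_circle C ord0 = circ A (inl (i, b, false)).
  by rewrite /start_circle config_circle /= tipE.
have x2E : end_circle C ord0 = circ A (inl (i, ~~ b, false)).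
  by rewrite /end_circle config_circle /= tipE.
have z1E : start_circle (dual C) ord0 = circ (tog i A) (inl (i, b, true)).
  by rewrite /start_circle config_dual_circle /= tipE.
have z2E : end_circle (dual C) ord0 = circ (tog i A) (inl (i, ~~ b, true)).
  by rewrite /end_circle config_dual_circle /= tipE.
have tr f : edge_map (C := C) f = edge_map (C := C) (trunc (circs D A) f).
  by apply: eq_bigr => B BC; rewrite ffunE -config_circles BC.
split; [exact (@edge_map_is_zmod_morphism C)| | |exact: tr].
  case: ifP => sf.
    rewrite edge_map_split; first by rewrite Phi1; apply: eq_L => c; rewrite z1E z2E.
      by rewrite x1E x2E; apply/eqP; rewrite circ_selfE.
    exact: supp_one.
  rewrite edge_map_join ?Phi1 //; last exact: supp_one.
  by rewrite x1E x2E circ_selfE sf.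
move=> h f fA; have lA : supp (circles C) (lw (circ A h) f).
  by rewrite config_circles; apply: supp_lw => //; apply: circ_in.
have fC : supp (circles C) f by rewrite config_circles.
have [n12|y12] := boolP ((circ A h == start_circle C ord0) || (circ A h == end_circle C ord0)).
  have mh : merge_circle (C := C) (circ A h) = start_circle (dual C) ord0 by rewrite /merge_circle n12.
  have zz : circ (tog i A) h = start_circle (dual C) ord0 \/
      circ (tog i A) h = end_circle (dual C) ord0.
    rewrite z1E z2E; apply: circ_tog_cross.
    by move: n12; rewrite x1E x2E => /orP[] /eqP; auto.
  case: (boolP (self E A i)) => sf.
    have x12 : start_circle C ord0 = end_circle C ord0.
      by rewrite x1E x2E; apply/eqP; rewrite circ_selfE.
    rewrite !edge_map_split // Phi_subst_lw mh expr1 mulrN1z -[LHS]opprK -lw_L.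
    by congr (- _); case: zz => ->; rewrite // lw_L_diff.
  have x12 : start_circle C ord0 != end_circle C ord0 by rewrite x1E x2E circ_selfE.
  rewrite !edge_map_join // Phi_subst_lw mh expr0 mulr1z; case: zz => -> //.
  congr (lw _ _); rewrite z1E z2E; apply/eqP; rewrite circ_selfE.
  by rewrite (self_tog (edgeK D) colour_E).
have mh : merge_circle (C := C) (circ A h) = circ A h by rewrite /merge_circle (negPf y12).
move: y12; rewrite x1E x2E negb_or => /andP[n1 n2].
have -> : circ (tog i A) h = circ A h by apply: (circ_tog_away n1 n2).
case: (boolP (self E A i)) => sf.
  have x12 : start_circle C ord0 = end_circle C ord0.
    by rewrite x1E x2E; apply/eqP; rewrite circ_selfE.
  by rewrite !edge_map_split // Phi_subst_lw mh expr1 mulrN1z lw_L opprK.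
have x12 : start_circle C ord0 != end_circle C ord0 by rewrite x1E x2E circ_selfE.
by rewrite !edge_map_join // Phi_subst_lw mh expr0 mulr1z.
Qed.

End EdgeConfig.
End Toggle.

(** * Squares *)

Section ExtNonzero.
Variable S : finType.
Implicit Types (p q : S) (X : {set S}).

Lemma lw_one p : lw p (one S) = mono [set p].
Proof.
rewrite /one lw_mono ?inE // setU0 /sg.
by rewrite (_ : [set y in set0 | _] = set0) ?cards0 ?expr0 ?mulr1z //; apply/setP => y; rewrite !inE.
Qed.

Definition pm p q : S -> int := fun y => (y == p)%:Z - (y == q)%:Z.

Lemma pm_one p q : L (pm p q) (one S) = mono [set p] - mono [set q].
Proof. by rewrite L_diff !lw_one. Qed.

Lemma L_pmN p q f : L (pm q p) f = - L (pm p q) f.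
Proof. by rewrite !L_diff opprB. Qed.

Lemma pm_one_neq0 p q : p != q -> L (pm p q) (one S) <> 0.
Proof.
move=> pq /(congr1 (fun f : ext S => f [set p])).
rewrite pm_one ext_subE !ffunE eqxx.
by case: eqP => // /setP/(_ p); rewrite !inE eqxx (negPf pq).
Qed.

(** The coefficient of the monomial on [q] and [q'] is a sign. *)
Lemma pm_pm_neq0 p q p' q' : p != q -> p' != q' ->
  q \notin [:: p'; q'] -> q' \notin [:: p; q] ->
  L (pm p q) (L (pm p' q') (one S)) <> 0.
Proof.
rewrite !inE !negb_or => pq pq' /andP[qp' qq'] /andP[q'p q'q].
move=> /(congr1 (fun f : ext S => f [set q; q'])).
rewrite pm_one L_diff !(raddfB (lw _)) /=.
rewrite !ext_subE !lwE !inE eqxx (negPf pq).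
rewrite [p == q']eq_sym (negPf q'p) /=.
have -> : [set q; q'] :\ q = [set q'].
  by apply/setP => y; rewrite !inE; case: (eqVneq y q) => [->|]//=; rewrite (negPf qq').
rewrite !ffunE eqxx.
have -> : ([set q'] == [set p'] :> {set S}) = false.
  by apply/eqP => /setP/(_ q'); rewrite !inE eqxx eq_sym (negPf pq').
rewrite /= !(mulr0, mulr1, subr0, sub0r, opprK) => /eqP; by rewrite (negPf (sg_neq0 _ _)).
Qed.

Lemma pm_pm_neq0_or p q p' q' : p != q -> p' != q' ->
  p \notin [:: p'; q'] \/ q \notin [:: p'; q'] ->
  p' \notin [:: p; q] \/ q' \notin [:: p; q] ->
  L (pm p q) (L (pm p' q') (one S)) <> 0.
Proof.
have swap (x y : S) : [:: x; y] =i [:: y; x] by move=> z; rewrite !inE orbC.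
have half u v : u != v -> forall u' v', u' != v' -> v \notin [:: u'; v'] ->
    u' \notin [:: u; v] \/ v' \notin [:: u; v] -> L (pm u v) (L (pm u' v') (one S)) <> 0.
  move=> uv u' v' uv' nv [nu'|nv']; last exact: pm_pm_neq0.
  rewrite (L_pmN v' u') raddfN => /eqP; rewrite oppr_eq0 => /eqP.
  by apply: pm_pm_neq0; rewrite // 1?eq_sym // swap.
move=> pq pq' [np|nq] np'; last exact: half.
rewrite L_pmN => /eqP; rewrite oppr_eq0 => /eqP.
by apply: half => //; rewrite 1?eq_sym // ![_ \in [:: q; p]]swap.
Qed.

Lemma pm_eq p q p' q' : p != q -> p \in [:: p'; q'] -> q \in [:: p'; q'] ->
  exists s : bool, forall f, L (pm p' q') f = L (pm p q) f *~ (-1) ^+ s.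
Proof.
rewrite !inE => pq /orP[] /eqP ep /orP[] /eqP eq; subst.
- by rewrite eqxx in pq.
- by exists false => f; rewrite expr0 mulr1z.
- by exists true => f; rewrite expr1 mulrN1z L_pmN.
by rewrite eqxx in pq.
Qed.

End ExtNonzero.

Section Squares.
Variables (n : nat) (D : diagram n).
Local Notation H := (res_hs D).
Local Notation E := (edge D).
Variable col : 'I_n -> bool.
Hypothesis colour_E : forall x, colour col (E x) = ~~ colour col x.
Implicit Types (A B : {set 'I_n}) (h k : H) (i j : 'I_n) (x y : ends n).

Definition meets i (c : {set H}) := exists2 x : ends n, x.1.1 = i & (inl x : H) \in c.

Lemma meets_tog A i h : meets i (circ A h) -> meets i (circ (tog i A) h).
Proof.
move=> [x xi xh]; case: (pickP [pred k in circ (tog i A) h | at_cross i k]) => [k|no].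
  by move=> /andP[kc]; case: k kc => // y yc /eqP yi; exists y.
have e : circ A h = circ (tog i A) h.
  rewrite -{1}(togK i A); apply: circ_away => k kc; apply/negP => ki.
  by have := no k; rewrite /= kc ki.
by have := no (inl x); rewrite /= -e xh xi eqxx.
Qed.

Lemma meets_togE A i h : meets i (circ (tog i A) h) -> meets i (circ A h).
Proof. by move/meets_tog; rewrite togK. Qed.

Lemma meets_self A i h x : self E A i -> x.1.1 = i -> meets i (circ A h) ->
  circ A h = circ A (inl x).
Proof.
move=> si xi [y yi yh].
have -> : circ A h = circ A (inl y) by apply/eqP; rewrite circ_eq -in_circ.
have b := circ_selfE D A i false true; rewrite si in b; move/eqP: b => b.
by case: (circ_cross D A false true yi) => ->; case: (circ_cross D A false true xi) => ->.
Qed.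

Lemma meets_in A i x : x.1.1 = i -> meets i (circ A (inl x : H)).
Proof. by move=> xi; exists x; rewrite // in_circ connect0. Qed.

Lemma meets_no A i h : ~ meets i (circ A h) -> circ (tog i A) h = circ A h.
Proof.
move=> nm; apply: circ_away => k kc; apply/negP => ki; apply: nm.
by case: k kc ki => // x xc /eqP xi; exists x.
Qed.

Lemma meets_dec i (c : {set H}) : meets i c \/ ~ meets i c.
Proof.
case: (pickP [pred x : ends n | (x.1.1 == i) && ((inl x : H) \in c)]) => [x|no].
  by move=> /andP[/eqP xi xc]; left; exists x.
by right=> -[x xi xc]; have := no x; rewrite /= xi eqxx xc.
Qed.

Local Notation one := (one {set H}).

Lemma evE b A i : ev (D := D) b A i = pm (circ A (inl (i, b, true))) (circ A (inl (i, ~~ b, true))).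
Proof. by []. Qed.

Lemma ev_one_neq0 b A i : ~~ self E A i -> L (ev (D := D) b A i) one <> 0.
Proof. by rewrite -(circ_selfE D A i b true) => /pm_one_neq0. Qed.

Lemma edge_ev b b' B (k l : 'I_n) G : is_edge (D := D) b B k G ->
  G (L (ev b' B l) one) = L (ev b' (tog k B) l) (G one) *~ (-1) ^+ self E B k.
Proof.
move=> Ge; rewrite !evE !L_diff (edge_additive Ge) !(edge_lw Ge); try exact: supp_one.
by rewrite mulrzBl.
Qed.

Lemma path_one b b' B (k l : 'I_n) F G : is_edge (D := D) b B k F -> is_edge b' (tog k B) l G ->
  G (F one) = match self E B k, self E (tog k B) l with
              | false, false => one
              | true, false => L (ev b (tog l (tog k B)) k) one
              | false, true => L (ev b' (tog l (tog k B)) l) one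
              | true, true => - L (ev b (tog l (tog k B)) k) (L (ev b' (tog l (tog k B)) l) one)
              end.
Proof.
move=> Fe Ge; rewrite (edge_one Fe); case: (self E B k).
  rewrite (edge_ev _ _ Ge) (edge_one Ge); case: (self E _ l); last by rewrite expr0 mulr1z.
  by rewrite expr1 mulrN1z.
by rewrite (edge_one Ge).
Qed.

Section Square.
Variables (A : {set 'I_n}) (i j : 'I_n) (bi bj : bool).
Variables Fi Gj Fj Gi : ext {set H} -> ext {set H}.
Hypothesis FiE : is_edge bi A i Fi.
Hypothesis GjE : is_edge bj (tog i A) j Gj.
Hypothesis FjE : is_edge bj A j Fj.
Hypothesis GiE : is_edge bi (tog j A) i Gi.
Let P f := Gj (Fi f).
Let Q f := Gi (Fj f).
Let A2 := tog j (tog i A).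
Let si := self E A i.
Let sj := self E A j.
Let sij := self E (tog i A) j.
Let sji := self E (tog j A) i.

(** Both paths contain equally many splits by [self_square], so a circle wedged on the left passes
    through them with the same sign, and the comparison at [one] decides. *)
Lemma path_sign (s : bool) : P one = Q one *~ (-1) ^+ s -> forall f, P f = Q f *~ (-1) ^+ s.
Proof.
move=> PQ f; rewrite /P /Q (edge_trunc FiE) (edge_trunc FjE).
have : supp (circs D A) (trunc (circs D A) f) by exact: supp_trunc.
elim/ext_ind => [||f1 f2 s1 s2|c f1 /imsetP[h _ ->] fA IH].
- by rewrite (edge0 FiE) (edge0 FjE) (edge0 GjE) (edge0 GiE) mul0rz.
- exact: PQ.
- rewrite (edge_additive FiE) (edge_additive FjE) (edge_additive GjE) (edge_additive GiE).
  by rewrite s1 s2 mulrzBl.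
rewrite (edge_lw FiE) // (edge_lw FjE) // (edgeMz GjE) (edgeMz GiE).
rewrite (edge_lw GjE); last exact: edge_supp FiE _ fA.
rewrite (edge_lw GiE); last exact: edge_supp FjE _ fA.
rewrite IH (togC i j) raddfMz /=; set X := lw _ _.
have := self_square (edgeK D) colour_E A i j.
case: (self E A i) (self E A j) (self E (tog i A) j) (self E (tog j A) i) s {PQ IH}
  => [] [] [] [] [] //= _; by rewrite ?(expr0, expr1, mulr1z, mulrN1z, opprK).
Qed.

Lemma square_count : (si + sij = sj + sji)%N.
Proof. exact: self_square (edgeK D) colour_E A i j. Qed.

Lemma self2i : self E A2 i = ~~ sji.
Proof. by rewrite /A2 togC (self_tog (edgeK D) colour_E). Qed.

Lemma self2j : self E A2 j = ~~ sij.
Proof. by rewrite /A2 (self_tog (edgeK D) colour_E). Qed.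

End Square.

(** After the surgery at [k] a single circle carries [l]. If both final circles at [k] met [l], both
    ends of [k] would have been on that circle before the surgery at [l]. *)
Lemma apart B (k l : 'I_n) b b' : ~~ self E (tog k B) k -> self E (tog k B) l ->
  let C2 := tog l (tog k B) in
  circ C2 (inl (k, b, true) : H) \notin [:: circ C2 (inl (l, b', true)); circ C2 (inl (l, ~~ b', true))] \/
  circ C2 (inl (k, ~~ b, true) : H) \notin [:: circ C2 (inl (l, b', true)); circ C2 (inl (l, ~~ b', true))].
Proof.
move=> nk sl C2; set s := [:: _; _].
have key e : circ C2 (inl (k, e, true) : H) \in s ->
    circ (tog k B) (inl (k, e, true) : H) = circ (tog k B) (inl (l, b', true)).
  move=> es; apply: (meets_self sl) => //; apply: (@meets_togE (tog k B) l).
  move: es; rewrite !inE => /orP[] /eqP->; exact: meets_in.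
case: (boolP (_ \in s)) => [h1|]; last by left.
case: (boolP (circ C2 (inl (k, ~~ b, true)) \in s)) => [h2|]; last by right.
by have := circ_selfE D (tog k B) k b true; rewrite (key _ h1) (key _ h2) eqxx (negPf nk).
Qed.

(** The excluded pattern, a split followed by a join on both paths, is the one with vanishing
    composites. [self_square] leaves five others, each decided by the value at [one]. *)
Lemma square_cases A i j bi bj Fi Gj Fj Gi :
  is_edge (D := D) bi A i Fi -> is_edge bj (tog i A) j Gj ->
  is_edge bj A j Fj -> is_edge bi (tog j A) i Gi ->
  ~~ [&& self E A i, self E A j, ~~ self E (tog i A) j & ~~ self E (tog j A) i] ->
  (exists s : bool, forall f, Gj (Fi f) = Gi (Fj f) *~ (-1) ^+ s) /\ Gj (Fi one) <> 0.
Proof.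
move=> FiE GjE FjE GiE nalt.
suff [[s PQ] nz] : (exists s : bool, Gj (Fi one) = Gi (Fj one) *~ (-1) ^+ s) /\ Gj (Fi one) <> 0.
  by split=> //; exists s; exact: (path_sign FiE GjE FjE GiE).
have := square_count A i j; have := self2i A i j; have := self2j A i j.
rewrite (path_one FiE GjE) (path_one FjE GiE) -(togC i j).
have si' := self_tog (edgeK D) colour_E A i.
have sj' := self_tog (edgeK D) colour_E A j.
case si: (self E A i) nalt si'; case sj: (self E A j) sj';
case sij: (self E (tog i A) j); case sji: (self E (tog j A) i) => //= sj' nalt si' s2j s2i _.
- split; first by exists true; rewrite expr1 mulrN1z opprK L_anti opprK.
  move=> /eqP; rewrite oppr_eq0 => /eqP; rewrite !evE; apply: pm_pm_neq0_or.
  - by rewrite circ_selfE s2i.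
  - by rewrite circ_selfE s2j.
  - by rewrite (togC i j); apply: apart; rewrite ?si' ?sij.
  by apply: apart; rewrite ?sj' ?sji.
- split; first by exists false; rewrite expr0 mulr1z.
  by apply: ev_one_neq0; rewrite s2i.
- split; first by exists false; rewrite expr0 mulr1z.
  by apply: ev_one_neq0; rewrite s2j.
(* A join and then a split on both paths: the arcs connect the same two circles, so both vectors are
   differences of one pair of circles. *)
- have key b : circ (tog i (tog j A)) (inl (i, b, true) : H) \in
      [:: circ (tog i (tog j A)) (inl (j, bj, true)); circ (tog i (tog j A)) (inl (j, ~~ bj, true))].
    have mi : meets j (circ (tog i A) (inl (i, b, true) : H)).
      have mj : meets i (circ A (inl (j, true, true) : H)) \/ meets i (circ A (inl (j, false, true) : H)).
        case: (meets_dec i (circ A (inl (j, true, true) : H))) => [|/meets_no n1]; first by left.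
        case: (meets_dec i (circ A (inl (j, false, true) : H))) => [|/meets_no n2]; first by right.
        have := circ_selfE D A j true true; rewrite sj -n1 -n2 /=.
        by rewrite (circ_selfE D (tog i A) j true true) sij.
      case: mj => /meets_tog /(meets_self (x := (i, b, true)) si' erefl) <-; exact: meets_in.
    move: mi => /meets_tog; rewrite -(togC i j) => -[x xj].
    rewrite in_circ -circ_eq => /eqP->.
    by rewrite !inE; case: (circ_cross D (tog i (tog j A)) bj true xj) => ->; rewrite eqxx ?orbT.
  split; last by apply: ev_one_neq0; rewrite s2j.
  have pq := circ_selfE D (tog i (tog j A)) i bi true; rewrite s2i in pq.
  have [s es] := pm_eq (negbT pq) (key bi) (key (~~ bi)).
  by exists s; rewrite !evE es.
split; first by exists false; rewrite expr0 mulr1z.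
move=> /(congr1 (fun f : ext {set H} => f set0)); by rewrite !ffunE eqxx.
Qed.

End Squares.

(** * Two alternating arcs on one circle *)

Section Alternating.
Variables (n : nat) (D : diagram n).
Local Notation H := (res_hs D).
Local Notation E := (edge D).
Variable col : 'I_n -> bool.
Hypothesis colour_E : forall x, colour col (E x) = ~~ colour col x.
Hypothesis planar :
  (n_comp (circ_r E (all_white col)) predT + n_comp (circ_r E (all_black col)) predT =
  #|'I_n| + (n_comp (total E) predT).*2)%N.
Implicit Types (A B : {set 'I_n}) (h k : H) (i j : 'I_n) (x y : ends n).

Definition travelH A h : H := state_thr A (res_seg h).

Lemma travelH_inj A : injective (travelH A).
Proof. exact: inj_comp (inv_inj (@state_thrK _ D A)) (inv_inj (@res_segK _ D)). Qed.

Lemma travelH_inl A m x : exists2 y, iter m (travelH A) (inl x) = inl y & colour col y = colour col x.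
Proof.
elim: m => [|m [y e cy]]; first by exists x.
exists (link A (E y)); first by rewrite iterS e.
by rewrite colour_link colour_E negbK.
Qed.

Lemma travelH_conn A m x y : iter m (travelH A) (inl x) = inl y -> connect (circ_r E A) x y.
Proof.
elim: m y => [|m IH] y; first by move=> [->]; apply: connect0.
have [z e _] := travelH_inl A m x; rewrite iterS e /travelH /= => -[<-].
apply: connect_trans (IH _ e) _; apply: connect_trans (connect_link _ _ _).
by apply: connect1; rewrite /circ_r eqxx.
Qed.

(** Travelling preserves the colour and visits the darts of the circle that have the colour of its
    starting point. *)
Lemma conn_travelH A x y : connect (circ_r E A) x y -> colour col x = colour col y ->
  fconnect (travelH A) (inl x) (inl y).
Proof.
move=> xy cxy; have fs := fconnect_sym (@travelH_inj A).
pose g z := if colour col z == colour col x then z else link A z.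
have N c b : (~~ c == b) = ~~ (c == b) by case: c b => [] [].
have step u v : circ_r E A u v ->
    fingraph.root (frel (travelH A)) (inl (g v)) = fingraph.root (frel (travelH A)) (inl (g u)).
  move=> uv; apply/eqP; rewrite (root_connect fs); case/orP: uv => /eqP->; rewrite /g.
    rewrite colour_E N; case: (colour col u == colour col x) => /=.
      by rewrite fs; apply: (fconnect1 (travelH A) (inl u)).
    by have := fconnect1 (travelH A) (inl (E u)); rewrite /travelH /= edgeK.
  by rewrite colour_link N; case: (colour col u == _); rewrite /= ?linkK; apply: connect0.
have := connect_const step xy; rewrite /g cxy eqxx => /eqP.
by rewrite (root_connect fs) fs.
Qed.

Section Alt.
Variables (A : {set 'I_n}) (i j : 'I_n).
Hypothesis ij : i != j.
Hypotheses (iA : i \notin A) (jA : j \notin A).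
Hypotheses (si : self E A i) (sj : self E A j) (sij : ~~ self E (tog i A) j).
Let B := tog i A.

(** A circle carrying [j] but not [i] would survive the surgery at [i], and [j] would still have
    both ends on it. *)
Lemma alt_at x y : x.1.1 = i -> y.1.1 = j ->
  connect (circ_r E B) x y (+) connect (circ_r E B) (opp x) y.
Proof.
move=> xi yj; have cs := circ_sym (edgeK D) B.
have sB : ~~ connect (circ_r E B) x (opp x).
  by rewrite -(selfE (edgeK D) B xi) (self_tog (edgeK D) colour_E) negbK.
have my : meets i (circ B (inl y : H)).
  apply: meets_tog; case: (meets_dec i (circ A (inl y : H))) => // nm.
  have nm' : ~ meets i (circ A (inl (opp y) : H)).
    suff -> : circ A (inl (opp y) : H) = circ A (inl y : H) by [].
    by apply/eqP; rewrite circ_eq state_inl (circ_sym (edgeK D)) -(selfE (edgeK D) A yj).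
  have e : circ A (inl y : H) = circ A (inl (opp y) : H).
    by apply/eqP; rewrite circ_eq state_inl -(selfE (edgeK D) A yj).
  case/negP: sij; rewrite (selfE (edgeK D) (tog i A) yj) -state_inl -circ_eq.
  by rewrite (meets_no nm) (meets_no nm') e.
have [z zi] := my; rewrite in_circ state_inl => yz.
have zx : connect (circ_r E B) z x \/ connect (circ_r E B) z (opp x).
  have l u : connect (circ_r E B) (link B u) u by rewrite cs connect_link.
  by case: (dart_cases B xi zi) => ->; [left|left|right|right];
    rewrite ?connect0 ?l // -link_opp l.
case: zx => zx; have yx := connect_trans yz zx; rewrite cs in yx; rewrite yx.
  by apply/negP => oy; case/negP: sB; rewrite cs in oy; apply: connect_trans yx oy.
rewrite addbT; apply/negP => xy; case/negP: sB; rewrite cs in yx.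
exact: connect_trans xy yx.
Qed.

Lemma alt_opp x y : x.1.1 = i -> y.1.1 = j ->
  connect (circ_r E B) x (opp y) = ~~ connect (circ_r E B) x y.
Proof.
move=> xi yj; have cs := circ_sym (edgeK D) B.
have ny : ~~ connect (circ_r E B) y (opp y) by rewrite -(selfE (edgeK D) B yj).
have [xy|nxy] := boolP (connect _ x y).
  by apply/negP => xo; case/negP: ny; rewrite cs in xy; apply: connect_trans xy xo.
have := alt_at xi yj; rewrite (negPf nxy) /= => oy.
have := alt_at xi (_ : (opp y).1.1 = j) => /(_ yj).
case: (connect _ x (opp y)) => //= oo; case/negP: ny; rewrite cs in oy.
exact: connect_trans oy oo.
Qed.

Lemma alt_opp_l x y : x.1.1 = i -> y.1.1 = j ->
  connect (circ_r E B) (opp x) y = ~~ connect (circ_r E B) x y.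
Proof. by move=> xi yj; have := alt_at xi yj; case: connect; case: connect. Qed.

Lemma alt_parity e e' : connect (circ_r E B) (i, e, false) (j, e', true) =
  connect (circ_r E B) (i, false, false) (j, false, true) (+) e (+) e'.
Proof.
have h e2 : connect (circ_r E B) (i, e2, false) (j, e', true) =
    connect (circ_r E B) (i, e2, false) (j, false, true) (+) e'.
  case: e'; last by rewrite addbF.
  by rewrite addbT -(@alt_opp (i, e2, false) (j, false, true)).
rewrite h; case: e; last by rewrite addbF.
by rewrite addbT -(@alt_opp_l (i, false, false) (j, false, true)).
Qed.

(** After the surgery at [i] both arcs join the same two distinct circles, so the involution
    multiplies one nonzero difference by both colour signs. These agree, and the surgery has changed
    the colour at [i]. *)
Lemma alt_black : black col A i = ~~ black col A j.
Proof.
pose x : ends n := (i, false, false); pose y : ends n := (j, false, false).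
have xi : x.1.1 = i by []; have yj : y.1.1 = j by [].
pose u := ind (D := D) (circ B (inl x)).
have cB : circ B (inl x : H) \in circs D B by exact: circ_in.
have iu : invH B u := invH_ind cB.
have iv := flipH_inv colour_E planar iu.
have jx : flipH col B u (inl (opp x)) - flipH col B u (inl x) =
    (u (inl (opp x)) - u (inl x)) * (-1) ^+ black col B i by exact: flipH_jump.
have jy : flipH col B u (inl (opp y)) - flipH col B u (inl y) =
    (u (inl (opp y)) - u (inl y)) * (-1) ^+ black col B j by exact: flipH_jump.
have cs := circ_sym (edgeK D) B.
have eqv a b : connect (circ_r E B) a b ->
    flipH col B u (inl b) = flipH col B u (inl a) /\ u (inl b) = u (inl a).
  move=> ab; have e : circ B (inl a : H) = circ B (inl b) by apply/eqP; rewrite circ_eq state_inl.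
  by rewrite (invH_conn iv e) (invH_conn iu e).
have ux : u (inl x) = 1 by rewrite /u (ind_circ _ cB) eqxx.
have uo : u (inl (opp x)) = 0.
  rewrite /u (ind_circ _ cB) circ_eq state_inl -(selfE (edgeK D) B xi).
  by rewrite (self_tog (edgeK D) colour_E) si.
suff : black col B i = black col B j.
  by rewrite !black_tog eqxx eq_sym (negPf ij) addbT addbF => <-; rewrite negbK.
move: jx jy; rewrite ux uo.
have o2 := alt_opp xi yj; have o3 := alt_opp_l xi yj.
have o4 : connect (circ_r E B) (opp x) (opp y) = connect (circ_r E B) x y.
  by rewrite (@alt_opp (opp x) y) // o3 negbK.
have [xy|nxy] := boolP (connect (circ_r E B) x y).
  rewrite xy in o4; have [-> ->] := eqv _ _ o4; have [-> ->] := eqv _ _ xy.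
  by rewrite ux uo => ->; case: (black col B i) (black col B j) => [] [] //=; lia.
rewrite (negPf nxy) in o2 o3; have [-> ->] := eqv _ _ o2; have [-> ->] := eqv _ _ o3.
rewrite ux uo; move: (flipH col B u (inl x)) (flipH col B u (inl (opp x))) => a b.
by case: (black col B i) (black col B j) => [] [] //=; clear - a b; lia.
Qed.

Lemma subseq_orbit (T : finType) (f : T -> T) z a b c :
  (0 < a < b)%N -> (b < c < order f z)%N ->
  subseq [:: z; iter a f z; iter b f z; iter c f z] (orbit f z).
Proof.
move=> /andP[a0 ab] /andP[bc cN].
have -> : orbit f z = [seq iter m f z | m <- iota 0 (order f z)].
  apply: (@eq_from_nth _ z); first by rewrite size_orbit size_map size_iota.
  move=> m; rewrite size_orbit => mN.
  by rewrite (nth_map 0%N) ?size_iota // nth_iota // nth_traject.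
have -> : [:: z; iter a f z; iter b f z; iter c f z] =
    [seq iter m f z | m <- [:: 0; a; b; c]%N] by [].
apply: map_subseq.
have <- : [seq m <- iota 0 (order f z) | m \in [:: 0; a; b; c]%N] = [:: 0; a; b; c]%N.
  apply: (irr_sorted_eq ltn_trans ltnn).
  - by apply: sorted_filter; [exact: ltn_trans|exact: iota_ltn_sorted].
  - by rewrite /= a0 ab bc.
  move=> m; rewrite mem_filter mem_iota !inE.
  by case: eqP => [->|_]; [|case: eqP => [->|_]; [|case: eqP => [->|_]; [|case: eqP => [->|_]]]] => //=; lia.
exact: filter_subseq.
Qed.

(* The journey from [x] in the state [A] agrees with the one in [tog i A] until it
  reaches [opp x]; the latter then returns to [x].  So the darts at [j] on the
  circle of [x] in [tog i A] are met before [opp x], the others after it. *)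
Lemma alternating_order e e' :
  connect (circ_r E B) (i, e, false) (j, e', true) ->
  subseq [:: inl (i, e, false); inl (j, e', true); inl (i, ~~ e, false); inl (j, ~~ e', true)]
    (orbit (travelH A) (inl (i, e, false) : H)).
Proof.
move=> xyB; set x : ends n := (i, e, false); set y : ends n := (j, e', true).
have xi : x.1.1 = i by []; have yj : y.1.1 = j by [].
(* The arcs have different colours, which offsets the different last components of [x] and [y].
   Travelling from [x] therefore passes [j] in darts of the form of [y]. *)
have cxy : colour col x = colour col y.
  have := alt_black; rewrite /black (negPf iA) (negPf jA) /colour /=.
  by case: (col i) (col j) => [] [].
have cox : colour col (opp x) = colour col x by [].
have coy : colour col (opp y) = colour col y by [].
pose g0 : H := inl x; pose tr := travelH A; pose tr' := travelH B.
have tr_inj := @travelH_inj A.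
have xoA : connect (circ_r E A) x (opp x) by rewrite -(selfE (edgeK D) A xi).
have fx : fconnect tr g0 (inl (opp x)) by apply: conn_travelH.
pose k := findex tr g0 (inl (opp x)).
have kN : (k < order tr g0)%N by exact: findex_max.
have ek : iter k tr g0 = inl (opp x) by exact: iter_findex.
have k0 : (0 < k)%N.
  rewrite lt0n; apply/eqP => k0; move: ek; rewrite k0 /= => -[] /eqP.
  by case: (e).
have uniq_it m m' : (m < order tr g0)%N -> (m' < order tr g0)%N ->
    iter m tr g0 = iter m' tr g0 -> m = m'.
  move=> mN m'N; by move=> em; rewrite -(findex_iter mN) em findex_iter.
(* The walks differ only when they arrive at [i], and the colour allows no darts there but [x] and
   [opp x]. *)
have same m : (m < k)%N -> iter m tr' g0 = iter m tr g0.
  elim: m => // m IH mk; rewrite !iterS IH ?(ltnW mk) //.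
  have [z ez cz] := travelH_inl A m.+1 x.
  have ez' : tr (iter m tr g0) = inl z by exact: ez.
  rewrite ez' /tr' /travelH /B state_thr_tog; first exact: ez'.
  rewrite -[res_seg _](@state_thrK _ D A) -/(travelH A _) -/tr ez' /=; apply/eqP => zi.
  have z2 : z.2 = x.2.
    move: cz; rewrite /colour zi /=; by case: z.2 (col i) => [] [].
  have [zx|zx] : z = x \/ z = opp x.
    by case: z zi z2 {ez ez' cz} => [[q e1] s1] /= -> ->; rewrite /x /opp /=; case: (e) e1 => [] []; auto.
  - have := @uniq_it m.+1 0%N (ltn_trans mk kN) (ltn_trans k0 kN).
    by rewrite iterS ez' zx => /(_ erefl).
  - have := @uniq_it m.+1 k (ltn_trans mk kN) kN.
    by rewrite iterS ez' zx ek => /(_ erefl) mk'; rewrite mk' ltnn in mk.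
have back : iter k tr' g0 = g0.
  rewrite -(prednK k0) iterS same ?prednK //.
  have et : tr (iter k.-1 tr g0) = inl (opp x) by rewrite -iterS prednK.
  have es : res_seg (iter k.-1 tr g0) = state_thr A (inl (opp x)).
    by rewrite -et /tr /travelH state_thrK.
  rewrite /tr' /travelH es /= link_tog_in //= linkK oppK; by [].
have cyc m : exists2 a, (a < k)%N & iter m tr' g0 = iter a tr g0.
  exists (m %% k)%N; first by rewrite ltn_mod.
  rewrite -same ?ltn_mod // {1}(divn_eq m k) addnC iterD; congr (iter _ _ _).
  by elim: (m %/ k)%N => //= q IH; rewrite mulSn iterD IH.
have fy : fconnect tr' g0 (inl y) by apply: conn_travelH.
have [a ak ea] := cyc (findex tr' g0 (inl y)); rewrite iter_findex // in ea.
have a0 : (0 < a)%N.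
  rewrite lt0n; apply/eqP => a0; move: ea; rewrite a0 /= => -[] ji.
  by move: ij; rewrite ji eqxx.
have xoy : connect (circ_r E A) x (opp y).
  have cs := circ_sym (edgeK D) A.
  have xyA : connect (circ_r E A) x y by rewrite ea in fy; exact: (travelH_conn (esym ea)).
  by apply: connect_trans xyA _; rewrite -(selfE (edgeK D) A yj).
have foy : fconnect tr g0 (inl (opp y)) by apply: conn_travelH; rewrite // coy.
pose m := findex tr g0 (inl (opp y)).
have mN : (m < order tr g0)%N by exact: findex_max.
have em : iter m tr g0 = inl (opp y) by exact: iter_findex.
have km : (k < m)%N.
  rewrite ltnNge leq_eqVlt negb_or; apply/andP; split.
    apply/eqP => mk; move: em; rewrite mk ek => -[] ji _.
    by move: ij; rewrite ji eqxx.
  apply/negP => mk; have := em; rewrite -same // => /travelH_conn.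
  by rewrite -/B (alt_opp xi yj) xyB.
have ka : (0 < a < k)%N by exact (introT andP (conj a0 ak)).
have kmN : (k < m < order tr g0)%N by exact (introT andP (conj km mN)).
have fin u v w : iter a tr g0 = u -> iter k tr g0 = v -> iter m tr g0 = w ->
    subseq [:: g0; u; v; w] (orbit tr g0).
  by move=> <- <- <-; exact: (subseq_orbit ka kmN).
exact: (fin _ _ _ (esym ea) ek em).
Qed.

End Alt.
End Alternating.

(** * Signs on the cube *)

Section CubeCohomology.
Variables (n : nat) (z : {set 'I_n} -> 'I_n -> bool).
Implicit Types (A B : {set 'I_n}) (i j m : 'I_n).
Hypothesis z_square : forall A i j, i != j -> i \notin A -> j \notin A ->
  z A i (+) z (tog i A) j = z A j (+) z (tog j A) i.

(* The sum of [z] along the path from the empty set to [A] that adds the elements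
  in increasing order. *)
Definition cube_sum A := \big[addb/false]_(i in A) z [set k in A | (k < i)%N] i.

Lemma cube_sum_max B m : (forall k, k \in B -> (k < m)%N) ->
  cube_sum (tog m B) = z B m (+) cube_sum B.
Proof.
move=> Bm; have mB : m \notin B by apply/negP => /Bm; rewrite ltnn.
have mT : m \in tog m B by rewrite in_tog eqxx (negPf mB).
rewrite /cube_sum (bigD1 m) //=; congr (_ (+) _).
  congr (z _ m); apply/setP => k; rewrite !inE.
  by case: (eqVneq k m) => [->|]; rewrite ?ltnn ?(negPf mB) ?andbF //= addbF;
    case: (boolP (k \in B)) => //= /Bm ->.
apply: eq_big => [k|k /andP[kT km]].
  by rewrite in_tog; case: (eqVneq k m) => [->|]; rewrite ?(negPf mB) ?addbF ?andbT ?andbF.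
have kB : k \in B by move: kT; rewrite in_tog (negPf km) addbF.
congr (z _ k); apply/setP => l; rewrite !inE; case: (eqVneq l m) => [->|]; rewrite ?addbF //.
by rewrite ltnNge (ltnW (Bm _ kB)) !andbF.
Qed.

(** If [i] is not above all of [A], take away the largest element [m] of [A]; the square spanned by
    [i] and [m] reduces the claim to the smaller set. *)
Lemma cube_sum_tog A i : i \notin A -> cube_sum (tog i A) = z A i (+) cube_sum A.
Proof.
have [N] := ubnP #|A|; elim: N A => // N IH A le iA.
case: (pickP [pred k in A | (i < k)%N]) => [k0 /andP[k0A ik0]|no]; last first.
  apply: cube_sum_max => k kA; have := no k; rewrite /= kA /= ltnNge => /negbFE ki.
  by rewrite ltn_neqAle ki andbT; apply: contraNneq iA => /val_inj <-.
case: (arg_maxnP (fun k : 'I_n => k) k0A) => m mA mmax.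
have {}mA : m \in A by exact: mA.
have {}mmax k : k \in A -> (k <= m)%N by move=> kA; apply: mmax.
have im : (i < m)%N by apply: leq_trans ik0 (mmax _ k0A).
have ni : i != m by rewrite neq_ltn im.
pose B := tog m A; have eA : A = tog m B by rewrite togK.
have mB : m \notin B by rewrite in_tog mA eqxx.
have kB k : k \in B -> (k < m)%N.
  rewrite in_tog; case: (eqVneq k m) => [->|km]; first by rewrite mA.
  by rewrite addbF => /mmax; rewrite leq_eqVlt => /orP[/eqP/val_inj e|//]; rewrite e eqxx in km.
have iB : i \notin B by rewrite in_tog (negPf iA) (negPf ni).
have lB : (#|B| < N)%N.
  rewrite -ltnS; apply: leq_trans le; rewrite ltnS; apply: proper_card.
  apply/properP; split; last by exists m.
  by apply/subsetP => k; rewrite in_tog; case: eqP => [->|]; rewrite ?mA ?addbF.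
have kiB k : k \in tog i B -> (k < m)%N.
  by rewrite in_tog; case: (eqVneq k i) => [->//|_]; rewrite addbF => /kB.
rewrite eA togC (cube_sum_max kiB) (cube_sum_max kB).
rewrite IH //; have := z_square ni iB mB.
by case: (z B i) (z B m) (z (tog i B) m) (z (tog m B) i) (cube_sum B) => [] [] [] [] [].
Qed.

End CubeCohomology.

(** * Isomorphisms of subquotients *)

Section SubquotientIso.
Local Open Scope quotient_scope.
Variables (V V' : zmodType) (Z B : zmodClosed V) (Z' B' : zmodClosed V').
Variables (p : {additive V -> V'}) (q : {additive V' -> V}).
Hypotheses (pZ : forall x, x \in Z -> p x \in Z') (qZ : forall x, x \in Z' -> q x \in Z).
Hypotheses (pB : forall x, x \in Z -> x \in B -> p x \in B').
Hypotheses (qB : forall x, x \in Z' -> x \in B' -> q x \in B).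
Hypotheses (pK : forall x, x \in Z -> q (p x) = x) (qK : forall x, x \in Z' -> p (q x) = x).

(** The maps are mutually inverse on [Z] and [Z'] only: the ambient groups also contain monomials in
    sets that are not circles, on which the chain maps need not be inverse. *)
Lemma subquotient_iso : exists f : {additive subquotient Z B -> subquotient Z' B'}, bijective f.
Proof.
have pP (x : subgrp Z) : p (val x) \in Z' by apply: pZ; apply: valP.
have qP (x : subgrp Z') : q (val x) \in Z by apply: qZ; apply: valP.
pose ps (x : subgrp Z) : subgrp Z' := Sub (p (val x)) (pP x).
pose qs (x : subgrp Z') : subgrp Z := Sub (q (val x)) (qP x).
pose f (u : subquotient Z B) : subquotient Z' B' := \pi_(subquotient Z' B') (ps (repr u)).
pose g (u : subquotient Z' B') : subquotient Z B := \pi_(subquotient Z B) (qs (repr u)).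
have fpi x : f (\pi_(subquotient Z B) x) = \pi_(subquotient Z' B') (ps x).
  apply/eqP; rewrite -Quotient.idealrBE; case: piP => y /eqP.
  rewrite -Quotient.idealrBE !inE !raddfB /= => xyB.
  have := pB (valP (x - y)) ; rewrite raddfB /= => /(_ xyB).
  by rewrite raddfB -opprB rpredN.
have gpi x : g (\pi_(subquotient Z' B') x) = \pi_(subquotient Z B) (qs x).
  apply/eqP; rewrite -Quotient.idealrBE; case: piP => y /eqP.
  rewrite -Quotient.idealrBE !inE !raddfB /= => xyB.
  have := qB (valP (x - y)) ; rewrite raddfB /= => /(_ xyB).
  by rewrite raddfB -opprB rpredN.
have fadd : zmod_morphism f.
  move=> u v; rewrite -[u]reprK -[v]reprK -raddfB !fpi -raddfB; congr (\pi_(_) _).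
  by apply: val_inj; rewrite /= !raddfB.
pose F : {additive subquotient Z B -> subquotient Z' B'} :=
  HB.pack f (GRing.isZmodMorphism.Build _ _ f fadd).
exists F; exists g => u.
  rewrite -[u]reprK /= fpi gpi; congr (\pi_(_) _); apply: val_inj.
  exact: pK (valP (repr u)).
rewrite -[u]reprK gpi /= fpi; congr (\pi_(_) _); apply: val_inj.
exact: qK (valP (repr u)).
Qed.

End SubquotientIso.

(** * Restricted configurations as states of the diagram *)

Section ConfigSurgery.
Variables (n : nat) (D : diagram n) (k : nat).
Local Notation H := (res_hs D).
Variables (thr : H -> H) (tip : 'I_k * bool * bool -> H).
Variables (segK : involutive (@res_seg n D)) (seg_neq : forall h, @res_seg n D h != h).
Variables (thrK : involutive thr) (thr_neq : forall h, thr h != h).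
Variables (tip_inj : injective tip).
Variable (thr_tip : forall p e s, thr (tip (p, e, s)) = tip (p, e, ~~ s)).
Let C : config k := Config segK seg_neq thrK thr_neq tip_inj thr_tip.
Variables (A : {set 'I_n}) (st : 'I_k -> 'I_n) (o : 'I_n -> bool).
Hypothesis st_inj : injective st.
Hypothesis thrE : thr =1 state_thr A.
Hypothesis tipE : forall p e s, tip (p, e, s) = inl (st p, e (+) o (st p), s).
Hypothesis stA : forall p, st p \notin A.

Lemma surg_state (S : {set 'I_k}) :
  surg_thr (C := C) S =1 state_thr [set q | (q \in A) (+) (q \in st @: S)].
Proof.
move=> u; have [[p [e [s [pS ->]]]]|hP] := @surg_case _ C S u.
  rewrite surg_thr_tip pS /= !tipE /= /link /= inE (negPf (stA p)) mem_imset // pS /=.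
  by rewrite addbT addNb.
rewrite surg_thr_out //= thrE; case: u hP => [[[i e] s]|//] hP /=.
rewrite /link /= inE; case: imsetP => [[p pS /= ip]|_]; last by rewrite addbF.
have := hP (p, e (+) o i, s) pS.
by rewrite /= tipE -ip addbK eqxx.
Qed.

End ConfigSurgery.

Section Resolved.
Variables (n : nat) (D : diagram n) (o : 'I_n -> bool).
Local Notation H := (res_hs D).
Local Notation E := (edge D).
Local Notation C := (reorient (zero_resolution D) o).
Variable col : 'I_n -> bool.
Hypothesis colour_E : forall x, colour col (E x) = ~~ colour col x.

Lemma surg_reorient (S : {set 'I_n}) : surg_thr (C := C) S =1 state_thr S.
Proof.
move=> u.
have e : [set q : 'I_n | (q \in set0) (+) (q \in id @: S)] = S.
  by apply/setP => q; rewrite in_set imset_id in_set0.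
rewrite -[in RHS]e; apply: (@surg_state _ _ _ _ _ _ _ _ _ _ _ _ _ o); first exact: inj_id.
- by move=> [[[i a] s]|[l a]] //=; rewrite /link /= in_set0 addbF.
- by [].
by move=> p; rewrite in_set0.
Qed.

Lemma circles_restr k (a : face n k) : circles (restr C a) = circs D (ones a).
Proof.
apply: eq_imset => h; apply/setP => u; rewrite inE in_circ; apply: eq_connect => v w.
by rewrite /circ_rel /state_rel /= surg_reorient.
Qed.

Lemma edge_is_edge (b : face n 1) :
  is_edge (D := D) (o (star b ord0)) (ones b) (star b ord0) (edge_map (C := restr C b)).
Proof.
apply: edge_map_is_edge colour_E; [exact: surg_reorient|by []|exact: star_ones].
Qed.

Lemma star_cube_edge k (p : 'I_k) (v : 'I_k -> bool) : star (cube_edge p v) ord0 = p.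
Proof. by apply/eqP; have := starP (cube_edge p v) ord0; rewrite ffunE; case: eqP. Qed.

Lemma square_edge (s : face n 2) (p p' : 'I_2) (v : bool) : p != p' ->
  is_edge (D := D) (o (star s p)) (if v then tog (star s p') (ones s) else ones s)
    (star s p) (edge_map (C := restr (restr C s) (cube_edge p (fun=> v)))).
Proof.
move=> pp'; set B := if v then _ else _.
have eB : [set q | (q \in ones s) (+) (q \in star s @: ones (cube_edge p (fun=> v)))] = B.
  have eo : ones (cube_edge p (fun=> v)) = if v then [set p'] else set0.
    apply/setP => q; rewrite inE ffunE.
    have : (q == p) = (q != p').
      by move: q p p' pp' {B} => [[|[|?]] ?] [[|[|?]] ?] [[|[|?]] ?].
    by case: (eqVneq q p') => [->|np'] ->; case: (v); rewrite ?inE ?eqxx ?(negPf np').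
  apply/setP => q; rewrite in_set eo /B; case: (v); last by rewrite imset0 in_set0 addbF.
  by rewrite imset_set1 in_set1 in_tog.
apply: edge_map_is_edge colour_E.
- move=> h; rewrite -eB; apply: (@surg_state _ _ _ _ _ _ _ _ _ _ _ _ _ o).
  + exact: star_inj.
  + exact: surg_reorient.
  + by [].
  + exact: star_ones.
- by move=> e t; rewrite /res_tip /= star_cube_edge.
rewrite /B; case: (v); last exact: star_ones.
by rewrite in_tog (negPf (star_ones s p)) (inj_eq (@star_inj _ _ s)) (negPf pp').
Qed.

End Resolved.

(** * Edges and squares of the cube *)

Section FaceCombinatorics.
Variable n : nat.
Implicit Types (A B : {set 'I_n}) (i j k : 'I_n).

Lemma star_surj l (a : face n l) k : val a k = None -> exists p, star a p = k.
Proof.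
move=> ak; have kS : k \in stars (val a) by rewrite inE ak.
exists (cast_ord (eqP (valP a)) (enum_rank_in kS k)).
by rewrite /star cast_ordK enum_rankK_in.
Qed.

Lemma val_face l (a : face n l) k : val a k = if k \in stars (val a) then None else Some (k \in ones a).
Proof. by rewrite !inE; case: (val a k) => [[]|]. Qed.

Definition mk_edge A i : face n 1 := cube_edge i (fun k => k \in A).

Lemma star_mk_edge A i : star (mk_edge A i) ord0 = i.
Proof. exact: star_cube_edge. Qed.

Lemma ones_mk_edge A i : i \notin A -> ones (mk_edge A i) = A.
Proof.
move=> iA; apply/setP => k; rewrite inE ffunE.
by case: (eqVneq k i) => [->|_]; [rewrite (negPf iA)|case: (k \in A)].
Qed.

Lemma mk_edgeE (b : face n 1) : mk_edge (ones b) (star b ord0) = b.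
Proof.
apply: val_inj; apply/ffunP => k; rewrite ffunE (val_face b k) [_ \in stars _]inE.
case: (eqVneq k (star b ord0)) => [->|nk]; first by rewrite starP.
case: eqP => [/star_surj [p pk]|//]; rewrite -pk (ord1 p) eqxx in nk; by [].
Qed.

Section Square.
Variable s : face n 2.
Let i := star s ord0.
Let j := star s ord_max.
Let A := ones s.

Lemma star2_neq : i != j.
Proof. by rewrite (inj_eq (@star_inj _ _ s)). Qed.

Lemma val_square k : val s k = if (k == i) || (k == j) then None else Some (k \in A).
Proof.
case: eqVneq => [->|ki]; first exact: starP.
case: eqVneq => [->|kj]; first exact: starP.
rewrite val_face inE; case: eqP => // /star_surj [[[|[|//]] p] pk]; rewrite -pk in ki kj.
  by move: ki; rewrite (_ : Ordinal p = ord0) ?eqxx //; apply: val_inj.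
by move: kj; rewrite (_ : Ordinal p = ord_max) ?eqxx //; apply: val_inj.
Qed.

Lemma subface_square (b : face n 1) : subface b s =
  (b \in [:: mk_edge A i; mk_edge (tog i A) j; mk_edge A j; mk_edge (tog j A) i]).
Proof.
have ij := star2_neq; have iA : i \notin A by exact: star_ones.
have jA : j \notin A by exact: star_ones.
have iff_val (b' : face n 1) : (b == b') = (val b == val b') by rewrite val_eqE.
apply/forallP/idP => [sub|].
  have {}sub k : k != i -> k != j -> val b k = Some (k \in A).
    move=> ki kj; have := sub k; rewrite val_square (negPf ki) (negPf kj) /=.
    by move=> /eqP.
  have mk B l : (forall k, val b k = if k == l then None else Some (k \in B)) -> b = mk_edge B l.
    by move=> h; apply: val_inj; apply/ffunP => k; rewrite h ffunE.
  pose l := star b ord0.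
  have bl k : (val b k == None) = (k == l).
    apply/eqP/eqP => [/star_surj [p <-]|->]; last exact: starP.
    by rewrite (ord1 p).
  have lij : (l == i) || (l == j).
    have lN : val b l = None by exact: starP.
    by apply/negPn/negP => /norP[li lj]; rewrite sub in lN.
  have side B k m : l = k -> (m == i) && (k == j) || (m == j) && (k == i) ->
      B = (if val b m == Some true then tog m A else A) -> b = mk_edge B k.
    move=> lk mk' BE; apply: mk => q; rewrite -lk.
    case: (eqVneq q l) => [->|ql]; first exact: starP.
    have qN : val b q != None by rewrite bl.
    case: (eqVneq q m) => [->|qm].
      have mA : m \in A = false by case/orP: mk' => /andP[/eqP-> _]; apply: negbTE.
      have mN : val b m != None.
        rewrite bl lk; by case/orP: mk' => /andP[/eqP-> /eqP->]; rewrite ?ij // eq_sym.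
      rewrite BE; case: (val b m) mN => [[]|] //= _; by rewrite ?in_tog ?mA ?eqxx.
    rewrite sub; first by rewrite BE; case: ifP => _ //; rewrite in_tog (negPf qm) addbF.
      by case/orP: mk' => /andP[/eqP mE /eqP kE]; rewrite ?lk ?kE ?mE in ql qm *.
    by case/orP: mk' => /andP[/eqP mE /eqP kE]; rewrite ?lk ?kE ?mE in ql qm *.
  rewrite !inE; case/orP: lij => /eqP lE.
    rewrite (side _ i j lE _ erefl) ?eqxx ?orbT //; by case: ifP; rewrite eqxx ?orbT.
  rewrite (side _ j i lE _ erefl) ?eqxx ?orbT //; by case: ifP; rewrite eqxx ?orbT.
rewrite !inE => h k; rewrite val_square.
case: (eqVneq k i) => //= ki; case: (eqVneq k j) => //= kj.
by case/or4P: h => /eqP->; rewrite ffunE ?(negPf ki) ?(negPf kj) //= ?in_tog ?(negPf ki) ?(negPf kj) ?addbF.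
Qed.

Lemma uniq_square :
  uniq [:: mk_edge A i; mk_edge (tog i A) j; mk_edge A j; mk_edge (tog j A) i].
Proof.
have ij := star2_neq; have ji : j != i by rewrite eq_sym.
have iA : i \notin A by exact: star_ones.
have jA : j \notin A by exact: star_ones.
have st B k B' l : k != l -> mk_edge B k != mk_edge B' l.
  by apply: contraNneq => /(congr1 (fun b => star b ord0)); rewrite !star_mk_edge => ->.
have on k l : k != l -> k \notin A -> l \notin A -> mk_edge A k != mk_edge (tog l A) k.
  move=> kl kA lA; apply/eqP => /(congr1 (@ones n 1)); rewrite !ones_mk_edge ?in_tog ?(negPf kA) //.
  by move=> /setP/(_ l); rewrite in_tog eqxx (negPf lA).
have h1 := on i j ij iA jA; have h2 := on j i ji jA iA; rewrite eq_sym in h2.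
by rewrite /= !inE !negb_or h1 h2 !(st _ _ _ _ ij) !(st _ _ _ _ ji).
Qed.

Lemma prod_square (eps : face n 1 -> int) : square_sign eps s =
  eps (mk_edge A i) * eps (mk_edge (tog i A) j) * eps (mk_edge A j) * eps (mk_edge (tog j A) i).
Proof.
rewrite /square_sign (eq_bigl _ _ subface_square) -big_uniq ?uniq_square //=.
by rewrite !big_cons big_nil mulr1 !mulrA.
Qed.

End Square.

Section MakeSquare.
Variables (A : {set 'I_n}) (i j : 'I_n).
Hypotheses (ij : i != j) (iA : i \notin A) (jA : j \notin A).

Definition square_fun : {ffun 'I_n -> option bool} :=
  [ffun k => if (k == i) || (k == j) then None else Some (k \in A)].

Lemma square_subproof : #|stars square_fun| == 2%N.
Proof.
have -> : stars square_fun = [set i; j].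
  by apply/setP => k; rewrite !inE ffunE; case: (_ || _).
by rewrite cards2 ij.
Qed.

Definition mk_square : face n 2 := exist _ square_fun square_subproof.

Lemma ones_mk_square : ones mk_square = A.
Proof.
apply/setP => k; rewrite inE ffunE.
case: (eqVneq k i) => [->|_] /=; first by rewrite (negPf iA).
by case: (eqVneq k j) => [->|_]; [rewrite (negPf jA)|case: (k \in A)].
Qed.

(** Stars are numbered in increasing order, and the order of [i] and [j] is not known. *)
Lemma star_mk_square :
  (star mk_square ord0 = i /\ star mk_square ord_max = j) \/
  (star mk_square ord0 = j /\ star mk_square ord_max = i).
Proof.
have h p : star mk_square p = i \/ star mk_square p = j.
  have := starP mk_square p; rewrite ffunE.
  by case: eqP => [|_]; [left|case: eqP; [right|]].
have := star2_neq mk_square.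
by case: (h ord0) => ->; case: (h ord_max) => ->; rewrite ?eqxx //; [left|right].
Qed.

End MakeSquare.
End FaceCombinatorics.

Lemma ext_neq_signs (S : finType) (x y : ext S) (a b : bool) :
  x <> 0 -> x = y *~ (-1) ^+ a -> x = y *~ (-1) ^+ b -> a = b.
Proof.
move=> x0 xa xb; apply: contra_notP x0 => /eqP ab.
have xy : x = - x.
  by rewrite {1}xa {1}xb; case: a b ab {xa xb} => [] [] //= _;
    rewrite ?expr0 ?expr1 ?mulr1z ?mulrN1z ?opprK.
apply/ffunP => E; have := congr1 (fun f : ext S => f E) xy.
by rewrite /= ext_oppE ffunE; lia.
Qed.

Lemma mulz_sign_add (V : zmodType) (x : V) (a b : bool) :
  x *~ (-1) ^+ a *~ (-1) ^+ b = x *~ (-1) ^+ (a (+) b).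
Proof. by case: a b => [] []; rewrite ?expr0 ?expr1 ?mulr1z ?mulrN1z ?opprK. Qed.

(** The groups are the sign exponents of two assignments and of [eta] on the four edges of a square;
    they are collected edge by edge. *)
Lemma addb_regroup (a b c d x y z w p q r s : bool) :
  a (+) b (+) (c (+) d) (+) (x (+) y (+) (z (+) w)) = p (+) q (+) (r (+) s) ->
  a (+) x (+) p (+) (b (+) y (+) q) = c (+) z (+) r (+) (d (+) w (+) s).
Proof.
have -> : a (+) b (+) (c (+) d) (+) (x (+) y (+) (z (+) w)) =
    a (+) x (+) (b (+) y) (+) (c (+) z (+) (d (+) w)).
  by case: a b c d x y z w => [] [] [] [] [] [] [] [].
move: (a (+) x) (b (+) y) (c (+) z) (d (+) w) => {}a {}b {}c {}d.
by case: a b c d p q r s => [] [] [] [] [] [] [] [].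
Qed.

Lemma intr_sign_inj (a b : bool) : (-1) ^+ a = (-1) ^+ b :> int -> a = b.
Proof. by case: a b => [] []. Qed.

(** * Signs of the two assignments on squares *)

Section Signs.
Variables (n : nat) (D : diagram n).
Local Notation H := (res_hs D).
Local Notation E := (edge D).
Variable col : 'I_n -> bool.
Hypothesis colour_E : forall x, colour col (E x) = ~~ colour col x.
Hypothesis planar :
  (n_comp (circ_r E (all_white col)) predT + n_comp (circ_r E (all_black col)) predT =
  #|'I_n| + (n_comp (total E) predT).*2)%N.
Implicit Types (A : {set 'I_n}) (i j : 'I_n) (o : 'I_n -> bool).
Local Notation conf o := (reorient (zero_resolution D) o).
Local Notation one := (one {set H}).

Definition alternating A i j :=
  [&& self E A i, self E A j, ~~ self E (tog i A) j & ~~ self E (tog j A) i].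

(* The sign by which the edge map at [i] fails to commute with [Phi (phi col _)]
  when the arcs are reoriented from [o] to [o']. *)
Definition eta o o' A i : bool :=
  self E A i && (o i (+) o' i (+) black col (tog i A) i).

Section OneSquare.
Variable s : face n 2.
Let i := star s ord0.
Let j := star s ord_max.
Let A := ones s.

Let ij : i != j := star2_neq s.
Let iA : i \notin A := star_ones s ord0.
Let jA : j \notin A := star_ones s ord_max.

(* In the alternating case this bit tells whether the square is of type Y or X. *)
Definition order_bit o :=
  connect (circ_r E (tog i A)) (i, o i, false) (j, o j, true).

Section Orientation.
Variable o : 'I_n -> bool.

Let F v p : ext {set H} -> ext {set H} :=
  edge_map (C := restr (restr (conf o) s) (cube_edge p (fun=> v))).

Let Fi : is_edge (D := D) (o i) A i (F false ord0).
Proof. exact: (@square_edge _ _ o _ colour_E s ord0 ord_max false). Qed.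
Let Fj : is_edge (D := D) (o j) A j (F false ord_max).
Proof. exact: (@square_edge _ _ o _ colour_E s ord_max ord0 false). Qed.
Let Gi : is_edge (D := D) (o i) (tog j A) i (F true ord0).
Proof. exact: (@square_edge _ _ o _ colour_E s ord0 ord_max true). Qed.
Let Gj : is_edge (D := D) (o j) (tog i A) j (F true ord_max).
Proof. exact: (@square_edge _ _ o _ colour_E s ord_max ord0 true). Qed.

(** The bit [t] distinguishes A from K. The edge maps are returned too, so that two orientations can
    be compared at [one]. *)
Lemma square_KA : ~~ alternating A i j -> exists F1 F2 G1 G2, exists t : bool,
  [/\ is_edge (D := D) (o i) A i F1, is_edge (D := D) (o j) A j F2,
      is_edge (D := D) (o i) (tog j A) i G1 & is_edge (D := D) (o j) (tog i A) j G2] /\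
  [/\ if t then type_A (restr (conf o) s) else type_K (restr (conf o) s),
      G2 (F1 one) = G1 (F2 one) *~ (-1) ^+ t & G2 (F1 one) <> 0].
Proof.
move=> nalt; have [[t PQ] nz] := square_cases colour_E Fi Gj Fj Gi nalt.
exists (F false ord0); exists (F false ord_max); exists (F true ord0); exists (F true ord_max).
exists t; split; first by split.
split; [|exact: PQ|exact: nz].
case: t PQ => PQ.
  split; last by exists one.
  move=> f; have := PQ f; rewrite expr1 mulrN1z; exact.
split; last by exists one.
move=> f; have := PQ f; rewrite expr0 mulr1z; exact.
Qed.

(** Travelling from the start of [i], the first end of [j] is the one left on the same circle by the
    surgery at [i]; [order_bit] tells whether it is the start of [j]. *)
Lemma square_XY : alternating A i j ->
  if order_bit o then square_Y (restr (conf o) s) else square_X (restr (conf o) s).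
Proof.
case/and4P=> si sj sij sji.
have trE : travel (C := restr (conf o) s) = travelH (D := D) A.
  apply/funext => h; rewrite /travel /travelH /=; apply: surg_reorient.
have ord v : connect (circ_r E (tog i A)) (i, o i, false) (j, v (+) o j, true) ->
    clockwise_from_start (restr (conf o) s) ord0 ord_max v.
  move/(alternating_order colour_E planar ij iA jA si sj sij).
  have nv : ~~ (v (+) o j) = ~~ v (+) o j by rewrite addNb.
  by rewrite nv /clockwise_from_start trE.
rewrite /order_bit; case: (boolP (connect _ _ _)) => [c|nc].
  exists ord0; exists ord_max; split=> //; exact: (ord false).
exists ord0; exists ord_max; split=> //; apply: (ord true).
have e : connect (circ_r E (tog i A)) (i, o i, false) (j, true (+) o j, true) =
    ~~ connect (circ_r E (tog i A)) (i, o i, false) (j, o j, true).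
  exact: (@alt_opp _ _ _ colour_E _ _ _ si sj sij (i, o i, false) (j, o j, true) erefl erefl).
by rewrite e nc.
Qed.

End Orientation.
Lemma path_intertwine o o' k l F F' G G' :
  is_edge (D := D) (o k) A k F -> is_edge (D := D) (o' k) A k F' ->
  is_edge (D := D) (o l) (tog k A) l G -> is_edge (D := D) (o' l) (tog k A) l G' ->
  Phi (phi col (tog l (tog k A))) (G (F one)) =
  G' (F' one) *~ (-1) ^+ (eta o o' A k (+) eta o o' (tog k A) l).
Proof.
move=> Fe Fe' Ge Ge'; have s1 : supp (circs D A) one by exact: supp_one.
rewrite (edge_intertwine colour_E planar Ge Ge'); last exact: (edge_supp Fe s1).
rewrite (edge_intertwine colour_E planar Fe Fe' s1) Phi1 (edgeMz Ge').
exact: mulz_sign_add.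
Qed.

Definition eta_square o o' := eta o o' A i (+) eta o o' (tog i A) j
  (+) (eta o o' A j (+) eta o o' (tog j A) i).

(** The involution carries the relation between the two composites at [one] from [o] to [o']. As the
    composites are nonzero, the resulting sign is determined. *)
Lemma KA_types o o' : ~~ alternating A i j -> exists t t' : bool,
  [/\ if t then type_A (restr (conf o) s) else type_K (restr (conf o) s),
      if t' then type_A (restr (conf o') s) else type_K (restr (conf o') s) &
      t' = t (+) eta_square o o'].
Proof.
move=> nalt.
have [F1 [F2 [G1 [G2 [t [[eF1 eF2 eG1 eG2] [T PQ nz]]]]]]] := square_KA o nalt.
have [F1' [F2' [G1' [G2' [t' [[eF1' eF2' eG1' eG2'] [T' PQ' nz']]]]]]] := square_KA o' nalt.
exists t; exists t'; split=> //.
have := congr1 (Phi (phi col (tog j (tog i A)))) PQ; rewrite raddfMz /=.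
rewrite (path_intertwine eF1 eF1' eG2 eG2') -(togC i j).
rewrite (path_intertwine eF2 eF2' eG1 eG1').
set a := eta _ _ _ _ (+) _; set b := eta _ _ _ _ (+) _.
rewrite mulz_sign_add => h; apply: (ext_neq_signs nz' PQ').
apply: (@mulz_signI _ a); rewrite h mulz_sign_add; congr (_ *~ (-1) ^+ nat_of_bool _).
by rewrite /eta_square -/a -/b; case: (a) (b) (t) => [] [] [].
Qed.

(** Only the first edge of each path is a split. By [alt_black] the two dual arcs have different
    colours, which gives the negation; reorienting the arcs changes both sides equally. *)
Lemma eta_alternating o o' : alternating A i j ->
  eta_square o o' = ~~ (order_bit o (+) order_bit o').
Proof.
case/and4P=> si sj sij sji; rewrite /eta_square /eta si sj (negPf sij) (negPf sji) /=.
rewrite !black_tog !eqxx (alt_black colour_E planar ij si sj sij).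
rewrite /order_bit !(alt_parity colour_E si sj sij (_ _)).
by case: (black col A j) (o i) (o j) (o' i) (o' j) (connect _ _ _) => [] [] [] [] [] [].
Qed.

Lemma sign_square o eps : edge_assignment (n := n) eps ->
  square_sign eps s = (-1) ^+ ((eps (mk_edge A i) == -1) (+) (eps (mk_edge (tog i A) j) == -1) (+)
    ((eps (mk_edge A j) == -1) (+) (eps (mk_edge (tog j A) i) == -1))).
Proof.
move=> ea; have e b : eps b = (-1) ^+ (eps b == -1) by case: (ea b) => ->.
rewrite prod_square !signr_addb -!e; ring.
Qed.

(** On alternating squares the assignments treat X and Y in opposite ways, which matches the
    negation in [eta_alternating]; on the others both follow K and A, and [KA_types] applies. *)
Lemma assignment_signs o o' eps eps' :
  assignment_X (conf o) eps -> assignment_Y (conf o') eps' ->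
  square_sign eps s * square_sign eps' s = (-1) ^+ eta_square o o'.
Proof.
move=> [_ /(_ s) [X1 X2]] [_ /(_ s) [Y1 Y2]].
case: (boolP (alternating A i j)) => [alt|nalt].
  have := square_XY o' alt; have := square_XY o alt; rewrite eta_alternating //.
  case: (order_bit o) => h; case: (order_bit o') => h'.
  - by rewrite (X2 (or_intror h)) (Y1 (or_intror h')) ?mulrNN ?mulr1 ?mul1r.
  - by rewrite (X2 (or_intror h)) (Y2 (or_intror h')) ?mulrNN ?mulr1 ?mul1r.
  - by rewrite (X1 (or_intror h)) (Y1 (or_intror h')) ?mulrNN ?mulr1 ?mul1r.
  by rewrite (X1 (or_intror h)) (Y2 (or_intror h')) ?mulrNN ?mulr1 ?mul1r.
have [t [t' [T T' tt]]] := KA_types o o' nalt.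
have -> : eta_square o o' = t (+) t' by rewrite tt addbA addbb.
case: t T {tt} => T; case: t' T' => T'.
- by rewrite (X1 (or_introl T)) (Y1 (or_introl T')) ?mulrNN ?mulr1 ?mul1r.
- by rewrite (X1 (or_introl T)) (Y2 (or_introl T')) ?mulrNN ?mulr1 ?mul1r.
- by rewrite (X2 (or_introl T)) (Y1 (or_introl T')) ?mulrNN ?mulr1 ?mul1r.
by rewrite (X2 (or_introl T)) (Y2 (or_introl T')) ?mulrNN ?mulr1 ?mul1r.
Qed.

End OneSquare.

Section Cochain.
Variables (o o' : 'I_n -> bool) (eps eps' : face n 1 -> int).
Hypothesis epsX : assignment_X (conf o) eps.
Hypothesis epsY : assignment_Y (conf o') eps'.

(** The obstruction on each edge to the involutions forming a chain map; [assignment_signs] says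
    that it is closed modulo 2. *)
Definition cochain A i : bool :=
  (eps (mk_edge A i) == -1) (+) (eps' (mk_edge A i) == -1) (+) eta o o' A i.

Lemma cochain_square A i j : i != j -> i \notin A -> j \notin A ->
  cochain A i (+) cochain (tog i A) j = cochain A j (+) cochain (tog j A) i.
Proof.
move=> ij iA jA; pose s := mk_square A ij.
have key : cochain (ones s) (star s ord0) (+) cochain (tog (star s ord0) (ones s)) (star s ord_max) =
    cochain (ones s) (star s ord_max) (+) cochain (tog (star s ord_max) (ones s)) (star s ord0).
  have := assignment_signs s epsX epsY.
  rewrite !sign_square ?(proj1 epsX) ?(proj1 epsY) //; try by case: epsX; try by case: epsY.
  by rewrite -signr_addb => /intr_sign_inj; apply: addb_regroup.
move: key; rewrite ones_mk_square //.
by case: (star_mk_square A ij) => -[-> ->] // ->.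
Qed.

Definition twist : {set 'I_n} -> bool := cube_sum cochain.

Lemma twist_edge (b : face n 1) : let A := ones b in let i := star b ord0 in
  twist (tog i A) = twist A (+) (eps b == -1) (+) (eps' b == -1) (+) eta o o' A i.
Proof.
rewrite /= /twist (cube_sum_tog cochain_square (star_ones b ord0)) /cochain mk_edgeE.
by rewrite addbC !addbA.
Qed.

End Cochain.
End Signs.

(** * The chain isomorphism *)

Section ChainMap.
Variables (n : nat) (D : diagram n).
Local Notation H := (res_hs D).
Local Notation E := (edge D).
Variable col : 'I_n -> bool.
Hypothesis colour_E : forall x, colour col (E x) = ~~ colour col x.
Hypothesis planar :
  (n_comp (circ_r E (all_white col)) predT + n_comp (circ_r E (all_black col)) predT =
  #|'I_n| + (n_comp (total E) predT).*2)%N.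
Local Notation conf o := (reorient (zero_resolution D) o).

Lemma ones_fill v (b : face n 1) :
  ones (fill v b) = if v then tog (star b ord0) (ones b) else ones b.
Proof.
have e k : (k \in ones (fill v b)) = odflt v (val b k) by rewrite inE ffunE; case: (odflt v (val b k)).
apply/setP => k; rewrite e; case bk: (val b k) => [w|] /=.
  have kb : k != star b ord0.
    by apply/eqP => kb; rewrite kb starP in bk.
  have -> : w = (k \in ones b) by rewrite inE bk; case: (w).
  by case: v {e}; rewrite ?in_tog ?(negPf kb) ?addbF.
have [p pk] := star_surj bk; rewrite (ord1 p) in pk.
by case: v {e}; rewrite -pk ?in_tog ?eqxx (negPf (star_ones b ord0)).
Qed.

Section Map.
Variables (o o' : 'I_n -> bool) (tw : {set 'I_n} -> bool).

Definition chain_map (f : chain (conf o)) : chain (conf o') :=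
  [ffun a : face n 0 => Phi (phi col (ones a)) (f a : ext {set H}) *~ (-1) ^+ tw (ones a)].

Lemma chain_map_is_zmod_morphism : zmod_morphism chain_map.
Proof. by move=> f g; apply/ffunP => a; rewrite !ffunE raddfB mulrzBl. Qed.

HB.instance Definition _ :=
  GRing.isZmodMorphism.Build _ _ chain_map chain_map_is_zmod_morphism.

Lemma homog_supp h d (f : chain (conf o)) a : homog h d f -> supp (circs D (ones a)) (f a : ext {set H}).
Proof.
move=> /forallP/(_ a)/forallP hf A nz; have /implyP/(_ nz)/and3P[] := hf A.
by rewrite circles_restr.
Qed.

Lemma chain_map_homog h d f : homog h d f -> homog h d (chain_map f).
Proof.
move=> hf; apply/forallP => a; apply/forallP => A; apply/implyP.
rewrite ffunE ext_mulzE mulf_eq0 negb_or => /andP[nz _].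
have sub c c' : c \in circs D (ones a) -> phi col (ones a) c c' != 0 -> c' \in circs D (ones a).
  by move=> _; apply: contraNT => /phi_out ->.
have [sA [B fB cB]] := Phi_neq0 sub (homog_supp (a := a) hf) nz.
have /forallP/(_ a)/forallP/(_ B)/implyP/(_ fB)/and3P[_ eh ed] := hf.
by move: ed; rewrite /delta_deg !circles_restr cB => ed; rewrite sA eh.
Qed.

End Map.

Lemma chain_mapK o o' tw h d (f : chain (conf o)) : homog h d f ->
  chain_map o tw (chain_map o' tw f) = f.
Proof.
move=> hf; apply/ffunP => a; rewrite !ffunE raddfMz /= mulz_signK.
exact: (Phi_stK colour_E planar (homog_supp hf)).
Qed.

(** Homogeneity confines the chain at each vertex to wedge products of circles, where
    [edge_intertwine] applies. *)
Lemma chain_map_diff o o' tw eps eps' h d (f : chain (conf o)) :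
  edge_assignment eps -> edge_assignment eps' ->
  (forall b : face n 1, let A := ones b in let i := star b ord0 in
    tw (tog i A) = tw A (+) (eps b == -1) (+) (eps' b == -1) (+) eta D col o o' A i) ->
  homog h d f ->
  diff eps' (chain_map o' tw f) = chain_map o' tw (diff eps f).
Proof.
move=> ea ea' twE hf; apply/ffunP => a; rewrite ffunE [RHS]ffunE.
rewrite [X in Phi _ X]ffunE raddf_sum mulrz_suml; apply: eq_bigr => b /eqP <-.
rewrite !ffunE !ones_fill raddfMz /=.
set A := ones b; set i := star b ord0.
have fA : supp (circs D A) (f (fill false b) : ext {set H}).
  by have := homog_supp (a := fill false b) hf; rewrite ones_fill.
pose g : ext {set H} := edge_map (C := restr (conf o) b) (f (fill false b)).
have ge : Phi (phi col (tog i A)) g = _ :=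
  edge_intertwine colour_E planar (edge_is_edge o colour_E b) (edge_is_edge o' colour_E b) fA.
transitivity (Phi (phi col (tog i A)) g *~ eps b *~ (-1) ^+ tw (tog i A)); last first.
  by congr (_ *~ _); exact: esym (raddfMz (Phi (phi col (tog i A))) (eps b) g).
rewrite ge.
have e : eps b = (-1) ^+ (eps b == -1) by case: (ea b) => ->.
have e' : eps' b = (-1) ^+ (eps' b == -1) by case: (ea' b) => ->.
rewrite e e' !mulz_sign_add twE /eta -/A -/i.
congr (_ *~ (-1) ^+ nat_of_bool _).
by case: (tw A) (eps b == -1) (eps' b == -1) (_ && _) => [] [] [] [].
Qed.

Section Homology.
Variables (o o' : 'I_n -> bool) (tw : {set 'I_n} -> bool) (eps eps' : face n 1 -> int).
Hypotheses (ea : edge_assignment eps) (ea' : edge_assignment eps').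
Hypothesis twE : forall b : face n 1, let A := ones b in let i := star b ord0 in
  tw (tog i A) = tw A (+) (eps b == -1) (+) (eps' b == -1) (+) eta D col o o' A i.
Variables (h d : int).

Lemma chain_map_cycles (f : chain (conf o)) :
  f \in cycles eps h d -> chain_map o' tw f \in cycles eps' h d.
Proof.
rewrite !inE => /andP[hf /eqP df]; rewrite chain_map_homog //=.
by rewrite (chain_map_diff ea ea' twE hf) df raddf0.
Qed.

Lemma chain_map_boundaries (f : chain (conf o)) :
  f \in boundaries eps h d -> chain_map o' tw f \in boundaries eps' h d.
Proof.
rewrite !inE => /asboolP[g hg <-]; apply/asboolP; exists (chain_map o' tw g).
  exact: chain_map_homog.
exact: chain_map_diff hg.
Qed.

End Homology.

End ChainMap.

Theorem proposition1p1 (n : nat) (D : diagram n) (C C' : config n)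
    (eps eps' : face n 1 -> int) :
  resolves D C -> assignment_X C eps ->
  resolves D C' -> assignment_Y C' eps' ->
  bigraded_iso (odd_Kh D C eps) (odd_Kh D C' eps').
Proof.
move=> [o ->] epsX [o' ->] epsY h d; rewrite /odd_Kh /homology.
have [col colour_E planar] := diagram_colouring D.
pose tw := twist D col o o' eps eps'.
have [ea ea'] : edge_assignment eps /\ edge_assignment eps' by case: epsX epsY => [? _] [? _].
have twE := twist_edge colour_E planar epsX epsY.
(* [eta] is symmetric in the two orientations, so the same twist serves the inverse map. *)
have twE' (b : face n 1) : let A := ones b in let i := star b ord0 in
    tw (tog i A) = tw A (+) (eps' b == -1) (+) (eps b == -1) (+) eta D col o' o A i.
  rewrite /= /tw twE /eta [o' _ (+) o _]addbC; set t := twist _ _ _ _ _ _ _.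
  by case: t (eps b == -1) (eps' b == -1) => [] [] [].
apply: (@subquotient_iso _ _ _ _ _ _ (chain_map (o := o) col o' tw)
  (chain_map (o := o') col o tw)).
- move=> f; exact: chain_map_cycles.
- move=> f; exact: chain_map_cycles.
- move=> f _; exact: chain_map_boundaries.
- move=> f _; exact: chain_map_boundaries.
- by move=> f /andP[hf _]; exact: chain_mapK hf.
by move=> f /andP[hf _]; exact: chain_mapK hf.
Qed.
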